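(* Let $\alpha\ge 0$, $\gamma>0$, $0\le\xi\le 1$, let $\mu>0$, $\nu>0$ satisfy $\mu+\nu=\alpha-\gamma$ and $\mu\nu=\gamma$, and let $\lambda:[0,1]\to\mathbb{R}$ be a non-negative integrable function with $\int_0^1\lambda(t)\,dt=1$. Let $\beta<1$ satisfy $$\frac{\beta}{1-\beta}=-\int_0^1\lambda(t)\big[(1-\xi)g(t)+\xi(2q(t)-1)\big]dt .$$ Assume that $t^{1/\nu}\Lambda_\nu(t)\to 0$ and $t^{1/\mu}\Pi_{\mu,\nu}(t)\to 0$ as $t\to 0^+$. For $|\epsilon|=1$ put $h(z)=h_\epsilon(z)=\dfrac{z\left(1+\frac{\epsilon-1}{2}z\right)}{(1-z)^2}$ and $$N_{\Pi_{\mu,\nu}}(h)=\inf_{z\in\mathbb{D}}\int_0^1 t^{1/\mu-1}\,\Pi_{\mu,\nu}(t)\left[(1-\xi)\left(\mathrm{Re}\,\frac{h(tz)}{tz}-\frac{1}{(1+t)^2}\right)+\xi\left(\mathrm{Re}\,h'(tz)-\frac{1-t}{(1+t)^3}\right)\right]dt .$$ Then $N_{\Pi_{\mu,\nu}}(h_\epsilon)\ge 0$ for all $\epsilon$ with $|\epsilon|=1$ if and only if $V_\lambda(f)\in M(\xi)$ for every $f\in W_\beta(\alpha,\gamma)$ (that is, $\xi zF'+(1-\xi)F\in S^\ast$ for every $F=V_\lambda(f)$ with $f\in W_\beta(\alpha,\gamma)$). Moreover the value of $\beta$ is sharp: for every $\beta'<\beta$ there exists $f\in W_{\beta'}(\alpha,\gamma)$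 with $V_\lambda(f)\notin M(\xi)$.
   Context: $\mathbb{D}=\{z\in\mathbb{C}:|z|<1\}$. $\mathcal{A}$ is the class of analytic functions $f$ in $\mathbb{D}$ with $f(0)=f'(0)-1=0$. $S^\ast$ is the class of $f\in\mathcal{A}$ that are univalent with image starlike with respect to the origin, equivalently $\mathrm{Re}\,(zf'(z)/f(z))>0$ in $\mathbb{D}$. For $0\le\xi\le1$, the Pascu class $M(\xi)$ consists of the $f\in\mathcal{A}$ with $\mathrm{Re}\,\dfrac{\xi z(zf'(z))'+(1-\xi)zf'(z)}{\xi zf'(z)+(1-\xi)f(z)}>0$ in $\mathbb{D}$, i.e. $\xi zf'+(1-\xi)f\in S^\ast$. For $\alpha\ge0,\gamma\ge0,\beta<1$, $W_\beta(\alpha,\gamma)$ is the class of $f\in\mathcal{A}$ for which there is $\phi\in\mathbb{R}$ with $\mathrm{Re}\left(e^{i\phi}\left((1-\alpha+2\gamma)\frac{f(z)}{z}+(\alpha-2\gamma)f'(z)+\gamma zf''(z)-\beta\right)\right)>0$ for all $z\in\mathbb{D}$. $V_\lambda(f)(z)=\int_0^1\lambda(t)\frac{f(tz)}{t}\,dt$. $\Lambda_\nu(t)=\int_t^1\frac{\lambda(x)}{x^{1/\nu}}\,dx$ and $\Pi_{\mu,\nu}(t)=\int_t^1\Lambda_\nu(x)\,x^{1/\nu-1-1/\mu}\,dx$. $g$ is the solution of $\frac{d}{dt}\left[t^{1/\nu}(1+g(t))\right]=\frac{2}{\mu\nu}t^{1/\nu-1}\int_0^1\frac{s^{1/\mu-1}}{(1+st)^2}\,ds$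 with $g(0)=1$, with series $g(t)=2\sum_{n=0}^\infty\frac{(n+1)(-1)^nt^n}{(1+\mu n)(1+\nu n)}-1$; $q$ is the solution of $\frac{d}{dt}\left[t^{1/\nu}q(t)\right]=\frac{1}{\mu\nu}t^{1/\nu-1}\int_0^1 s^{1/\mu-1}\frac{1-st}{(1+st)^3}\,ds$ with $q(0)=1$, with series $q(t)=\sum_{n=0}^\infty\frac{(n+1)^2(-1)^nt^n}{(1+\mu n)(1+\nu n)}$. *)

(* Defs.v *)
From HB Require Import structures.
From mathcomp Require Import all_boot all_order all_algebra.
From mathcomp Require Import all_classical all_reals all_analysis.
From mathcomp.real_closed Require Import complex.

Set Implicit Arguments.
Unset Strict Implicit.
Unset Printing Implicit Defensive.

Import Order.TTheory GRing.Theory Num.Theory.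
Import numFieldNormedType.Exports.

Local Open Scope classical_set_scope.
Local Open Scope ring_scope.
Local Open Scope complex_scope.

Section AnalyticFunctions.
Context {R : realType}.
Implicit Types (f : R[i] -> R[i]) (z : R[i]).

(* The strict order on [R[i]] only relates numbers with equal imaginary parts;
   as [`|z|] has imaginary part 0, this is the usual real inequality. *)
Definition unit_disk : set R[i] := [set z | `|z| < 1].

(* [R[i]^o] is the normed module of the field [R[i]] over itself, hence these
   are complex derivatives. *)
Definition cderivable f z : Prop := derivable (f : R[i]^o -> R[i]^o) z 1.
Definition cderive f : R[i] -> R[i] := derive1 (f : R[i] -> R[i]^o).

Definition analytic_on_disk f : Prop :=
  forall z, unit_disk z -> cderivable f z.

Definition class_A f : Prop :=
  [/\ analytic_on_disk f, f 0 = 0 & cderive f 0 = 1].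

(* [f z / z] for [f] with [f 0 = 0], with its removable singularity at [0]
   filled in (division by zero would give [0] there). *)
Definition quotz f z : R[i] := if z == 0 then cderive f 0 else f z / z.

(* The point [z = 0] is a removable singularity of the quotient, where its
   value is [1]; it is therefore left out.  Elsewhere a zero of the denominator
   violates the inequality since [x / 0 = 0]. *)
Definition pascu (xi : R) f : Prop :=
  class_A f /\
  forall z, unit_disk z -> z != 0 ->
    0 < complex.Re ((xi%:C * z * cderive (fun w => w * cderive f w) z
             + (1 - xi)%:C * (z * cderive f z))
            / (xi%:C * (z * cderive f z) + (1 - xi)%:C * f z)).

Definition class_W (beta alpha gamma : R) f : Prop :=
  class_A f /\
  exists phi : R, forall z, unit_disk z ->
    0 < complex.Re ((cos phi +i* sin phi)
            * ((1 - alpha + 2 * gamma)%:C * quotz f z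
               + (alpha - 2 * gamma)%:C * cderive f z
               + gamma%:C * z * cderive (cderive f) z
               - beta%:C)).

End AnalyticFunctions.

Section Transforms.
Context {R : realType}.
Implicit Types (lam g q : R -> R) (mu nu xi t : R).

Local Notation leb := (@lebesgue_measure R).

Definition cintegral01 (F : R -> R[i]) : R[i] :=
  (\int[leb]_(t in `[0, 1]) complex.Re (F t)) +i* (\int[leb]_(t in `[0, 1]) complex.Im (F t)).

Definition V_op lam (f : R[i] -> R[i]) (z : R[i]) : R[i] :=
  cintegral01 (fun t => (lam t)%:C * (f (t%:C * z) / t%:C)).

Definition Lambda_ nu lam t : R :=
  \int[leb]_(x in `[t, 1]) (lam x / x `^ nu^-1).

Definition Pi_ mu nu lam t : R :=
  \int[leb]_(x in `[t, 1]) (Lambda_ nu lam x * x `^ (nu^-1 - 1 - mu^-1)).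

(* The equation is singular at [t = 0]: the initial value only selects a
   solution together with continuity at [0]. *)
Definition solves_g mu nu g : Prop :=
  [/\ g 0 = 1,
      g t @[t --> 0^'+] --> g 0 &
      forall t, 0 < t < 1 ->
        is_derive t (1 : R) (fun u => u `^ nu^-1 * (1 + g u))
          (2 / (mu * nu) * t `^ (nu^-1 - 1)
           * \int[leb]_(s in `[0, 1]) (s `^ (mu^-1 - 1) / (1 + s * t) ^+ 2))].

Definition solves_q mu nu q : Prop :=
  [/\ q 0 = 1,
      q t @[t --> 0^'+] --> q 0 &
      forall t, 0 < t < 1 ->
        is_derive t (1 : R) (fun u => u `^ nu^-1 * q u)
          (1 / (mu * nu) * t `^ (nu^-1 - 1)
           * \int[leb]_(s in `[0, 1])
               (s `^ (mu^-1 - 1) * ((1 - s * t) / (1 + s * t) ^+ 3)))].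

Definition h_ (eps z : R[i]) : R[i] :=
  z * (1 + (eps - 1) / 2 * z) / (1 - z) ^+ 2.

(* The infimum is taken in the extended reals, as the integrals need not be
   bounded below; the real-valued [inf] would then be [0]. *)
Definition N_ mu nu lam xi (h : R[i] -> R[i]) : \bar R :=
  ereal_inf [set (\int[leb]_(t in `[0, 1])
      (t `^ (mu^-1 - 1) * Pi_ mu nu lam t *
       ((1 - xi) * (complex.Re (quotz h (t%:C * z)) - 1 / (1 + t) ^+ 2)
        + xi * (complex.Re (cderive h (t%:C * z)) - (1 - t) / (1 + t) ^+ 3))))%:E
    | z in unit_disk].

End Transforms.

(* Main.v *)
Require Import Defs.
From HB Require Import structures.
From mathcomp Require Import all_boot all_order all_algebra.
From mathcomp Require Import all_classical all_reals all_analysis.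
From mathcomp.real_closed Require Import complex.
From mathcomp Require Import measurable_realfun ring lra zify.

(** The theorem is an instance of the duality principle for Hadamard products. Write
    [f z = sum a_n z ^ n], and let [m_n] be the moments of [lam].

    The conditions become conditions on power series. The expression that defines
    [class_W] has the coefficients [P_n = (1 + mu n) (1 + nu n) a_(n+1)]
    ([class_W_psum]). For [F = V_op lam f], the function [xi z F' + (1 - xi) F] is [z Y]
    where [Y] has the coefficients [(1 + xi n) m_n a_(n+1)], and the Pascu condition is
    [Re (X / Y) > 0] where [X] has the coefficients [(n + 1) Y_n] ([pascu_V_op]). This
    means [|X - Y| < |X + Y|], so it holds as soon as [X + Y + eps (X - Y)] stays in a
    fixed open half-plane for all [|eps| = 1], and it fails if such a combination
    vanishes. Now [X + Y + eps (X - Y)] is twice the Hadamard product of [Y] with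
    [h_eps z / z] ([psum_hcoef]), hence twice the Hadamard product of [P] with the
    series [psi_eps] of coefficients [psi_coef].

    The integral in [N_] is a function of the same series. The weight
    [t ^ (1/mu - 1) Pi t] has the moments [mu nu m_n / ((1 + mu n) (1 + nu n))], and
    integrating against it undoes the two averages in the equations for [g] and [q].
    With the equation for [beta] the integral is therefore
    [mu nu (Re psi_eps z - (1 - b) / 2)], where [b = beta / (1 - beta)]
    ([N_integrandE]), and [N_ >= 0] says that [Re psi_eps >= (1 - b) / 2] on the disk.

    Under this bound, the Hadamard product of [psi_eps] with a series of positive real
    part is controlled from below ([hadamard_Re_ge]), and Harnack's inequality makes
    the estimate strict; this is [pascu_of_psi_bound]. Conversely, where
    [Re psi_eps = (1 - b) / 2], a function for which [P] maps the disk onto a half-plane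
    makes the Hadamard product vanish ([psi_bound_of_pascu]). Finally the bound is
    attained in the limit [z -> -1] for [eps = 1] ([psi_near_minus1]), so that for
    [beta' < beta] the extremal function of the larger class makes [X] vanish at a
    point of the disk ([pascu_sharp]).

    Two analytic tools are developed for this. The first is the power series expansion
    of a function which is only assumed complex differentiable ([taylor]): contour
    integrals are replaced by means over roots of unity, Goursat's subdivision argument
    is carried out on Riemann sums ([goursat]), and a homotopy between circles gives
    Cauchy's formula ([cauchy_formula]). The second is integration against the iterated
    kernel [Pi], by Tonelli's theorem on a triangle and the fundamental theorem of
    calculus on an interval open at [0] ([Pi_kernel_integral], [singular_ode]). *)

Import Order.TTheory GRing.Theory Num.Theory.
Import numFieldNormedType.Exports.

Local Open Scope classical_set_scope.
Local Open Scope ring_scope.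

Set Implicit Arguments.
Unset Strict Implicit.
Unset Printing Implicit Defensive.

(** * Complex modulus and geometrically convergent sums *)

Section ComplexModulus.
Context {R : realType}.
Implicit Types (z w : R[i]) (a b : R).
Local Open Scope complex_scope.

(** The norm of [R[i]] takes its values in [R[i]], where comparisons also constrain
    imaginary parts; all estimates below are made with its real part instead. *)
Definition cabs z : R := complex.Re `|z|.

Lemma cabsC z : (cabs z)%:C = `|z|.
Proof. by rewrite /cabs normc_def. Qed.

Lemma cabsE z : cabs z = Num.sqrt (complex.Re z ^+ 2 + complex.Im z ^+ 2).
Proof. by rewrite /cabs normc_def. Qed.

Lemma cabs_ge0 z : 0 <= cabs z.
Proof. by rewrite cabsE sqrtr_ge0. Qed.

Lemma cabs_sqr z : cabs z ^+ 2 = complex.Re z ^+ 2 + complex.Im z ^+ 2.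
Proof. by rewrite cabsE sqr_sqrtr // addr_ge0 ?sqr_ge0. Qed.

Lemma cabs0 : cabs 0 = 0.
Proof. by rewrite /cabs normr0. Qed.

Lemma cabs1 : cabs 1 = 1.
Proof. by rewrite /cabs normr1. Qed.

Lemma cabs_eq0 z : (cabs z == 0) = (z == 0).
Proof.
apply/eqP/eqP => [h|->]; last exact: cabs0.
by apply/eqP; rewrite -normr_eq0 -cabsC h.
Qed.

Lemma cabs_gt0 z : (0 < cabs z) = (z != 0).
Proof. by rewrite lt_def cabs_ge0 andbT cabs_eq0. Qed.

Lemma cabsM z w : cabs (z * w) = cabs z * cabs w.
Proof. by apply: complexI; rewrite rmorphM !cabsC normrM. Qed.

Lemma cabsX z n : cabs (z ^+ n) = cabs z ^+ n.
Proof. by apply: complexI; rewrite rmorphXn !cabsC normrX. Qed.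

Lemma cabsV z : cabs z^-1 = (cabs z)^-1.
Proof. by apply: complexI; rewrite fmorphV !cabsC normfV. Qed.

Lemma cabsN z : cabs (- z) = cabs z.
Proof. by apply: complexI; rewrite !cabsC normrN. Qed.

Lemma cabsB z w : cabs (z - w) = cabs (w - z).
Proof. by rewrite -cabsN opprB. Qed.

Lemma cabsD z w : cabs (z + w) <= cabs z + cabs w.
Proof. by rewrite -lecR rmorphD !cabsC ler_normD. Qed.

Lemma cabs_subD z w : cabs (z - w) <= cabs z + cabs w.
Proof. by rewrite -[cabs w]cabsN cabsD. Qed.

Lemma cabs_trans v z w : cabs (z - w) <= cabs (z - v) + cabs (v - w).
Proof. by rewrite (le_trans _ (cabsD _ _)) // addrA subrK. Qed.

Lemma cabs_real a : cabs a%:C = `|a|.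
Proof. by rewrite cabsE /= expr0n /= addr0 sqrtr_sqr. Qed.

Lemma cabs_nat n : cabs n%:R = n%:R.
Proof. by apply: complexI; rewrite cabsC normr_nat rmorph_nat. Qed.

Lemma cabs_sum (I : Type) (r : seq I) (P : pred I) (F : I -> R[i]) :
  cabs (\sum_(i <- r | P i) F i) <= \sum_(i <- r | P i) cabs (F i).
Proof.
elim/big_rec2: _ => [|i y x _ h]; first by rewrite cabs0.
by rewrite (le_trans (cabsD _ _)) // lerD2l.
Qed.

Lemma Re_le_cabs z : `|complex.Re z| <= cabs z.
Proof. by rewrite cabsE -sqrtr_sqr ler_wsqrtr // lerDl sqr_ge0. Qed.

Lemma Im_le_cabs z : `|complex.Im z| <= cabs z.
Proof. by rewrite cabsE -sqrtr_sqr ler_wsqrtr // lerDr sqr_ge0. Qed.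

Lemma cabs_le_ReIm z : cabs z <= `|complex.Re z| + `|complex.Im z|.
Proof.
rewrite -(@ler_pXn2r _ 2) ?nnegrE ?cabs_ge0 ?addr_ge0 //.
rewrite cabs_sqr sqrrD !real_normK ?num_real //.
by rewrite lerD2r lerDl mulrn_wge0 // mulr_ge0.
Qed.

Lemma ReD z w : complex.Re (z + w) = complex.Re z + complex.Re w.
Proof. by case: z; case: w. Qed.
Lemma ImD z w : complex.Im (z + w) = complex.Im z + complex.Im w.
Proof. by case: z; case: w. Qed.
Lemma ReN z : complex.Re (- z) = - complex.Re z.
Proof. by case: z. Qed.
Lemma ImN z : complex.Im (- z) = - complex.Im z.
Proof. by case: z. Qed.
Lemma ReM z w : complex.Re (z * w) =
  complex.Re z * complex.Re w - complex.Im z * complex.Im w.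
Proof. by case: z; case: w. Qed.
Lemma ImM z w : complex.Im (z * w) =
  complex.Re z * complex.Im w + complex.Im z * complex.Re w.
Proof. by case: z; case: w. Qed.
Lemma Re_sum (I : Type) (r : seq I) (P : pred I) (F : I -> R[i]) :
  complex.Re (\sum_(i <- r | P i) F i) = \sum_(i <- r | P i) complex.Re (F i).
Proof. by elim/big_rec2: _ => // i y x _ <-; rewrite ReD. Qed.
Lemma Im_sum (I : Type) (r : seq I) (P : pred I) (F : I -> R[i]) :
  complex.Im (\sum_(i <- r | P i) F i) = \sum_(i <- r | P i) complex.Im (F i).
Proof. by elim/big_rec2: _ => // i y x _ <-; rewrite ImD. Qed.
Lemma ReCM a z : complex.Re (a%:C * z) = a * complex.Re z.
Proof. by rewrite ReM /= mul0r subr0. Qed.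
Lemma ImCM a z : complex.Im (a%:C * z) = a * complex.Im z.
Proof. by rewrite ImM /= mul0r addr0. Qed.

Lemma complex_ReIm z w :
  complex.Re z = complex.Re w -> complex.Im z = complex.Im w -> z = w.
Proof. by case: z => ? ?; case: w => ? ? /= -> ->. Qed.

Lemma unit_diskE z : unit_disk z = (cabs z < 1).
Proof. by rewrite /unit_disk /= -cabsC -[1]/(1%:C) ltcR. Qed.

(** Differentiability with the difference quotient cleared of its denominator, so
    that estimates compose without excluding [w = z]. *)
Definition cdiff (f : R[i] -> R[i]) z (l : R[i]) : Prop :=
  forall e : R, 0 < e -> exists2 d : R, 0 < d &
    forall w, cabs (w - z) < d -> cabs (f w - f z - l * (w - z)) <= e * cabs (w - z).

Lemma cdiff_is_derive f z l : cdiff f z l -> cderivable f z /\ cderive f z = l.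
Proof.
move=> h.
have cv : ((fun k : R[i]^o => k^-1 *: ((f (k + z) : R[i]^o) - f z)) @ 0^') --> (l : R[i]^o).
  apply/cvgrPdist_lt => e e0.
  have [e1 e1E] : exists e1 : R, e = e1%:C.
    by exists (complex.Re e); rewrite RRe_real // gtr0_real.
  move: e0; rewrite e1E -[0]/(0%:C) ltcR => e10.
  have [d d0 hd] := h (e1 / 2) ltac:(by rewrite divr_gt0).
  near=> k.
  have kn0 : k != 0 by near: k; exact: nbhs_dnbhs_neq.
  have kd : cabs k < d.
    rewrite -ltcR cabsC; near: k.
    by apply: (@dnbhs0_lt _ R[i]^o); rewrite -[0]/(0%:C) ltcR.
  rewrite -cabsC ltcR cabsB.
  have := hd (k + z); rewrite addrK => /(_ kd).
  have -> : k^-1 *: ((f (k + z) : R[i]^o) - f z) - l = k^-1 * (f (k + z) - f z - l * k).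
    by rewrite mulrBr mulrCA mulVf // mulr1.
  move=> /le_lt_trans hk; rewrite cabsM cabsV mulrC ltr_pdivrMr ?cabs_gt0 //.
  by apply: hk; rewrite ltr_pM2r ?cabs_gt0 //; lra.
split; first by apply/cvg_ex; exists l; move: cv; under eq_fun do rewrite -[X in f (X + _)]mulr1.
by rewrite /cderive /derive1; apply: (cvg_lim _ cv); exact: norm_hausdorff.
Unshelve. all: by end_near.
Qed.

Lemma cderivable_cdiff f z : cderivable f z -> cdiff f z (cderive f z).
Proof.
move=> h e e0.
have cv : ((fun k : R[i]^o => k^-1 *: ((f (k + z) : R[i]^o) - f z)) @ 0^') --> (cderive f z : R[i]^o).
  have := h; rewrite /cderivable /derivable.
  have -> // : (fun k : R[i]^o => k^-1 *: (((f : R[i]^o -> R[i]^o) \o shift z) (k *: 1) - f z)) =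
    (fun k : R[i]^o => k^-1 *: ((f (k + z) : R[i]^o) - f z)).
  by apply/funext => k /=; rewrite [k *: _]mulr1.
have e2 : (0 : R[i]) < e%:C by rewrite -[0]/(0%:C) ltcR.
move/cvgrPdist_lt: cv => /(_ _ e2).
rewrite /dnbhs => /nbhs_ballP[d /= d0 hd].
have d1 : 0 < complex.Re d by move: d0; rewrite ltcE => /andP[].
exists (complex.Re d) => // w wd.
have [->|wz] := eqVneq w z; first by rewrite !subrr mulr0 subrr cabs0 mulr0.
have wz0 : w - z != 0 by rewrite subr_eq0.
have := hd (w - z); rewrite /ball /= sub0r normrN subrK.
have dE : d = (complex.Re d)%:C by rewrite RRe_real // gtr0_real.
rewrite dE -cabsC ltcR => /(_ wd wz0).
rewrite -cabsC ltcR [in X in X -> _]cabsB.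
have -> : (w - z)^-1 *: ((f w : R[i]^o) - f z) - cderive f z =
          (w - z)^-1 * (f w - f z - cderive f z * (w - z)).
  by rewrite mulrBr mulrCA mulVf // mulr1.
rewrite cabsM cabsV mulrC ltr_pdivrMr ?cabs_gt0 //.
exact: ltW.
Qed.

Lemma cdiff_local (f g : R[i] -> R[i]) z l (d : R) : 0 < d ->
  (forall w, cabs (w - z) < d -> f w = g w) -> cdiff f z l -> cdiff g z l.
Proof.
move=> d0 fg h e e0; have [d1 d10 hd1] := h e e0.
exists (Num.min d d1); first by rewrite lt_min d0.
move=> w; rewrite lt_min => /andP[wd wd1].
by rewrite -!fg ?subrr ?cabs0 //; exact: hd1.
Qed.

Lemma cdiff_continuous f z l : cdiff f z l ->
  forall e : R, 0 < e -> exists2 d : R, 0 < d &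
    forall w, cabs (w - z) < d -> cabs (f w - f z) <= e.
Proof.
move=> h e e0; have [d d0 hd] := h 1 ltr01.
have c1 : 0 < 1 + cabs l by rewrite ltr_pwDl // cabs_ge0.
exists (Num.min d (e / (1 + cabs l))); first by rewrite lt_min d0 divr_gt0.
move=> w; rewrite lt_min => /andP[/hd h1 h2].
have -> : f w - f z = (f w - f z - l * (w - z)) + l * (w - z) by rewrite subrK.
apply: (le_trans (cabsD _ _)); rewrite cabsM.
apply: (le_trans (lerD h1 (lexx _))).
by rewrite -mulrDl mulrC -ler_pdivlMr // ltW.
Qed.

End ComplexModulus.

(** * Complex power series on the unit disk *)

Section PowerSeries.
Context {R : realType}.
Implicit Types (z w : R[i]) (c : nat -> R[i]) (d u : nat -> R[i]).
Local Open Scope complex_scope.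

Lemma geo_small (K x e : R) : 0 <= x < 1 -> 0 < e ->
  exists N, forall n, (N <= n)%N -> K * x ^+ n <= e.
Proof.
move=> /andP[x0 x1] e0.
have : geometric K x @ \oo --> 0 by apply: cvg_geometric; rewrite ger0_norm.
move=> /cvgrPdist_le/(_ _ e0)[N _ hN]; exists N => n /hN /=.
by rewrite sub0r normrN; apply: le_trans; exact: ler_norm.
Qed.

(** The limit is taken on real and imaginary parts, where completeness is that of
    [R]; it is a junk value for divergent sequences. *)
Definition clim d : R[i] :=
  lim ((fun n => complex.Re (d n)) @ \oo) +i* lim ((fun n => complex.Im (d n)) @ \oo).

Arguments clim : simpl never.

Lemma real_cauchy_lim (a : nat -> R) :
  (forall e : R, 0 < e -> exists N, forall m n, (N <= m)%N -> (N <= n)%N -> `|a m - a n| <= e) ->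
  a @ \oo --> lim (a @ \oo).
Proof.
move=> h; apply/cauchy_cvgP; apply/cauchy_ballP => e e0.
have [N hN] := h (e / 2) ltac:(by rewrite divr_gt0).
exists ([set x | exists2 n, (N <= n)%N & x = a n], [set x | exists2 n, (N <= n)%N & x = a n]).
  by split; exists N => // n /= Nn; exists n.
move=> [x y] /= [[m Nm ->] [n Nn ->]]; rewrite /ball /=.
by apply: le_lt_trans (hN _ _ Nm Nn) _; rewrite ltr_pdivrMr // mulr_natr mulr2n ltrDl.
Qed.

Lemma clim_cauchy d :
  (forall e : R, 0 < e -> exists N, forall m n, (N <= m)%N -> (N <= n)%N -> cabs (d m - d n) <= e) ->
  forall e : R, 0 < e -> exists N, forall n, (N <= n)%N -> cabs (clim d - d n) <= e.
Proof.
move=> h e e0.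
have hRe : (fun n => complex.Re (d n)) @ \oo --> complex.Re (clim d).
  apply: real_cauchy_lim => k k0; have [N hN] := h k k0; exists N => m n Nm Nn.
  by apply: le_trans (hN _ _ Nm Nn); rewrite -ReN -ReD; exact: Re_le_cabs.
have hIm : (fun n => complex.Im (d n)) @ \oo --> complex.Im (clim d).
  apply: real_cauchy_lim => k k0; have [N hN] := h k k0; exists N => m n Nm Nn.
  by apply: le_trans (hN _ _ Nm Nn); rewrite -ImN -ImD; exact: Im_le_cabs.
have e2 : 0 < e / 2 by rewrite divr_gt0.
move/cvgrPdist_le: hRe => /(_ _ e2)[N1 _ h1].
move/cvgrPdist_le: hIm => /(_ _ e2)[N2 _ h2].
exists (maxn N1 N2) => n; rewrite geq_max => /andP[n1 n2].
apply: le_trans (cabs_le_ReIm _) _; rewrite ReD ImD ReN ImN [leRHS]splitr.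
exact: lerD (h1 _ n1) (h2 _ n2).
Qed.

Lemma clim_unique d l :
  (forall e : R, 0 < e -> exists N, forall n, (N <= n)%N -> cabs (l - d n) <= e) ->
  clim d = l.
Proof.
move=> h.
have cv e : 0 < e -> exists N, forall n, (N <= n)%N -> cabs (clim d - d n) <= e.
  apply: clim_cauchy => {}e e0; have [N hN] := h (e / 2) ltac:(by rewrite divr_gt0).
  exists N => m n Nm Nn; apply: le_trans (cabs_trans l _ _) _.
  by rewrite cabsB [leRHS]splitr lerD ?hN.
apply/eqP; rewrite -subr_eq0 -cabs_eq0 eq_le cabs_ge0 andbT.
apply/ler_addgt0Pr => e e0; rewrite add0r; have e2 : 0 < e / 2 by rewrite divr_gt0.
have [N1 h1] := h _ e2; have [N2 h2] := cv _ e2.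
apply: le_trans (cabs_trans (d (maxn N1 N2)) _ _) _.
rewrite [X in _ + X]cabsB [leRHS]splitr.
by apply: lerD; [apply: h2; rewrite leq_maxr|apply: h1; rewrite leq_maxl].
Qed.

Definition psum c z : R[i] := clim (fun N => \sum_(k < N) c k * z ^+ k).

Arguments psum : simpl never.

(** Coefficients of a power series converging on the whole unit disk, in a form
    that compares well with geometric sequences. *)
Definition pcoef c : Prop := forall rho : R, 0 < rho < 1 ->
  exists M : R, forall n, cabs (c n) * rho ^+ n <= M.

Lemma geo_block u (M x : R) : 0 <= x < 1 ->
  (forall n, cabs (u n) <= M * x ^+ n) ->
  forall N m, cabs (\sum_(k < N + m) u k - \sum_(k < N) u k) <= M / (1 - x) * x ^+ N.
Proof.
move=> /andP[x0 x1] hu N m.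
have x1' : 0 < 1 - x by rewrite subr_gt0.
have M0 : 0 <= M by have := hu 0%N; rewrite expr0 mulr1; apply: le_trans; exact: cabs_ge0.
suff : cabs (\sum_(k < N + m) u k - \sum_(k < N) u k) <= M / (1 - x) * (x ^+ N - x ^+ (N + m)).
  move=> /le_trans; apply; rewrite ler_wpM2l ?divr_ge0 ?(ltW x1') //.
  by rewrite lerBlDr lerDl exprn_ge0.
elim: m => [|m IH]; first by rewrite addn0 !subrr cabs0 mulr0.
rewrite addnS big_ord_recr /= addrAC.
apply: le_trans (cabsD _ _) _; apply: le_trans (lerD IH (hu _)) _.
rewrite exprS le_eqVlt; apply/orP; left; apply/eqP; field; lra.
Qed.

Lemma psum_tail c z (M x : R) : 0 <= x < 1 ->
  (forall n, cabs (c n * z ^+ n) <= M * x ^+ n) ->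
  forall N, cabs (psum c z - \sum_(k < N) c k * z ^+ k) <= M / (1 - x) * x ^+ N.
Proof.
move=> x01 hu N; have blk := geo_block x01 hu.
have : forall e : R, 0 < e -> exists N, forall n, (N <= n)%N ->
    cabs (psum c z - \sum_(k < n) c k * z ^+ k) <= e.
  apply: clim_cauchy => e e0.
  have [N0 h0] := geo_small (M / (1 - x)) x01 (ltac:(by rewrite divr_gt0) : 0 < e / 2).
  exists N0 => m n Nm Nn; apply: le_trans (cabs_trans (\sum_(k < N0) c k * z ^+ k) _ _) _.
  rewrite [leRHS]splitr -(subnKC Nm) -(subnKC Nn) [X in _ + X]cabsB.
  by apply: lerD; apply: le_trans (blk _ _) _; exact: h0.
move=> cv; apply/ler_addgt0Pr => e /cv[N0 h0].
apply: le_trans (cabs_trans (\sum_(k < N + N0) c k * z ^+ k) _ _) _.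
by rewrite addrC lerD // h0 // leq_addl.
Qed.

(** One geometric majorant serves all [z] in the closed disk of radius [r]: the
    coefficients are compared with the intermediate radius [(1 + r) / 2]. *)
Lemma psum_unif c (r : R) : pcoef c -> 0 <= r < 1 ->
  exists K x : R, [/\ 0 <= K, 0 <= x < 1,
    (forall z n, cabs z <= r -> cabs (c n * z ^+ n) <= K * x ^+ n) &
    (forall z N, cabs z <= r ->
       cabs (psum c z - \sum_(k < N) c k * z ^+ k) <= K * x ^+ N)].
Proof.
move=> hc /andP[r0 r1].
have rho01 : 0 < (1 + r) / 2 < 1 by apply/andP; split; lra.
have [M hM] := hc _ rho01; set rho := (1 + r) / 2 in hM rho01.
have rr : r < rho by rewrite /rho; lra.
case/andP: rho01 => rho0 rho1.
have x01 : 0 <= r / rho < 1 by rewrite divr_ge0 ?(ltW rho0) //= ltr_pdivrMr // mul1r.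
have M0 : 0 <= M by have := hM 0%N; rewrite expr0 mulr1; apply: le_trans; exact: cabs_ge0.
have hz z n : cabs z <= r -> cabs (c n * z ^+ n) <= M * (r / rho) ^+ n.
  move=> zr; rewrite cabsM cabsX expr_div_n mulrA ler_pdivlMr ?exprn_gt0 //.
  rewrite mulrAC; apply: ler_pM; rewrite ?mulr_ge0 ?exprn_ge0 ?cabs_ge0 ?(ltW rho0) //.
  by rewrite lerXn2r ?nnegrE ?cabs_ge0.
have x1 : 0 < 1 - r / rho by case/andP: x01 => _; rewrite subr_gt0.
have x1' : 1 - r / rho <= 1 by case/andP: x01 => ? _; rewrite lerBlDr lerDl.
exists (M / (1 - r / rho)), (r / rho); split => //.
- by rewrite divr_ge0 // ltW.
- move=> z n zr; apply: le_trans (hz _ _ zr) _.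
  by rewrite ler_wpM2r ?exprn_ge0 ?(andP x01).1 // ler_pdivlMr // ler_piMr.
- by move=> z N zr; apply: psum_tail => // n; exact: hz.
Qed.

Lemma psum_lim c z : pcoef c -> cabs z < 1 -> forall e : R, 0 < e ->
  exists N, forall n, (N <= n)%N -> cabs (psum c z - \sum_(k < n) c k * z ^+ k) <= e.
Proof.
move=> hc z1 e e0; have [|K [x [K0 x01 _ h]]] := psum_unif (r := cabs z) hc.
  by rewrite cabs_ge0.
have [N hN] := geo_small K x01 e0; exists N => n Nn.
exact: le_trans (h _ _ (lexx _)) (hN _ Nn).
Qed.

Lemma psum_eq c z l :
  (forall e : R, 0 < e -> exists N, forall n, (N <= n)%N ->
     cabs (l - \sum_(k < n) c k * z ^+ k) <= e) -> psum c z = l.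
Proof. exact: clim_unique. Qed.

Lemma eq_psum c1 c2 z : c1 =1 c2 -> psum c1 z = psum c2 z.
Proof. by move=> /funext ->. Qed.

Lemma psum_scale c (s z : R[i]) : psum (fun n => c n * s ^+ n) z = psum c (s * z).
Proof.
rewrite /psum; congr clim; apply/funext => N; apply: eq_bigr => k _.
by rewrite exprMn mulrA.
Qed.

Lemma pcoef_le c1 c2 (B : R) : 0 <= B -> (forall n, cabs (c2 n) <= B * cabs (c1 n)) ->
  pcoef c1 -> pcoef c2.
Proof.
move=> B0 h h1 rho rho01; have [M hM] := h1 _ rho01; exists (B * M) => n.
apply: le_trans (ler_wpM2r _ (h n)) _; first by rewrite exprn_ge0 // ltW //; case/andP: rho01.
by rewrite -mulrA ler_wpM2l.
Qed.

Lemma pcoef_bounded c (B : R) : (forall n, cabs (c n) <= B) -> pcoef c.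
Proof.
move=> h rho /andP[rho0 rho1]; exists B => n; rewrite -[leRHS]mulr1.
by apply: ler_pM; rewrite ?cabs_ge0 ?exprn_ge0 ?exprn_ile1 ?(ltW rho0) ?(ltW rho1).
Qed.

Lemma pcoefD c1 c2 : pcoef c1 -> pcoef c2 -> pcoef (fun n => c1 n + c2 n).
Proof.
move=> h1 h2 rho rho01; have [M1 hM1] := h1 _ rho01; have [M2 hM2] := h2 _ rho01.
exists (M1 + M2) => n; apply: le_trans (lerD (hM1 n) (hM2 n)); rewrite -mulrDl.
by rewrite ler_wpM2r ?cabsD // exprn_ge0 // ltW //; case/andP: rho01.
Qed.

Lemma pcoefZ c (a : R[i]) : pcoef c -> pcoef (fun n => a * c n).
Proof. by apply: (@pcoef_le _ _ (cabs a)); [exact: cabs_ge0|move=> n; rewrite cabsM]. Qed.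

Lemma pcoefS c : pcoef c -> pcoef (fun n => c n.+1).
Proof.
move=> h rho rho01; have [M hM] := h _ rho01; have /andP[rho0 _] := rho01.
by exists (M / rho) => n; rewrite ler_pdivlMr // -mulrA -exprSr.
Qed.

Lemma pcoef_cons c (a : R[i]) : pcoef c -> pcoef (fun n => if n is m.+1 then c m else a).
Proof.
move=> h rho rho01; have [M hM] := h _ rho01; have /andP[rho0 rho1] := rho01.
exists (M + cabs a) => -[|n].
  by rewrite expr0 mulr1 lerDr; apply: le_trans (hM 0%N); rewrite expr0 mulr1 cabs_ge0.
rewrite ler_wpDr ?cabs_ge0 // (le_trans _ (hM n)) // ler_wpM2l ?cabs_ge0 // exprS.
by rewrite ler_piMl ?exprn_ge0 // ltW.
Qed.

Lemma geo_sum_le (x : R) N : 0 <= x < 1 -> \sum_(i < N) x ^+ i <= (1 - x)^-1.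
Proof.
move=> /andP[x0 x1]; rewrite -[leRHS]mul1r ler_pdivlMr ?subr_gt0 //.
suff -> : (\sum_(i < N) x ^+ i) * (1 - x) = 1 - x ^+ N by rewrite lerBlDr lerDl exprn_ge0.
elim: N => [|N IH]; first by rewrite big_ord0 mul0r expr0 subrr.
by rewrite big_ord_recr /= mulrDl IH exprS; ring.
Qed.

Lemma nat_geo (x : R) n : 0 <= x <= 1 -> n%:R * (1 - x) * x ^+ n <= 1 - x ^+ n.
Proof.
move=> /andP[x0 x1]; elim: n => [|n IH]; first by rewrite mul0r mul0r expr0 subrr.
have xn : 0 <= x ^+ n <= 1 by rewrite exprn_ge0 // exprn_ile1.
rewrite exprS -natr1; move: xn IH; move: (x ^+ n) => y /andP[y0 y1] IH.
have : x * (n%:R * (1 - x) * y) <= x * (1 - y) by rewrite ler_wpM2l.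
have : 0 <= (1 - x) * (1 - x * y).
  by rewrite mulr_ge0 ?subr_ge0 // -[leRHS]mulr1; apply: ler_pM.
lra.
Qed.

Lemma pcoefMn c : pcoef c -> pcoef (fun n => n%:R * c n).
Proof.
move=> h rho /andP[rho0 rho1].
pose rho' : R := (1 + rho) / 2.
have [|M hM] := h rho'; first by rewrite /rho'; lra.
have rr : rho < rho' by rewrite /rho'; lra.
have rp0 : 0 < rho' by rewrite (lt_trans rho0).
have M0 : 0 <= M by have := hM 0%N; rewrite expr0 mulr1; apply: le_trans; exact: cabs_ge0.
pose x := rho / rho'.
have x0 : 0 <= x by rewrite divr_ge0 ?ltW.
have x1 : x < 1 by rewrite ltr_pdivrMr // mul1r.
have x1' : 0 < 1 - x by rewrite subr_gt0.
exists (M / (1 - x)) => n.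
have -> : rho ^+ n = rho' ^+ n * x ^+ n.
  by rewrite -exprMn /x mulrCA divff ?mulr1 // gt_eqF.
rewrite cabsM cabs_nat mulrACA mulrAC ler_pdivlMr //.
have := nat_geo n (ltac:(by rewrite x0 ltW) : 0 <= x <= 1).
have xn : 0 <= x ^+ n by rewrite exprn_ge0.
move=> hn.
have {}hn : n%:R * (1 - x) * x ^+ n <= 1 by apply: le_trans hn _; rewrite lerBlDr lerDl.
rewrite [leLHS](_ : _ = (cabs (c n) * rho' ^+ n) * (n%:R * (1 - x) * x ^+ n)); last by ring.
by rewrite -[leRHS]mulr1; apply: ler_pM; rewrite ?mulr_ge0 ?cabs_ge0 ?exprn_ge0 ?(ltW rp0) ?(ltW x1').
Qed.

Lemma psumD c1 c2 z : pcoef c1 -> pcoef c2 -> cabs z < 1 ->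
  psum (fun n => c1 n + c2 n) z = psum c1 z + psum c2 z.
Proof.
move=> h1 h2 z1; apply: psum_eq => e e0; have e2 : 0 < e / 2 by rewrite divr_gt0.
have [N1 hN1] := psum_lim h1 z1 e2; have [N2 hN2] := psum_lim h2 z1 e2.
exists (maxn N1 N2) => n; rewrite geq_max => /andP[/hN1 n1 /hN2 n2].
under eq_bigr do rewrite mulrDl.
rewrite big_split /= opprD addrACA [leRHS]splitr.
exact: le_trans (cabsD _ _) (lerD n1 n2).
Qed.

Lemma psumZ c (a : R[i]) z : pcoef c -> cabs z < 1 ->
  psum (fun n => a * c n) z = a * psum c z.
Proof.
move=> h z1; apply: psum_eq => e e0.
have a1 : 0 < 1 + cabs a by rewrite ltr_pwDl ?cabs_ge0.
have [N hN] := psum_lim h z1 (ltac:(by rewrite divr_gt0) : 0 < e / (1 + cabs a)).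
exists N => n /hN {}hN.
under eq_bigr do rewrite -mulrA.
rewrite -mulr_sumr -mulrBr cabsM; apply: le_trans (ler_wpM2l (cabs_ge0 _) hN) _.
by rewrite mulrCA ler_piMr ?ltW // ltr_pdivrMr // mul1r ltrDr.
Qed.

Lemma psum_cons c (a : R[i]) z : pcoef c -> cabs z < 1 ->
  psum (fun n => if n is m.+1 then c m else a) z = a + z * psum c z.
Proof.
move=> h z1; apply: psum_eq => e e0.
have [N hN] := psum_lim h z1 e0; exists N.+1 => -[//|n] Nn.
rewrite big_ord_recl expr0 mulr1 opprD addrACA subrr add0r.
have -> : \sum_(i < n) c i * z ^+ bump 0 i = z * \sum_(i < n) c i * z ^+ i.
  by rewrite mulr_sumr; apply: eq_bigr => i _; rewrite exprS mulrCA.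
rewrite -mulrBr cabsM.
by apply: le_trans (hN _ Nn); rewrite ler_piMl ?cabs_ge0 // ltW.
Qed.

Lemma psumS c z : pcoef c -> cabs z < 1 ->
  psum c z = c 0%N + z * psum (fun n => c n.+1) z.
Proof.
move=> h z1; rewrite -psum_cons //; last exact: pcoefS.
by apply: eq_psum => -[].
Qed.

Lemma psum0 c : pcoef c -> psum c 0 = c 0%N.
Proof. by move=> h; rewrite psumS ?cabs0 // mul0r addr0. Qed.

Lemma psum_le c (r : R) : pcoef c -> 0 <= r < 1 ->
  exists K : R, forall z, cabs z <= r -> cabs (psum c z) <= K.
Proof.
move=> hc r01; have [K [x [K0 x01 _ h]]] := psum_unif hc r01.
by exists K => z zr; have := h z 0%N zr; rewrite big_ord0 subr0 expr0 mulr1.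
Qed.

Lemma expr_lip (r : R) z w n : 0 <= r -> cabs z <= r -> cabs w <= r ->
  r * cabs (w ^+ n - z ^+ n) <= n%:R * r ^+ n * cabs (w - z).
Proof.
move=> r0 zr wr; elim: n => [|n IH]; first by rewrite !expr0 subrr cabs0 mulr0 !mul0r.
have -> : w ^+ n.+1 - z ^+ n.+1 = w ^+ n * (w - z) + z * (w ^+ n - z ^+ n).
  by rewrite !exprS; ring.
apply: le_trans (ler_wpM2l r0 (cabsD _ _)) _; rewrite mulrDr !cabsM cabsX.
rewrite -natr1 exprS.
have h1 : r * (cabs z * cabs (w ^+ n - z ^+ n)) <= r * (n%:R * r ^+ n * cabs (w - z)).
  rewrite mulrCA; apply: ler_pM => //; first exact: cabs_ge0.
  by rewrite mulr_ge0 ?cabs_ge0.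
have h2 : r * (cabs w ^+ n * cabs (w - z)) <= r * (r ^+ n * cabs (w - z)).
  by rewrite ler_wpM2l // ler_wpM2r ?cabs_ge0 // lerXn2r ?nnegrE ?cabs_ge0.
apply: le_trans (lerD h2 h1) _; rewrite le_eqVlt; apply/orP; left; apply/eqP; ring.
Qed.

Lemma expr_taylor (r : R) z w n : 0 <= r -> cabs z <= r -> cabs w <= r ->
  r ^+ 2 * cabs (w ^+ n - z ^+ n - n%:R * z ^+ n.-1 * (w - z))
    <= n%:R ^+ 2 * r ^+ n * cabs (w - z) ^+ 2.
Proof.
move=> r0 zr wr; elim: n => [|n IH].
  by rewrite !expr0 subrr !mul0r subrr cabs0 mulr0 expr2 !mul0r.
have -> : w ^+ n.+1 - z ^+ n.+1 - n.+1%:R * z ^+ n.+1.-1 * (w - z) =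
   z * (w ^+ n - z ^+ n - n%:R * z ^+ n.-1 * (w - z)) + (w ^+ n - z ^+ n) * (w - z).
  case: n {IH} => [|n]; first by rewrite !expr0 ?expr1; ring.
  by rewrite -!pred_Sn -!natr1 !exprS; ring.
apply: le_trans (ler_wpM2l _ (cabsD _ _)) _; first by rewrite exprn_ge0.
rewrite mulrDr !cabsM.
have h1 : r ^+ 2 * (cabs z * cabs (w ^+ n - z ^+ n - n%:R * z ^+ n.-1 * (w - z))) <=
          r * (n%:R ^+ 2 * r ^+ n * cabs (w - z) ^+ 2).
  rewrite mulrCA; apply: ler_pM => //; first exact: cabs_ge0.
  by rewrite mulr_ge0 ?cabs_ge0 ?sqr_ge0.
have h2 : r ^+ 2 * (cabs (w ^+ n - z ^+ n) * cabs (w - z)) <=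
          r * (n%:R * r ^+ n * cabs (w - z) ^+ 2).
  rewrite expr2 -mulrA ler_wpM2l // mulrA [X in _ <= _ * X]expr2 mulrA.
  by rewrite ler_wpM2r ?cabs_ge0 // expr_lip.
apply: le_trans (lerD h1 h2) _; rewrite -natr1 [r ^+ n.+1]exprS.
have n0 : 0 <= n%:R :> R by [].
have rn0 : 0 <= r * r ^+ n * cabs (w - z) ^+ 2 by rewrite !mulr_ge0 ?exprn_ge0 ?cabs_ge0.
rewrite -subr_ge0 [leRHS](_ : _ = (n%:R + 1) * (r * r ^+ n * cabs (w - z) ^+ 2)).
  by rewrite mulr_ge0 // addr_ge0.
by ring.
Qed.

Definition dcoef c n : R[i] := n.+1%:R * c n.+1.

Lemma pcoef_dcoef c : pcoef c -> pcoef (dcoef c).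
Proof. by move=> h; exact: pcoefS (pcoefMn h). Qed.

(** Term by term differentiation: [expr_taylor] bounds the second order remainder of
    each power, and [n ^ 2 c n] is still summable on a slightly larger disk. *)
Lemma psum_cdiff c z : pcoef c -> cabs z < 1 -> cdiff (psum c) z (psum (dcoef c) z).
Proof.
move=> hc z1.
pose r := (1 + cabs z) / 2.
have zr : cabs z < r by rewrite /r; lra.
have r1 : r < 1 by rewrite /r; lra.
have r0 : 0 < r by rewrite (le_lt_trans (cabs_ge0 z)).
have hc2 := pcoefMn (pcoefMn hc).
have [|K [x [K0 x01 hK _]]] := psum_unif hc2 (r := r); first by rewrite ltW.
have /andP[x0 x1] := x01; have x1' : 0 < 1 - x by rewrite subr_gt0.
have main w : cabs w <= r ->
    cabs (psum c w - psum c z - psum (dcoef c) z * (w - z)) <=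
    K / (1 - x) / r ^+ 2 * cabs (w - z) ^+ 2.
  move=> wr; apply/ler_addgt0Pr => e e0.
  have e3 : 0 < e / 3 by rewrite divr_gt0.
  have wz : 0 < 1 + cabs (w - z) by rewrite ltr_pwDl ?cabs_ge0.
  have [N1 h1] := psum_lim hc (le_lt_trans wr r1) e3.
  have [N2 h2] := psum_lim hc z1 e3.
  have [N3 h3] := psum_lim (pcoef_dcoef hc) z1
    (ltac:(by rewrite divr_gt0) : 0 < e / 3 / (1 + cabs (w - z))).
  pose N := (maxn N1 (maxn N2 N3)).+1.
  have {}h1 := h1 N (leqW (leq_maxl _ _)).
  have {}h2 := h2 N (leqW (leq_trans (leq_maxl _ _) (leq_maxr _ _))).
  have {}h3 := h3 N.-1 (leq_trans (leq_maxr _ _) (leq_maxr _ _)).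
  have -> : psum c w - psum c z - psum (dcoef c) z * (w - z) =
    (psum c w - \sum_(k < N) c k * w ^+ k) - (psum c z - \sum_(k < N) c k * z ^+ k)
    - (psum (dcoef c) z - \sum_(k < N.-1) dcoef c k * z ^+ k) * (w - z)
    + \sum_(k < N) c k * (w ^+ k - z ^+ k - k%:R * z ^+ k.-1 * (w - z)).
    have -> : \sum_(k < N) c k * (w ^+ k - z ^+ k - k%:R * z ^+ k.-1 * (w - z)) =
      \sum_(k < N) c k * w ^+ k - \sum_(k < N) c k * z ^+ k -
      (\sum_(k < N.-1) dcoef c k * z ^+ k) * (w - z).
      rewrite -sumrB mulr_suml (_ : \sum_(i < N.-1) _ = \sum_(i < N) c i * (i%:R * z ^+ i.-1 * (w - z))).
        by rewrite -sumrB; apply: eq_bigr => i _; rewrite mulrBr mulrBr.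
      rewrite [RHS]big_ord_recl /= mul0r mul0r mulr0 add0r.
      by apply: eq_bigr => i _; rewrite /dcoef /bump add1n /= [_ * c _]mulrC !mulrA.
    by rewrite [in RHS]mulrBl !opprB; move: (psum c w) (psum c z) (_ * (w - z)) (_ * (w - z))
      (\sum_(k < N) c k * w ^+ k) (\sum_(k < N) c k * z ^+ k) => a1 a2 a3 a4 a5 a6; ring.
  apply: le_trans (cabsD _ _) _; rewrite addrC; apply: lerD.
    apply: le_trans (cabs_sum _ _ _) _.
    have hk k : cabs (c k * (w ^+ k - z ^+ k - k%:R * z ^+ k.-1 * (w - z))) <=
        K / r ^+ 2 * cabs (w - z) ^+ 2 * x ^+ k.
      have := expr_taylor k (ltW r0) (ltW zr) wr; rewrite mulrC -ler_pdivlMr ?exprn_gt0 // => ht.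
      rewrite cabsM; apply: le_trans (ler_wpM2l (cabs_ge0 _) ht) _.
      have := hK r%:C k; rewrite cabs_real ger0_norm ?(ltW r0) // lexx => /(_ isT).
      rewrite !cabsM cabsX cabs_real ger0_norm ?(ltW r0) // !cabs_nat => hk.
      rewrite [leLHS](_ : _ = (k%:R * (k%:R * cabs (c k)) * r ^+ k) * ((r ^+ 2)^-1 * cabs (w - z) ^+ 2)); last by ring.
      rewrite [leRHS](_ : _ = (K * x ^+ k) * ((r ^+ 2)^-1 * cabs (w - z) ^+ 2)); last by ring.
      by rewrite ler_wpM2r // mulr_ge0 ?invr_ge0 ?exprn_ge0 ?cabs_ge0 // ltW.
    apply: (@le_trans _ _ (\sum_(k < N) K / r ^+ 2 * cabs (w - z) ^+ 2 * x ^+ k)).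
      by apply: ler_sum => k _; exact: hk.
    rewrite -mulr_sumr.
    have := geo_sum_le N x01.
    have CC : 0 <= K / r ^+ 2 * cabs (w - z) ^+ 2.
      by rewrite !mulr_ge0 ?invr_ge0 ?exprn_ge0 ?cabs_ge0 // ltW.
    move=> /(ler_wpM2l CC) /le_trans; apply.
    by rewrite le_eqVlt; apply/orP; left; apply/eqP; ring.
  have h4 : cabs (psum (dcoef c) z - \sum_(k < N.-1) dcoef c k * z ^+ k) * cabs (w - z) <= e / 3.
    apply: le_trans (ler_wpM2r (cabs_ge0 _) h3) _.
    by rewrite mulrAC ler_pdivrMr // ler_wpM2l ?(ltW e3) // lerDr.
  apply: le_trans (cabs_subD _ _) _; rewrite cabsM.
  apply: le_trans (lerD (cabs_subD _ _) h4) _.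
  have {2}-> : e = e / 3 + e / 3 + e / 3 by field.
  exact: lerD (lerD h1 h2) (lexx _).
set B := K / (1 - x) / r ^+ 2 in main.
have B0 : 0 <= B by rewrite !divr_ge0 ?exprn_ge0 // ltW.
move=> e e0; exists (Num.min (r - cabs z) (e / (1 + B))).
  by rewrite lt_min subr_gt0 zr divr_gt0 // ltr_pwDl.
move=> w; rewrite lt_min => /andP[w1 w2].
apply: le_trans (main w _) _.
  rewrite -[w](subrK z) (le_trans (cabsD _ _)) //; lra.
rewrite expr2 mulrA ler_wpM2r ?cabs_ge0 //.
have B1 : 0 < 1 + B by rewrite ltr_pwDl.
move: w2; rewrite ltr_pdivlMr // => w2; apply: le_trans (ltW w2).
by rewrite mulrC ler_wpM2l ?cabs_ge0 // lerDr.
Qed.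

(** By induction on [n]: the constant term is a value at points tending to [0], and
    dividing by [z] shifts the series. *)
Lemma psum_inj c1 c2 (r : R) : pcoef c1 -> pcoef c2 -> 0 < r ->
  (forall z, cabs z < r -> psum c1 z = psum c2 z) -> forall n, c1 n = c2 n.
Proof.
move=> h1 h2 r0 heq.
have base d : pcoef d ->
    (forall z, z != 0 -> cabs z < r -> cabs z < 1 -> psum d z = 0) -> d 0%N = 0.
  move=> hd hz; apply/eqP; rewrite -cabs_eq0 eq_le cabs_ge0 andbT leNgt; apply/negP => d0.
  have c01 : cabs (0 : R[i]) < 1 by rewrite cabs0.
  have [e e0 he] := cdiff_continuous (psum_cdiff hd c01) (divr_gt0 d0 (ltr0n _ 2)).
  pose t := Num.min e (Num.min r 1) / 2.
  have m0 : 0 < Num.min e (Num.min r 1) by rewrite !lt_min e0 r0 ltr01.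
  have t0 : 0 < t by rewrite divr_gt0.
  have : t < Num.min e (Num.min r 1) by rewrite ltr_pdivrMr // ltr_pMr // ltr1n.
  rewrite !lt_min => /and3P[te tr t1].
  have ct : cabs t%:C = t by rewrite cabs_real ger0_norm // ltW.
  have := he t%:C; rewrite subr0 ct => /(_ te).
  rewrite hz ?ct // -?cabs_gt0 ?ct // psum0 // sub0r cabsN.
  by apply/negP; rewrite -ltNge ltr_pdivrMr // ltr_pMr // ltr1n.
suff key n d : pcoef d -> (forall z, z != 0 -> cabs z < r -> cabs z < 1 -> psum d z = 0) ->
    d n = 0.
  move=> n; apply/eqP; rewrite -subr_eq0 -mulN1r; apply/eqP.
  apply: (key n (fun n => c1 n + -1 * c2 n)); first by apply: pcoefD => //; exact: pcoefZ.
  move=> z _ zr z1; rewrite psumD //; last exact: pcoefZ.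
  by rewrite psumZ // heq // mulN1r subrr.
elim: n d => [|n IH] d hd hz; first exact: base.
apply: (IH (fun n => d n.+1)); first exact: pcoefS.
move=> z z0 zr z1; have := hz z z0 zr z1; rewrite psumS // (base d) // add0r => /eqP.
by rewrite mulf_eq0 (negbTE z0) /= => /eqP.
Qed.

End PowerSeries.

(** * Goursat's argument for Riemann sums over dyadic squares *)

Section Goursat.
Context {R : realType}.
Variables P Q : R -> R -> R[i].
Local Open Scope complex_scope.

Definition dyad (k i : nat) : R := i%:R / 2 ^+ k.

Definition circulation_cell (k i j : nat) : R[i] :=
  ((2 ^+ k)^-1)%:C * (P (dyad k i) (dyad k j) - P (dyad k i) (dyad k j.+1))
  + ((2 ^+ k)^-1)%:C * (Q (dyad k i.+1) (dyad k j) - Q (dyad k i) (dyad k j)).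

(** Riemann sum, on the grid of mesh [2 ^- (k + m)], for the circulation of the
    form [P dx + Q dy] around the dyadic square of side [2 ^- k] with lower left
    corner [(dyad k p, dyad k q)], written as a sum over the cells of the grid so
    that it is additive under subdivision. *)
Definition circulation (k p q m : nat) : R[i] :=
  \sum_(i < 2 ^ m) \sum_(j < 2 ^ m)
     circulation_cell (k + m) (p * 2 ^ m + i)%N (q * 2 ^ m + j)%N.

Lemma dyad_scale k m p : dyad (k + m) (p * 2 ^ m) = dyad k p.
Proof.
rewrite /dyad natrM natrX exprD.
have h j : (2 : R) ^+ j != 0 by rewrite expf_neq0.
by field; rewrite !h.
Qed.

Lemma sum_double (V : nmodType) (F : nat -> V) n n' : n' = (n + n)%N ->
  \sum_(i < n') F i = \sum_(i < n) F i + \sum_(i < n) F (n + i)%N.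
Proof. by move=> ->; rewrite big_split_ord. Qed.

Lemma circulationS k p q m : circulation k p q m.+1 =
  circulation k.+1 p.*2 q.*2 m + circulation k.+1 p.*2 q.*2.+1 m +
  (circulation k.+1 p.*2.+1 q.*2 m + circulation k.+1 p.*2.+1 q.*2.+1 m).
Proof.
rewrite /circulation.
have e2 : (2 ^ m.+1 = 2 ^ m + 2 ^ m)%N by rewrite expnS mul2n addnn.
have e0 r i : (r * 2 ^ m.+1 + i = r.*2 * 2 ^ m + i)%N by rewrite e2 -muln2; lia.
have e1 r i : (r * 2 ^ m.+1 + (2 ^ m + i) = r.*2.+1 * 2 ^ m + i)%N.
  by rewrite e2 -muln2; lia.
have ek : (k + m.+1 = k.+1 + m)%N by rewrite addnS addSn.
rewrite (sum_double (fun i => \sum_(j < 2 ^ m.+1)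
  circulation_cell (k + m.+1) (p * 2 ^ m.+1 + i)%N (q * 2 ^ m.+1 + j)%N) e2).
congr (_ + _); rewrite -big_split; apply: eq_bigr => i _ /=.
  rewrite (sum_double (fun j =>
    circulation_cell (k + m.+1) (p * 2 ^ m.+1 + i)%N (q * 2 ^ m.+1 + j)%N) e2).
  by congr (_ + _); apply: eq_bigr => j _; rewrite ?e1 ?e0 ek.
rewrite (sum_double (fun j =>
  circulation_cell (k + m.+1) (p * 2 ^ m.+1 + (2 ^ m + i))%N (q * 2 ^ m.+1 + j)%N) e2).
by congr (_ + _); apply: eq_bigr => j _; rewrite ?e1 ?e0 ek.
Qed.

Lemma sum_telescope (F : nat -> R[i]) n : \sum_(j < n) (F j.+1 - F j) = F n - F 0%N.
Proof.
elim: n => [|n IH]; first by rewrite big_ord0 subrr.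
by rewrite big_ord_recr /= IH addrC addrA subrK.
Qed.

(** The cells telescope, so only the boundary of the square contributes. *)
Lemma circulation_boundary k p q m : circulation k p q m =
  ((2 ^+ (k + m))^-1)%:C *
   (\sum_(i < 2 ^ m) (P (dyad (k + m) (p * 2 ^ m + i)) (dyad k q)
                    - P (dyad (k + m) (p * 2 ^ m + i)) (dyad k q.+1))
  + \sum_(j < 2 ^ m) (Q (dyad k p.+1) (dyad (k + m) (q * 2 ^ m + j))
                    - Q (dyad k p) (dyad (k + m) (q * 2 ^ m + j)))).
Proof.
rewrite /circulation /circulation_cell.
under eq_bigr do rewrite big_split /=.
rewrite big_split /= mulrDr; congr (_ + _).
  rewrite mulr_sumr; apply: eq_bigr => i _.
  rewrite -mulr_sumr; congr (_ * _).
  have := sum_telescope (fun j => - P (dyad (k + m) (p * 2 ^ m + i)) (dyad (k + m) (q * 2 ^ m + j))) (2 ^ m).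
  rewrite addn0 -mulSnr !dyad_scale opprK [X in _ = X]addrC => <-.
  by apply: eq_bigr => j _; rewrite opprK addrC addnS.
rewrite exchange_big mulr_sumr; apply: eq_bigr => j _ /=.
rewrite -mulr_sumr; congr (_ * _).
have := sum_telescope (fun i => Q (dyad (k + m) (p * 2 ^ m + i)) (dyad (k + m) (q * 2 ^ m + j))) (2 ^ m).
rewrite addn0 -mulSnr !dyad_scale => <-.
by apply: eq_bigr => i _; rewrite addnS.
Qed.

Lemma dyadS k p : dyad k p.+1 = dyad k p + (2 ^+ k)^-1.
Proof. by rewrite /dyad -natr1 mulrDl mul1r. Qed.

Lemma dyad_le k p q : (dyad k p <= dyad k q) = (p <= q)%N.
Proof. by rewrite /dyad ler_pM2r ?invr_gt0 ?exprn_gt0 // ler_nat. Qed.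

Lemma dyad_in k m p i : (i < 2 ^ m)%N ->
  dyad k p <= dyad (k + m) (p * 2 ^ m + i) <= dyad k p.+1.
Proof.
move=> im; rewrite -(dyad_scale k m p) -(dyad_scale k m p.+1) !dyad_le leq_addr mulSnr.
by rewrite leq_add2l ltnW.
Qed.

(** The circulation of an affine closed form vanishes exactly, already for the
    Riemann sums; only the remainders contribute. *)
Lemma circulation_small k p q m (x y E : R) (p0 q0 p1 p2 q2 : R[i]) :
  (forall x' y', dyad k p <= x' <= dyad k p.+1 -> dyad k q <= y' <= dyad k q.+1 ->
     cabs (P x' y' - p0 - p1 * (x' - x)%:C - p2 * (y' - y)%:C) <= E /\
     cabs (Q x' y' - q0 - p2 * (x' - x)%:C - q2 * (y' - y)%:C) <= E) ->
  cabs (circulation k p q m) <= 4 * E / 2 ^+ k.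
Proof.
move=> h; rewrite circulation_boundary.
pose s : R := (2 ^+ k)^-1.
have hm : (2 : R) ^+ m != 0 by rewrite expf_neq0.
pose A i := P (dyad (k + m) (p * 2 ^ m + i)) (dyad k q)
                    - P (dyad (k + m) (p * 2 ^ m + i)) (dyad k q.+1) + p2 * s%:C.
pose B j := Q (dyad k p.+1) (dyad (k + m) (q * 2 ^ m + j))
                    - Q (dyad k p) (dyad (k + m) (q * 2 ^ m + j)) - p2 * s%:C.
have -> : (\sum_(i < 2 ^ m) (P (dyad (k + m) (p * 2 ^ m + i)) (dyad k q)
                    - P (dyad (k + m) (p * 2 ^ m + i)) (dyad k q.+1))
  + \sum_(j < 2 ^ m) (Q (dyad k p.+1) (dyad (k + m) (q * 2 ^ m + j))
                    - Q (dyad k p) (dyad (k + m) (q * 2 ^ m + j)))) =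
  \sum_(i < 2 ^ m) (A i + B i).
  rewrite -big_split /=; apply: eq_bigr => i _; rewrite /A /B.
  by rewrite [in RHS]addrACA subrr addr0.
have qq : dyad k q <= dyad k q <= dyad k q.+1 by rewrite lexx dyad_le leqnSn.
have qq1 : dyad k q <= dyad k q.+1 <= dyad k q.+1 by rewrite lexx dyad_le leqnSn.
have pp : dyad k p <= dyad k p <= dyad k p.+1 by rewrite lexx dyad_le leqnSn.
have pp1 : dyad k p <= dyad k p.+1 <= dyad k p.+1 by rewrite lexx dyad_le leqnSn.
have hA i : (i < 2 ^ m)%N -> cabs (A i) <= 2 * E.
  move=> im; have xi := dyad_in k p im.
  have [h1 _] := h _ _ xi qq; have [h2 _] := h _ _ xi qq1.
  rewrite mulr_natl mulr2n; apply: le_trans (lerD h1 h2).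
  apply: le_trans _ (cabs_subD _ _); rewrite le_eqVlt; apply/orP; left; apply/eqP.
  congr cabs; rewrite /A dyadS -/s.
  have -> : (dyad k q + s - y)%:C = (dyad k q - y)%:C + s%:C by rewrite -rmorphD addrAC.
  by ring.
have hB i : (i < 2 ^ m)%N -> cabs (B i) <= 2 * E.
  move=> im; have yi := dyad_in k q im.
  have [_ h1] := h _ _ pp1 yi; have [_ h2] := h _ _ pp yi.
  rewrite mulr_natl mulr2n; apply: le_trans (lerD h1 h2).
  apply: le_trans _ (cabs_subD _ _); rewrite le_eqVlt; apply/orP; left; apply/eqP.
  congr cabs; rewrite /B dyadS -/s.
  have -> : (dyad k p + s - x)%:C = (dyad k p - x)%:C + s%:C by rewrite -rmorphD addrAC.
  by ring.
rewrite cabsM cabs_real ger0_norm ?invr_ge0 ?exprn_ge0 //.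
apply: (@le_trans _ _ ((2 ^+ (k + m))^-1 * \sum_(i < 2 ^ m) (4 * E))).
  rewrite ler_wpM2l ?invr_ge0 ?exprn_ge0 //.
  apply: le_trans (cabs_sum _ _ _) _; apply: ler_sum => i _.
  apply: le_trans (cabsD _ _) _; apply: le_trans (lerD (hA _ (ltn_ord i)) (hB _ (ltn_ord i))) _.
  by rewrite -mulrDl -natrD.
rewrite sumr_const card_ord -[(4 * E) *+ _]mulr_natl natrX exprD.
have hk : (2 : R) ^+ k != 0 by rewrite expf_neq0.
by rewrite le_eqVlt; apply/orP; left; apply/eqP; field; rewrite hk hm.
Qed.

(** The shared [p2] says that [dP/dy = dQ/dx], which makes the form [P dx + Q dy]
    closed; [(x', y')] is confined to the unit square, where the grids live. *)
Definition closed_form_at (x y : R) := exists p1 p2 q2 : R[i],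
  forall e : R, 0 < e -> exists2 d : R, 0 < d &
    forall x' y', 0 <= x' <= 1 -> 0 <= y' <= 1 -> `|x' - x| + `|y' - y| < d ->
     cabs (P x' y' - P x y - p1 * (x' - x)%:C - p2 * (y' - y)%:C)
       <= e * (`|x' - x| + `|y' - y|) /\
     cabs (Q x' y' - Q x y - p2 * (x' - x)%:C - q2 * (y' - y)%:C)
       <= e * (`|x' - x| + `|y' - y|).

Lemma nested_point (l u : nat -> R) : (forall n, l n <= l n.+1) ->
  (forall n, u n.+1 <= u n) -> (forall n, l n <= u n) ->
  exists x, forall n, l n <= x <= u n.
Proof.
move=> hl hu lu.
have lm i j : (i <= j)%N -> l i <= l j.
  by move=> /subnKC <-; elim: (j - i)%N => [|n IH]; rewrite ?addn0 // addnS (le_trans IH).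
have um i j : (i <= j)%N -> u j <= u i.
  move=> /subnKC <-; elim: (j - i)%N => [|n IH]; rewrite ?addn0 // addnS.
  exact: le_trans (hu _) IH.
have luij i j : l i <= u j.
  apply: le_trans (lm _ _ (leq_maxl i j)) _; apply: le_trans (lu _) _.
  exact: um (leq_maxr _ _).
exists (sup (range l)) => n; apply/andP; split.
  by apply: ub_le_sup; [exists (u 0%N) => _ [i _ <-]|exists n].
by apply: ge_sup; [exists (l 0%N), 0%N|move=> _ [i _ <-]].
Qed.

(** Goursat's subdivision argument with Riemann sums in place of integrals: if the
    circulation does not tend to [0], one quarter of the square keeps at least a
    quarter of it along arbitrarily fine grids; the nested squares shrink to a point
    where differentiability makes the circulation too small. *)
Theorem goursat :
  (forall x y, 0 <= x <= 1 -> 0 <= y <= 1 -> closed_form_at x y) ->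
  forall A : R, 0 < A -> exists m0, forall m, (m0 <= m)%N -> cabs (circulation 0 0 0 m) <= A.
Proof.
move=> hd A A0; apply: contrapT => hA.
(* The refinement level is existential: for each square only infinitely many
   grids are known to be bad, not all of them. *)
pose bad k p q := forall m0, exists2 m, (m0 <= m)%N & A / 4 ^+ k < cabs (circulation k p q m).
have bad0 : bad 0%N 0%N 0%N.
  move=> m0; apply: contrapT => h; apply: hA; exists m0 => m m0m.
  rewrite leNgt; apply/negP => h1; apply: h; exists m => //.
  by rewrite expr0 divr1.
have step (s : nat * nat * nat) : exists s' : nat * nat,
    bad s.1.1 s.1.2 s.2 -> [/\ bad s.1.1.+1 s'.1 s'.2,
      (s.1.2.*2 <= s'.1 <= s.1.2.*2.+1)%N & (s.2.*2 <= s'.2 <= s.2.*2.+1)%N].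
  move: s => [[k p] q] /=; apply: contrapT => h.
  have hb : bad k p q by apply: contrapT => nb; apply: h; exists (0%N, 0%N).
  have good p' q' : (p.*2 <= p' <= p.*2.+1)%N -> (q.*2 <= q' <= q.*2.+1)%N ->
      exists m0, forall m, (m0 <= m)%N -> cabs (circulation k.+1 p' q' m) <= A / 4 ^+ k.+1.
    move=> hp hq; apply: contrapT => hng; apply: h; exists (p', q') => _; split => // m0.
    apply: contrapT => hng2; apply: hng; exists m0 => m m0m.
    by rewrite leNgt; apply/negP => h1; apply: hng2; exists m.
  have b0 n : (n <= n <= n.+1)%N by rewrite leqnn leqnSn.
  have b1 n : (n <= n.+1 <= n.+1)%N by rewrite leqnn leqnSn.
  have [m1 h1] := good _ _ (b0 p.*2) (b0 q.*2).
  have [m2 h2] := good _ _ (b0 p.*2) (b1 q.*2).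
  have [m3 h3] := good _ _ (b1 p.*2) (b0 q.*2).
  have [m4 h4] := good _ _ (b1 p.*2) (b1 q.*2).
  have [[//|m] /=] := hb (maxn (maxn m1 m2) (maxn m3 m4)).+1.
  rewrite ltnS !geq_max => /andP[/andP[n1 n2] /andP[n3 n4]].
  apply/negP; rewrite -leNgt circulationS.
  apply: le_trans (cabsD _ _) _; apply: le_trans (lerD (cabsD _ _) (cabsD _ _)) _.
  apply: le_trans (lerD (lerD (h1 _ n1) (h2 _ n2)) (lerD (h3 _ n3) (h4 _ n4))) _.
  have h4k : (4 : R) ^+ k != 0 by rewrite expf_neq0.
  by rewrite exprS le_eqVlt; apply/orP; left; apply/eqP; field.
have [f hf] := choice step.
pose fix s k := if k is k'.+1 then f (k', (s k').1, (s k').2) else (0%N, 0%N).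
have sbad k : bad k (s k).1 (s k).2.
  by elim: k => [|k IH] //; have [] := hf (k, (s k).1, (s k).2) IH.
have sp k : ((s k).1.*2 <= (s k.+1).1 <= (s k).1.*2.+1)%N.
  by have [] := hf (k, (s k).1, (s k).2) (sbad k).
have sq k : ((s k).2.*2 <= (s k.+1).2 <= (s k).2.*2.+1)%N.
  by have [] := hf (k, (s k).1, (s k).2) (sbad k).
have nest (a : nat -> nat) : (forall k, (a k).*2 <= a k.+1 <= (a k).*2.+1)%N ->
    exists x, forall k, dyad k (a k) <= x <= dyad k (a k).+1.
  move=> ha; have e2 k p : dyad k p = dyad k.+1 p.*2.
    by rewrite -(dyad_scale k 1) addn1 expn1 muln2.
  apply: nested_point => k.
  - by rewrite e2 dyad_le; case/andP: (ha k).
  - by rewrite [leRHS]e2 dyad_le doubleS ltnS; case/andP: (ha k).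
  - by rewrite dyad_le.
have [x hx] := nest _ sp; have [y hy] := nest _ sq.
have in01 (a : nat -> nat) : (forall k, (a k).*2 <= a k.+1 <= (a k).*2.+1)%N -> a 0%N = 0%N ->
    forall k x', dyad k (a k) <= x' <= dyad k (a k).+1 -> 0 <= x' <= 1.
  move=> ha a0 k x' /andP[x1 x2]; apply/andP; split.
    by apply: le_trans x1; rewrite /dyad divr_ge0 ?exprn_ge0.
  apply: le_trans x2 _; rewrite /dyad ler_pdivrMr ?exprn_gt0 // mul1r -natrX ler_nat.
  elim: k {x1} => [|k IH]; first by rewrite a0.
  rewrite expnS mul2n -addnn; move: (ha k) => /andP[_]; lia.
have x01 : 0 <= x <= 1 by exact: (in01 _ sp erefl 0%N).
have y01 : 0 <= y <= 1 by exact: (in01 _ sq erefl 0%N).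
have [p1 [p2 [q2 hpq]]] := hd x y x01 y01.
(* On a square of side [2 ^- k] the increments have sum at most [2 / 2 ^+ k], and
   [circulation_small] multiplies by [4 / 2 ^+ k]; with [A / 8] this gives [A / 4 ^+ k]. *)
have [d d0 hdd] := hpq (A / 8) ltac:(by rewrite divr_gt0).
have half01 : 0 <= (2^-1 : R) < 1 by apply/andP; split; lra.
have [k hk] := geo_small 2 half01 (ltac:(by rewrite divr_gt0) : 0 < d / 2).
have {}hk : 2 / 2 ^+ k < d.
  have := hk k (leqnn _); rewrite exprVn => /le_lt_trans; apply.
  by rewrite ltr_pdivrMr // ltr_pMr // ltr1n.
have s0 : 0 < (2 ^+ k)^-1 :> R by rewrite invr_gt0 exprn_gt0.
have [m _] := sbad k 0%N; apply/negP; rewrite -leNgt.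
apply: le_trans (@circulation_small k _ _ m x y (A / 8 * (2 / 2 ^+ k)) (P x y) (Q x y) p1 p2 q2 _) _.
  move=> x' y' hx' hy'.
  have dist a (z z' : R) : dyad k a <= z <= dyad k a.+1 -> dyad k a <= z' <= dyad k a.+1 ->
      `|z' - z| <= (2 ^+ k)^-1.
    rewrite dyadS => /andP[z1 z2] /andP[z3 z4]; rewrite ler_norml.
    apply/andP; split; lra.
  have dxy : `|x' - x| + `|y' - y| <= 2 / 2 ^+ k.
    by rewrite mulr_natl mulr2n; exact: lerD (dist _ _ _ (hx k) hx') (dist _ _ _ (hy k) hy').
  have [] := hdd x' y' (in01 _ sp erefl _ _ hx') (in01 _ sq erefl _ _ hy') (le_lt_trans dxy hk).
  by move=> h1 h2; split; [apply: le_trans h1 _|apply: le_trans h2 _];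
    rewrite ler_wpM2l // divr_ge0 // ltW.
have hk2 : (2 : R) ^+ k != 0 by rewrite expf_neq0.
have -> : (4 : R) ^+ k = 2 ^+ k * 2 ^+ k by rewrite -exprMn -natrM.
by rewrite le_eqVlt; apply/orP; left; apply/eqP; field.
Qed.

End Goursat.

(** * Cauchy's formula and power series expansion *)

Section Vitali.
Context {R : realType}.
Local Open Scope complex_scope.

Lemma sum_coef_lim (d : nat -> nat -> R[i]) (c : nat -> R[i]) (a : R[i]) L :
  cabs a < 1 ->
  (forall n, (n < L)%N -> forall e : R, 0 < e -> exists M0, forall M, (M0 <= M)%N ->
     cabs (c n - d M n) <= e) ->
  forall e : R, 0 < e -> exists M0, forall M, (M0 <= M)%N ->
    cabs (\sum_(n < L) c n * a ^+ n - \sum_(n < L) d M n * a ^+ n) <= e.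
Proof.
move=> a1; elim: L => [|L IH] h e e0.
  by exists 0%N => M _; rewrite !big_ord0 subrr cabs0 ltW.
have e2 : 0 < e / 2 by rewrite divr_gt0.
have [M1 h1] := IH (fun n nL => h n (ltnW nL)) _ e2.
have [M2 h2] := h L (ltnSn L) _ e2.
exists (maxn M1 M2) => M; rewrite geq_max => /andP[/h1 {}h1 /h2 {}h2].
rewrite !big_ord_recr /= opprD addrACA -mulrBl [leRHS]splitr.
apply: le_trans (cabsD _ _) _; apply: lerD => //; rewrite cabsM.
by apply: le_trans h2; rewrite ler_piMr ?cabs_ge0 // cabsX exprn_ile1 ?cabs_ge0 // ltW.
Qed.

(** If power series with uniformly bounded coefficients converge pointwise on the
    disk, their coefficients converge: the [n]-th one is recovered, up to
    [O(|a|)], from the value at a small [a] and the previous ones. *)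
Lemma pointwise_limit_psum (d : nat -> nat -> R[i]) (F : R[i] -> R[i]) (B : R) :
  (forall M n, cabs (d M n) <= B) ->
  (forall a, cabs a < 1 -> forall e : R, 0 < e -> exists M0, forall M L, (M0 <= M)%N ->
     cabs (F a - \sum_(n < L) d M n * a ^+ n) <= e + B / (1 - cabs a) * cabs a ^+ L) ->
  exists2 c, (forall n, cabs (c n) <= B) & forall a, cabs a < 1 -> psum c a = F a.
Proof.
move=> hB hF.
have B0 : 0 <= B by exact: le_trans (cabs_ge0 _) (hB 0%N 0%N).
pose c n := clim (fun M => d M n).
have cv n : forall e : R, 0 < e -> exists M0, forall M, (M0 <= M)%N -> cabs (c n - d M n) <= e.
  elim/ltn_ind: n => n IH; apply: clim_cauchy => e e0.
  (* The tail beyond degree [n] is at most [2 B t ^+ n.+1] for [t <= 1 / 2], hence at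
     most [e / 8 * t ^+ n] for this [t]. *)
  pose t := Num.min 2^-1 (e / (16 * (B + 1))).
  have B1 : 0 < B + 1 by rewrite ltr_wpDl.
  have t0 : 0 < t by rewrite lt_min invr_gt0 ltr0n divr_gt0 // mulr_gt0.
  have t2 : t <= 2^-1 by rewrite ge_min lexx.
  have tB : 16 * (B + 1) * t <= e.
    by rewrite mulrC -ler_pdivlMr ?mulr_gt0 // ge_min lexx orbT.
  have t1 : t < 1 by apply: le_lt_trans t2 _; rewrite invf_lt1 // ltr1n.
  have ct : cabs t%:C = t by rewrite cabs_real ger0_norm // ltW.
  have ct1 : cabs t%:C < 1 by rewrite ct.
  have e'0 : 0 < e * t ^+ n / 8 by rewrite divr_gt0 // mulr_gt0 // exprn_gt0.
  have [M1 h1] := hF _ ct1 _ e'0.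
  have [M2 h2] := sum_coef_lim ct1 IH e'0.
  exists (maxn M1 M2).
  suff key M : (maxn M1 M2 <= M)%N -> cabs (F t%:C - \sum_(j < n) c j * t%:C ^+ j - d M n * t%:C ^+ n)
      <= e / 2 * t ^+ n.
    move=> M M' hM hM'; rewrite -(ler_pM2r (exprn_gt0 n t0)).
    have -> : cabs (d M n - d M' n) * t ^+ n = cabs (d M n * t%:C ^+ n - d M' n * t%:C ^+ n).
      by rewrite -mulrBl cabsM cabsX ct.
    apply: le_trans (cabs_trans (F t%:C - \sum_(j < n) c j * t%:C ^+ j) _ _) _.
    rewrite cabsB [in leRHS](splitr e) mulrDl.
    exact: lerD (key _ hM) (key _ hM').
  rewrite geq_max => /andP[m1 m2].
  have := h1 M n.+1 m1; rewrite big_ord_recr /= ct => h.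
  have -> : F t%:C - \sum_(j < n) c j * t%:C ^+ j - d M n * t%:C ^+ n =
     F t%:C - (\sum_(i < n) d M i * t%:C ^+ i + d M n * t%:C ^+ n) -
     (\sum_(j < n) c j * t%:C ^+ j - \sum_(j < n) d M j * t%:C ^+ j).
    move: (\sum_(i < n) d M i * t%:C ^+ i) (\sum_(j < n) c j * t%:C ^+ j) => s1 s2; ring.
  apply: le_trans (cabs_subD _ _) _; apply: le_trans (lerD h (h2 _ m2)) _.
  have tn0 : 0 < t ^+ n by rewrite exprn_gt0.
  have hb : B / (1 - t) * t ^+ n.+1 <= e / 8 * t ^+ n.
    rewrite exprS mulrA ler_pM2r // mulrAC ler_pdivrMr ?subr_gt0 //.
    have : e / 8 * 2^-1 <= e / 8 * (1 - t).
      by rewrite ler_pM2l ?divr_gt0 //; clear -t2; lra.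
    apply: le_trans; clear -tB t0 B0.
    have : 0 <= t by rewrite ltW.
    by nra.
  apply: le_trans (lerD (lerD (lexx _) hb) (lexx _)) _.
  rewrite (_ : _ + _ = 3 / 8 * (e * t ^+ n)); last by field.
  rewrite (_ : e / 2 * _ = 4 / 8 * (e * t ^+ n)); last by field.
  by rewrite ler_pM2r ?mulr_gt0 // ler_pM2r ?invr_gt0 // ler_nat.
exists c => [n|a a1].
  apply/ler_addgt0Pr => e /cv - /(_ n)[M0 h0].
  rewrite -[c n](subrK (d M0 n)) [leRHS]addrC; apply: le_trans (cabsD _ _) _.
  by apply: lerD => //; exact: h0.
apply: psum_eq => e e0.
have [N hN] := geo_small (B / (1 - cabs a)) (ltac:(by rewrite cabs_ge0 a1) : 0 <= cabs a < 1) e0.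
exists N => L /hN; apply: le_trans.
apply/ler_addgt0Pr => k k0; have k2 : 0 < k / 2 by rewrite divr_gt0.
have [M1 h1] := hF _ a1 _ k2.
have [M2 h2] := sum_coef_lim a1 (fun n (_ : (n < L)%N) => cv n) k2.
have {}h1 := h1 (maxn M1 M2) L (leq_maxl _ _).
have {}h2 := h2 (maxn M1 M2) (leq_maxr _ _).
apply: le_trans (cabs_trans (\sum_(n < L) d (maxn M1 M2) n * a ^+ n) _ _) _.
rewrite [X in _ + X]cabsB; apply: le_trans (lerD h1 h2) _.
by rewrite le_eqVlt; apply/orP; left; apply/eqP; rewrite [in RHS](splitr k); ring.
Qed.

End Vitali.

Section UnitCircle.
Context {R : realType}.
Local Open Scope complex_scope.

(** The parametrisation of the unit circle by [[0, 1]], whose dyadic points are the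
    roots of unity of order a power of two. *)
Definition uexp (y : R) : R[i] := cos (2 * pi * y) +i* sin (2 * pi * y).

Lemma uexpD x y : uexp (x + y) = uexp x * uexp y.
Proof. by rewrite /uexp mulrDr cosD sinD; apply: complex_ReIm => //=; rewrite addrC. Qed.

Lemma uexp0 : uexp 0 = 1.
Proof. by rewrite /uexp mulr0 cos0 sin0. Qed.

Lemma uexp1 : uexp 1 = 1.
Proof. by rewrite /uexp mulr1 mulr_natl cos2pi sin2pi. Qed.

Lemma cabs_uexp y : cabs (uexp y) = 1.
Proof. by rewrite cabsE /= cos2Dsin2 sqrtr1. Qed.

Lemma uexp_neq0 y : uexp y != 0.
Proof. by rewrite -cabs_eq0 cabs_uexp oner_eq0. Qed.

Lemma uexpMn n y : uexp (n%:R * y) = uexp y ^+ n.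
Proof.
elim: n => [|n IH]; first by rewrite mul0r uexp0 expr0.
by rewrite -natr1 mulrDl mul1r uexpD IH exprSr.
Qed.

Lemma uexp_neq1 (y : R) : 0 < y < 1 -> uexp y != 1.
Proof.
move=> /andP[y0 y1]; apply/negP => /eqP h.
have h1 : cos (2 * pi * y) = 1 by have := congr1 (@complex.Re R) h.
have hp : 0 < pi * y < pi.
  by rewrite mulr_gt0 ?pi_gt0 //= -[ltRHS]mulr1 ltr_pM2l ?pi_gt0.
have := sin_gt0_pi hp.
have : cos (pi * y + pi * y) = 1 by rewrite -mulr2n -mulr_natl mulrA.
rewrite cosD => h2.
have : sin (pi * y) ^+ 2 = 0 by have := cos2Dsin2 (pi * y); lra.
by move=> /eqP; rewrite sqrf_eq0 => /eqP ->; rewrite ltxx.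
Qed.

Lemma unity_root_sum (x : R[i]) N : x ^+ N = 1 -> x != 1 -> \sum_(j < N) x ^+ j = 0.
Proof.
move=> xN x1; have := subrX1 x N; rewrite xN subrr => /esym/eqP.
by rewrite mulf_eq0 subr_eq0 (negbTE x1) => /eqP.
Qed.

(** Mean of [F] over the [2 ^ m]-th roots of unity; these means replace contour
    integrals, since they are exact on Laurent polynomials of degree below [2 ^ m]. *)
Definition cmean m (F : R[i] -> R[i]) : R[i] :=
  ((2 ^+ m)^-1)%:C * \sum_(j < 2 ^ m) F (uexp (j%:R / 2 ^+ m)).

Lemma cmean_sum m L (F : nat -> R[i] -> R[i]) :
  cmean m (fun u => \sum_(n < L) F n u) = \sum_(n < L) cmean m (F n).
Proof. by rewrite /cmean exchange_big mulr_sumr. Qed.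

Lemma cmeanD m F G : cmean m (fun u => F u + G u) = cmean m F + cmean m G.
Proof. by rewrite /cmean big_split mulrDr. Qed.

Lemma cmeanZ m a F : cmean m (fun u => a * F u) = a * cmean m F.
Proof. by rewrite /cmean -mulr_sumr mulrCA. Qed.

Lemma cmeanB m F G : cmean m (fun u => F u - G u) = cmean m F - cmean m G.
Proof. by rewrite /cmean sumrB mulrBr. Qed.

Lemma eq_cmean m F G : (forall u, cabs u = 1 -> F u = G u) -> cmean m F = cmean m G.
Proof. by move=> h; congr (_ * _); apply: eq_bigr => j _; rewrite h // cabs_uexp. Qed.

Lemma cmean_const m a : cmean m (fun=> a) = a.
Proof.
rewrite /cmean sumr_const card_ord -[a *+ _]mulr_natl mulrA.
have -> : (2 ^ m)%:R = (2 ^+ m)%:C :> R[i] by rewrite natrX rmorphXn rmorph_nat.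
by rewrite -rmorphM mulVf ?mul1r // expf_neq0.
Qed.

Lemma cmean_le_circle m F (B : R) :
  (forall y, 0 <= y <= 1 -> cabs (F (uexp y)) <= B) -> cabs (cmean m F) <= B.
Proof.
move=> h; rewrite /cmean cabsM cabs_real ger0_norm ?invr_ge0 ?exprn_ge0 //.
rewrite mulrC ler_pdivrMr ?exprn_gt0 //; apply: le_trans (cabs_sum _ _ _) _.
apply: le_trans (ler_sum _ (G := fun=> B) _) _.
  move=> j _; apply: h; rewrite divr_ge0 ?exprn_ge0 //= ler_pdivrMr ?exprn_gt0 //.
  by rewrite mul1r -natrX ler_nat ltnW.
by rewrite sumr_const card_ord -[B *+ _]mulr_natr natrX.
Qed.

Lemma cmean_le m F (B : R) : (forall u, cabs u = 1 -> cabs (F u) <= B) ->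
  cabs (cmean m F) <= B.
Proof. by move=> h; apply: cmean_le_circle => y _; rewrite h // cabs_uexp. Qed.

Lemma cmean_expr m n : (0 < n < 2 ^ m)%N -> cmean m (fun u => u ^+ n) = 0.
Proof.
move=> /andP[n0 nm]; rewrite /cmean.
have h2 : (2 : R) ^+ m != 0 by rewrite expf_neq0.
have -> : \sum_(j < 2 ^ m) uexp (j%:R / 2 ^+ m) ^+ n = \sum_(j < 2 ^ m) (uexp (n%:R / 2 ^+ m)) ^+ j.
  by apply: eq_bigr => j _; rewrite -!uexpMn; congr uexp; rewrite mulrCA mulrA.
rewrite unity_root_sum ?mulr0 //.
  rewrite -uexpMn natrX mulrCA divff // mulr1 -[n%:R]mulr1 uexpMn uexp1 expr1n.
  by [].
rewrite uexp_neq1 // divr_gt0 ?ltr0n ?exprn_gt0 //=.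
by rewrite ltr_pdivrMr ?exprn_gt0 // mul1r -natrX ltr_nat.
Qed.

Lemma cmean_exprV m n : (0 < n < 2 ^ m)%N -> cmean m (fun u => (u ^+ n)^-1) = 0.
Proof.
move=> nm; have hm := cmean_expr nm.
have e j : uexp (j%:R / 2 ^+ m) ^+ n != 0 by rewrite expf_neq0 ?uexp_neq0.
rewrite /cmean; have /andP[n0 nlt] := nm.
have h2 : (2 : R) ^+ m != 0 by rewrite expf_neq0.
have -> : \sum_(j < 2 ^ m) (uexp (j%:R / 2 ^+ m) ^+ n)^-1 =
          \sum_(j < 2 ^ m) ((uexp (n%:R / 2 ^+ m))^-1) ^+ j.
  apply: eq_bigr => j _; rewrite exprVn -!uexpMn; congr ((uexp _)^-1).
  by rewrite mulrCA mulrA.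
rewrite unity_root_sum ?mulr0 //.
  rewrite exprVn -uexpMn natrX mulrCA divff // mulr1 -[n%:R]mulr1 uexpMn uexp1 expr1n.
  by rewrite invr1.
rewrite invr_eq1 uexp_neq1 // divr_gt0 ?ltr0n ?exprn_gt0 //=.
by rewrite ltr_pdivrMr ?exprn_gt0 // mul1r -natrX ltr_nat.
Qed.

End UnitCircle.

Section RealDifferential.
Context {R : realType}.
Implicit Types (F G : R -> R -> R[i]) (x y : R).
Local Open Scope complex_scope.

(** Real differentiability in two variables with the partial derivatives [a] and [b]
    exposed, measured in the sum norm. *)
Definition rdiff F x y (a b : R[i]) : Prop := forall e : R, 0 < e -> exists2 d : R, 0 < d &
  forall x' y', `|x' - x| + `|y' - y| < d ->
    cabs (F x' y' - F x y - a * (x' - x)%:C - b * (y' - y)%:C) <= e * (`|x' - x| + `|y' - y|).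

Lemma rdiff_eq F x y a b a' b' : rdiff F x y a b -> a = a' -> b = b' -> rdiff F x y a' b'.
Proof. by move=> h <- <-. Qed.

Lemma rdiff_lip F x y a b : rdiff F x y a b ->
  exists2 d : R, 0 < d & forall x' y', `|x' - x| + `|y' - y| < d ->
   cabs (F x' y' - F x y) <= (1 + cabs a + cabs b) * (`|x' - x| + `|y' - y|).
Proof.
move=> /(_ 1 ltr01)[d d0 h]; exists d => // x' y' /h {}h.
have -> : F x' y' - F x y = (F x' y' - F x y - a * (x' - x)%:C - b * (y' - y)%:C) +
   (a * (x' - x)%:C + b * (y' - y)%:C) by ring.
apply: le_trans (cabsD _ _) _; rewrite -(addrA 1) mulrDl; apply: lerD => //.
apply: le_trans (cabsD _ _) _; rewrite !cabsM !cabs_real mulrDl.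
by apply: lerD; rewrite ler_wpM2l ?cabs_ge0 // ?lerDl ?lerDr.
Qed.

Lemma rdiff_comp f F x y l a b : cdiff f (F x y) l -> rdiff F x y a b ->
  rdiff (fun x y => f (F x y)) x y (l * a) (l * b).
Proof.
move=> hf hF e e0.
pose C := 1 + cabs a + cabs b.
have C0 : 0 < C by rewrite /C -addrA ltr_pwDl // addr_ge0 ?cabs_ge0.
have l0 : 0 < 1 + cabs l by rewrite ltr_pwDl ?cabs_ge0.
have [d1 d10 h1] := hf (e / 2 / C) ltac:(by rewrite !divr_gt0).
have [d2 d20 h2] := rdiff_lip hF.
have [d3 d30 h3] := hF (e / 2 / (1 + cabs l)) ltac:(by rewrite !divr_gt0).
exists (Num.min (d1 / C) (Num.min d2 d3)); first by rewrite !lt_min divr_gt0 ?d20.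
move=> x' y'; rewrite !lt_min => /and3P[n1 n2 n3].
have {}h2 := h2 _ _ n2; have {}h3 := h3 _ _ n3; rewrite -/C in h2.
have {}h1 := h1 (F x' y') ltac:(apply: le_lt_trans h2 _; by rewrite mulrC -ltr_pdivlMr).
rewrite (_ : _ - _ - l * a * _ - l * b * _ = (f (F x' y') - f (F x y) - l * (F x' y' - F x y)) +
  l * (F x' y' - F x y - a * (x' - x)%:C - b * (y' - y)%:C)); last by ring.
apply: le_trans (cabsD _ _) _. rewrite [cabs (l * _)]cabsM.
set n := `|x' - x| + `|y' - y| in h1 h2 h3 *.
have n0 : 0 <= n by rewrite addr_ge0.
rewrite [X in X * n]splitr mulrDl; apply: lerD.
  apply: le_trans h1 _; apply: le_trans (ler_wpM2l _ h2) _; first by rewrite !divr_ge0 // ltW.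
  by rewrite mulrA divfK // gt_eqF.
apply: le_trans (ler_wpM2l (cabs_ge0 _) h3) _.
rewrite mulrA ler_wpM2r // mulrCA ler_piMr ?divr_ge0 ?(ltW e0) //.
by rewrite ler_pdivrMr // mul1r lerDr.
Qed.

Lemma rdiff_mul F G x y a b a' b' : rdiff F x y a b -> rdiff G x y a' b' ->
  rdiff (fun x y => F x y * G x y) x y (a * G x y + F x y * a') (b * G x y + F x y * b').
Proof.
move=> hF hG e e0.
pose C := 1 + cabs a + cabs b; pose C' := 1 + cabs a' + cabs b'.
have C0 : 0 < C by rewrite /C -addrA ltr_pwDl // addr_ge0 ?cabs_ge0.
have C'0 : 0 < C' by rewrite /C' -addrA ltr_pwDl // addr_ge0 ?cabs_ge0.
have f0 : 0 < 1 + cabs (F x y) by rewrite ltr_pwDl ?cabs_ge0.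
have g0 : 0 < 1 + cabs (G x y) by rewrite ltr_pwDl ?cabs_ge0.
have [d1 d10 h1] := rdiff_lip hF; have [d2 d20 h2] := rdiff_lip hG.
have [d3 d30 h3] := hF (e / 3 / (1 + cabs (G x y))) ltac:(by rewrite !divr_gt0).
have [d4 d40 h4] := hG (e / 3 / (1 + cabs (F x y))) ltac:(by rewrite !divr_gt0).
exists (Num.min (e / 3 / (C * C')) (Num.min (Num.min d1 d2) (Num.min d3 d4))).
  by rewrite !lt_min divr_gt0 ?divr_gt0 ?mulr_gt0 ?d10 ?d20 ?d30.
move=> x' y'; rewrite !lt_min => /andP[n0 /andP[/andP[n1 n2] /andP[n3 n4]]].
have {}h1 := h1 _ _ n1; have {}h2 := h2 _ _ n2; have {}h3 := h3 _ _ n3; have {}h4 := h4 _ _ n4.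
rewrite -/C in h1; rewrite -/C' in h2.
rewrite (_ : _ - _ - _ * (x' - x)%:C - _ * (y' - y)%:C = (F x' y' - F x y) * (G x' y' - G x y) +
  (F x' y' - F x y - a * (x' - x)%:C - b * (y' - y)%:C) * G x y +
  F x y * (G x' y' - G x y - a' * (x' - x)%:C - b' * (y' - y)%:C)); last by ring.
set n := `|x' - x| + `|y' - y| in n0 h1 h2 h3 h4 *.
have nn : 0 <= n by rewrite addr_ge0.
apply: le_trans (cabsD _ _) _; apply: le_trans (lerD (cabsD _ _) (lexx _)) _; rewrite !cabsM.
have -> : e * n = e / 3 * n + e / 3 * n + e / 3 * n by field.
apply: lerD; first apply: lerD.
- apply: le_trans (ler_pM (cabs_ge0 _) (cabs_ge0 _) h1 h2) _.
  rewrite mulrACA mulrA ler_wpM2r //.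
  by move: n0; rewrite ltr_pdivlMr ?mulr_gt0 // mulrC => /ltW.
- apply: le_trans (ler_wpM2r (cabs_ge0 _) h3) _.
  rewrite mulrAC ler_wpM2r // mulrAC ler_pdivrMr //.
  by rewrite ler_wpM2l ?divr_ge0 ?(ltW e0) // lerDr.
- apply: le_trans (ler_wpM2l (cabs_ge0 _) h4) _.
  rewrite mulrA ler_wpM2r // mulrA mulrC ler_pdivrMl // mulrC.
  by rewrite mulrC ler_wpM2r ?divr_ge0 ?(ltW e0) // lerDr.
Qed.

Lemma rdiff_cst x y (c : R[i]) : rdiff (fun _ _ => c) x y 0 0.
Proof.
move=> e e0; exists 1 => // x' y' _.
by rewrite subrr !mul0r !subr0 cabs0 mulr_ge0 ?addr_ge0 // ltW.
Qed.

Lemma rdiff_addc F x y a b (c : R[i]) : rdiff F x y a b ->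
  rdiff (fun x y => c + F x y) x y a b.
Proof.
move=> h e e0; have [d d0 hd] := h e e0; exists d => // x' y' /hd.
by congr (cabs _ <= _); ring.
Qed.

Lemma rdiff_mulc F x y a b (c : R[i]) : rdiff F x y a b ->
  rdiff (fun x y => c * F x y) x y (c * a) (c * b).
Proof.
move=> h; apply: rdiff_eq (rdiff_mul (rdiff_cst x y c) h) _ _; by rewrite mul0r add0r.
Qed.

Lemma cdiff_inv (w : R[i]) : w != 0 -> cdiff (fun w => w^-1) w (- w^-1 ^+ 2).
Proof.
move=> w0 e e0; have cw : 0 < cabs w by rewrite cabs_gt0.
exists (Num.min (cabs w / 2) (e * cabs w ^+ 3 / 2)).
  by rewrite lt_min !divr_gt0 // mulr_gt0 // exprn_gt0.
move=> v; rewrite lt_min => /andP[h1 h2].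
have cv : cabs w / 2 <= cabs v.
  have := cabsD (w - v) v; rewrite subrK cabsB => h.
  clear -h h1; lra.
have cv0 : 0 < cabs v by apply: lt_le_trans cv; rewrite divr_gt0.
have v0 : v != 0 by rewrite -cabs_gt0.
have -> : v^-1 - w^-1 - - w^-1 ^+ 2 * (v - w) = (v - w) ^+ 2 / (v * w ^+ 2).
  by field; rewrite v0 w0.
rewrite cabsM cabsV [cabs (v * _)]cabsM !cabsX ler_pdivrMr ?mulr_gt0 ?exprn_gt0 //.
rewrite expr2 mulrAC ler_wpM2r ?cabs_ge0 //.
apply: le_trans (ltW h2) _; rewrite -mulrA ler_wpM2l ?(ltW e0) //.
by rewrite exprS -mulrAC ler_wpM2r ?exprn_ge0 ?(ltW cw).
Qed.

Lemma real_diff (f : R -> R) x l : is_derive x (1 : R) f l ->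
  forall e : R, 0 < e -> exists2 d : R, 0 < d &
    forall y, `|y - x| < d -> `|f y - f x - l * (y - x)| <= e * `|y - x|.
Proof.
move=> [df dl] e e0.
have cv : (fun h => h^-1 *: (f (h + x) - f x)) @ 0^' --> l.
  have <- : 'D_1 f x = l by [].
  have := df; rewrite /derivable /derive.
  have -> // : (fun h : R => h^-1 *: ((f \o shift x) (h *: 1) - f x)) =
    (fun h => h^-1 *: (f (h + x) - f x)).
  by apply/funext => k /=; rewrite [k *: _]mulr1.
move/cvgrPdist_lt: cv => /(_ _ e0).
rewrite /dnbhs => /nbhs_ballP[d /= d0 hd].
exists d => // w wd.
have [->|wz] := eqVneq w x; first by rewrite !subrr mulr0 subrr normr0 mulr0.
have wz0 : w - x != 0 by rewrite subr_eq0.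
have := hd (w - x); rewrite /ball /= sub0r normrN subrK => /(_ wd wz0).
rewrite distrC.
have -> : (w - x)^-1 *: (f w - f x) - l = (w - x)^-1 * (f w - f x - l * (w - x)).
  by rewrite [in RHS]mulrBr mulrCA mulVf // mulr1.
by rewrite normrM normfV mulrC ltr_pdivrMr ?normr_gt0 // => /ltW.
Qed.

Definition i2pi : R[i] := 0 +i* (2 * pi).

Lemma uexp_rdiff x y : rdiff (fun _ y => uexp y) x y 0 (i2pi * uexp y).
Proof.
move=> e e0; have p0 : 0 < 2 * pi :> R by rewrite mulr_gt0 ?pi_gt0.
have [d1 d10 h1] := real_diff (is_derive_cos 0) (ltac:(by rewrite !divr_gt0) : 0 < e / 2 / (2 * pi)).
have [d2 d20 h2] := real_diff (is_derive_sin 0) (ltac:(by rewrite !divr_gt0) : 0 < e / 2 / (2 * pi)).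
exists (Num.min d1 d2 / (2 * pi)); first by rewrite divr_gt0 // lt_min d10.
move=> x' y'; rewrite mul0r subr0 => h.
have : `|2 * pi * (y' - y)| < Num.min d1 d2.
  rewrite normrM (gtr0_norm p0) mulrC -ltr_pdivlMr //; apply: le_lt_trans h.
  by rewrite lerDr.
rewrite lt_min => /andP[n1 n2].
have := h1 (2 * pi * (y' - y)); rewrite subr0 => /(_ n1).
have := h2 (2 * pi * (y' - y)); rewrite subr0 => /(_ n2).
rewrite cos0 sin0 !subr0 oppr0 mul0r subr0 mul1r => k2 k1.
have -> : uexp y' - uexp y - i2pi * uexp y * (y' - y)%:C =
  uexp y * (uexp (y' - y) - 1 - i2pi * (y' - y)%:C).
  have -> : uexp y' = uexp y * uexp (y' - y) by rewrite -uexpD subrKC.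
  by ring.
rewrite cabsM cabs_uexp mul1r; apply: le_trans (cabs_le_ReIm _) _.
rewrite !ReD !ImD !ReN !ImN !ReM !ImM /= !mul0r !mulr0 !oppr0 !addr0 subr0 add0r.
apply: le_trans (lerD k1 k2) _.
rewrite normrM (gtr0_norm p0).
have -> : forall t : R, e / 2 / (2 * pi) * (2 * pi * t) + e / 2 / (2 * pi) * (2 * pi * t) = e * t.
  move=> t; have : 2 * pi != 0 :> R by rewrite gt_eqF.
  by move: (2 * pi) => c c0; field.
by rewrite ler_wpM2l ?(ltW e0) // lerDr.
Qed.

End RealDifferential.

Section Taylor.
Context {R : realType}.
Local Open Scope complex_scope.
Variable f : R[i] -> R[i].
Hypothesis f_analytic : analytic_on_disk f.

Let f_cdiff z : cabs z < 1 -> cdiff f z (cderive f z).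
Proof. by move=> z1; apply: cderivable_cdiff; apply: f_analytic; rewrite unit_diskE. Qed.

(** This is [z / (z - a)] at [z = r u], that is the kernel of Cauchy's formula for the
    measure [dz / z]. *)
Definition cauchy_kernel (r : R) (a u : R[i]) : R[i] := 1 + a * (- a + r%:C * u)^-1.

Section Homotopy.
Variables (r tau : R) (a : R[i]).
Hypotheses (r01 : 0 < r < 1) (ar : cabs a < r) (tau01 : 0 < tau < 1).

Let T (x : R) : R := tau + (1 - tau) * x.
Let W (x y : R) : R[i] := a + (T x)%:C * (- a + r%:C * uexp y).
Let P (x y : R) : R[i] := f (W x y) * ((1 - tau)%:C * ((T x)%:C)^-1).
Let Q (x y : R) : R[i] := f (W x y) * (i2pi * cauchy_kernel r a (uexp y)).

Lemma sub_circle_neq0 u : cabs u = 1 -> - a + r%:C * u != 0.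
Proof.
move=> u1; apply/negP => /eqP h; have : r%:C * u = a by rewrite -[a]addr0 -h; ring.
move=> /(congr1 cabs); rewrite cabsM u1 mulr1 cabs_real gtr0_norm; last by case/andP: r01.
by move=> e; move: ar; rewrite -e ltxx.
Qed.

(** [P dx + Q dy] is the form [f w dw / (w - a)] pulled back along
    [w = a + t (z - a)], with [z] on the circle and [t] from [tau] to [1]. The mixed
    partial derivatives agree without [f] being twice differentiable, because
    [dw / (w - a)] is [dt / t] plus a form in [dy] only. *)
Lemma homotopy_closed x y : 0 <= x <= 1 -> 0 <= y <= 1 -> closed_form_at P Q x y.
Proof.
move=> /andP[x0 x1] _; have /andP[t0 t1] := tau01; have /andP[r0 r1] := r01.
have T0 : 0 < T x by rewrite /T ltr_pwDl // mulr_ge0 // subr_ge0 ltW.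
have T1 : T x <= 1.
  rewrite /T; have : (1 - tau) * x <= (1 - tau) * 1 by rewrite ler_wpM2l // subr_ge0 ltW.
  rewrite mulr1 => h; lra.
have Tn0 : (T x)%:C != 0 by rewrite -cabs_gt0 cabs_real normr_gt0 gt_eqF.
have zn0 := sub_circle_neq0 (cabs_uexp y).
have W1 : cabs (W x y) < 1.
  have -> : W x y = (1 - T x)%:C * a + (T x)%:C * (r%:C * uexp y).
    by rewrite /W rmorphB rmorph1; ring.
  apply: le_lt_trans (cabsD _ _) _; rewrite !cabsM !cabs_real cabs_uexp mulr1.
  rewrite ger0_norm ?subr_ge0 // (gtr0_norm T0) (gtr0_norm r0).
  have : (1 - T x) * cabs a <= (1 - T x) * r by rewrite ler_wpM2l ?subr_ge0 // ltW.
  move=> h; lra.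
have hT : rdiff (fun x _ => (T x)%:C) x y (1 - tau)%:C 0.
  move=> e e0; exists 1 => // x' y' _; rewrite mul0r subr0 -!rmorphB -rmorphM.
  rewrite -rmorphB (_ : T x' - _ - _ = 0); last by rewrite /T; ring.
  by rewrite rmorph0 cabs0 mulr_ge0 ?addr_ge0 ?(ltW e0).
have hZ : rdiff (fun _ y => - a + r%:C * uexp y) x y 0 (r%:C * (i2pi * uexp y)).
  apply: rdiff_addc; apply: rdiff_eq (rdiff_mulc _ (uexp_rdiff x y)) _ _ => //.
  by rewrite mulr0.
have hW : rdiff W x y ((1 - tau)%:C * (- a + r%:C * uexp y))
                ((T x)%:C * (r%:C * (i2pi * uexp y))).
  apply: rdiff_addc; apply: rdiff_eq (rdiff_mul hT hZ) _ _; ring.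
have hf := rdiff_comp (f_cdiff W1) hW.
have hTV := rdiff_mulc (1 - tau)%:C (rdiff_comp (cdiff_inv Tn0) hT).
have hP := rdiff_mul hf hTV.
have hK : rdiff (fun _ y => cauchy_kernel r a (uexp y)) x y 0
   (a * (- (- a + r%:C * uexp y)^-1 ^+ 2 * (r%:C * (i2pi * uexp y)))).
  apply: rdiff_addc.
  apply: rdiff_eq (rdiff_mulc a (rdiff_comp (cdiff_inv zn0) hZ)) _ _.
    by rewrite !mulr0.
  by [].
have hQ := rdiff_mul hf (rdiff_mulc i2pi hK).
pose p2 := cderive f (W x y) * ((1 - tau)%:C * (r%:C * (i2pi * uexp y))).
have hP2 : p2 = cderive f (W x y) * ((T x)%:C * (r%:C * (i2pi * uexp y))) * ((1 - tau)%:C / (T x)%:C) +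
    f (W x y) * ((1 - tau)%:C * (- ((T x)%:C)^-1 ^+ 2 * 0)) by rewrite /p2; field.
have hQ1 : p2 = cderive f (W x y) * ((1 - tau)%:C * (- a + r%:C * uexp y)) *
     (i2pi * cauchy_kernel r a (uexp y)) + f (W x y) * (i2pi * 0).
  by rewrite /p2 /cauchy_kernel; field.
eexists; exists p2; eexists => e e0.
have [d1 d10 h1] := hP e e0; have [d2 d20 h2] := hQ e e0.
exists (Num.min d1 d2); first by rewrite lt_min d10.
move=> x' y' _ _; rewrite lt_min => /andP[n1 n2]; split.
  by rewrite hP2; exact: h1.
by rewrite hQ1; exact: h2.
Qed.

(** Shrinking the circle towards [a] does not change the Cauchy mean in the limit:
    apply [goursat] to the closed form above; the two sides [y = 0] and [y = 1] of the
    square cancel because [uexp] is periodic. *)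
Lemma cmean_homotopy (e : R) : 0 < e -> exists m0, forall m, (m0 <= m)%N ->
  cabs (cmean m (fun u => f (r%:C * u) * cauchy_kernel r a u) -
        cmean m (fun u => f (a + tau%:C * (- a + r%:C * u)) * cauchy_kernel r a u)) <= e.
Proof.
move=> e0; have p0 : 0 < 2 * pi :> R by rewrite mulr_gt0 ?pi_gt0.
have ci : cabs (i2pi : R[i]) = 2 * pi.
  by rewrite cabsE /= expr0n /= add0r sqrtr_sqr gtr0_norm.
have [m0 h0] := goursat homotopy_closed (ltac:(by rewrite mulr_gt0) : 0 < 2 * pi * e).
exists m0 => m /h0; rewrite circulation_boundary.
have d0 k : dyad k 0 = 0 :> R by rewrite /dyad mul0r.
have d1 : dyad 0 1 = 1 :> R by rewrite /dyad expr0 divr1.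
rewrite !d0 d1 big1 ?add0r; last first.
  by move=> i _; rewrite /P /W uexp0 uexp1 subrr.
rewrite mul0n.
have -> : ((2 ^+ m)^-1)%:C * \sum_(j < 2 ^ m) (Q 1 (dyad m (0 + j)) - Q 0 (dyad m (0 + j))) =
   i2pi * (cmean m (fun u => f (r%:C * u) * cauchy_kernel r a u) -
        cmean m (fun u => f (a + tau%:C * (- a + r%:C * u)) * cauchy_kernel r a u)).
  rewrite -cmeanB -cmeanZ; congr (_ * _); apply: eq_bigr => j _.
  rewrite add0n -/(dyad m j) /Q /W /T mulr0 addr0 mulr1 subrKC rmorph1 mul1r addrA subrr add0r.
  ring.
by rewrite cabsM ci ler_pM2l.
Qed.

End Homotopy.

Lemma cauchy_kernel_expand (r : R) (a u : R[i]) L : 0 < r -> cabs a < r -> cabs u = 1 ->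
  cauchy_kernel r a u = \sum_(n < L) (a / r%:C) ^+ n * (u ^+ n)^-1 +
    (a / r%:C) ^+ L * (u ^+ L)^-1 * cauchy_kernel r a u.
Proof.
move=> r0 ar u1.
have u0 : u != 0 by rewrite -cabs_gt0 u1.
have rn0 : r%:C != 0 by rewrite -cabs_gt0 cabs_real normr_gt0 gt_eqF.
have zn0 : - a + r%:C * u != 0.
  rewrite addrC.
  apply/negP => /eqP /subr0_eq /(congr1 cabs); rewrite cabsM u1 mulr1 cabs_real gtr0_norm //.
  by move=> e; move: ar; rewrite -e ltxx.
elim: L => [|L IH]; first by rewrite big_ord0 add0r expr0 invr1 !mul1r.
rewrite big_ord_recr /= [LHS]IH -addrA; congr (_ + _); rewrite /cauchy_kernel !exprS.
have uL : u ^+ L != 0 by rewrite expf_neq0.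
move: (u ^+ L) uL ((a / r%:C) ^+ L) => v v0 b; field.
by rewrite zn0 u0 v0 rn0.
Qed.

Lemma cabs_cauchy_kernel (r : R) (a u : R[i]) : 0 < r -> cabs a < r -> cabs u = 1 ->
  cabs (cauchy_kernel r a u) <= (1 - cabs a / r)^-1.
Proof.
move=> r0 ar u1.
have a1 : 0 < 1 - cabs a / r by rewrite subr_gt0 ltr_pdivrMr // mul1r.
rewrite -[leRHS]mul1r ler_pdivlMr //.
have := cauchy_kernel_expand 1 r0 ar u1.
rewrite big_ord1 !expr0 invr1 mulr1 !expr1 => h.
have {h} : cabs (cauchy_kernel r a u) <= 1 + cabs a / r * cabs (cauchy_kernel r a u).
  rewrite {1}h; apply: le_trans (cabsD _ _) _; rewrite cabs1 !cabsM !cabsV u1 cabs_real.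
  by rewrite invr1 mulr1 gtr0_norm.
by rewrite mulrBr mulr1 lerBlDr mulrC.
Qed.

Lemma cmean_cauchy_kernel (r : R) (a : R[i]) : 0 < r -> cabs a < r ->
  forall e : R, 0 < e -> exists m0, forall m, (m0 <= m)%N ->
  cabs (1 - cmean m (cauchy_kernel r a)) <= e.
Proof.
move=> r0 ar e e0; have q0 : 0 <= cabs a / r < 1.
  by rewrite divr_ge0 ?cabs_ge0 ?(ltW r0) //= ltr_pdivrMr // mul1r.
have [N hN] := geo_small (1 - cabs a / r)^-1 q0 e0.
exists N => m Nm.
have -> : cmean m (cauchy_kernel r a) = 1 + cmean m (fun u =>
    (a / r%:C) ^+ (2 ^ m) * (u ^+ (2 ^ m))^-1 * cauchy_kernel r a u).
  rewrite (eq_cmean m (fun u => cauchy_kernel_expand (2 ^ m) r0 ar)).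
  rewrite cmeanD; congr (_ + _).
  rewrite (cmean_sum m (2 ^ m) (fun n u => (a / r%:C) ^+ n * (u ^+ n)^-1)).
  rewrite -(ltn_predK (expn_gt0 2 m : (0 < 2 ^ m)%N)) big_ord_recl /=.
  rewrite [X in X + _](eq_cmean m (G := fun=> 1)); last by move=> u _; rewrite !expr0 invr1 mulr1.
  rewrite cmean_const big1 ?addr0 // => i _.
  rewrite cmeanZ cmean_exprV ?mulr0 // /bump /= add1n /=.
  by have := ltn_ord i; rewrite ltn_predRL.
rewrite opprD addrA subrr add0r cabsN.
apply: le_trans _ (hN (2 ^ m)%N (leq_trans Nm (ltnW (ltn_expl _ _)))) => //.
apply: cmean_le => u u1; rewrite !cabsM cabsV !cabsX u1 expr1n invr1 mulr1 cabsM cabsV cabs_real.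
rewrite gtr0_norm // mulrC ler_wpM2r ?exprn_ge0 ?(andP q0).1 //.
exact: cabs_cauchy_kernel.
Qed.

(** Move the circle to a small one around [a], where [f] is nearly constant. *)
Lemma cauchy_formula (r : R) (a : R[i]) : 0 < r < 1 -> cabs a < r ->
  forall e : R, 0 < e -> exists m0, forall m, (m0 <= m)%N ->
  cabs (f a - cmean m (fun u => f (r%:C * u) * cauchy_kernel r a u)) <= e.
Proof.
move=> r01 ar e e0; have /andP[r0 r1] := r01.
have e3 : 0 < e / 3 by rewrite divr_gt0.
have k0 : 0 < 1 - cabs a / r by rewrite subr_gt0 ltr_pdivrMr // mul1r.
have [d d0 hd] := cdiff_continuous (f_cdiff (lt_trans ar r1))
  (ltac:(by rewrite mulr_gt0) : 0 < e / 3 * (1 - cabs a / r)).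
pose tau := Num.min 2^-1 (d / 4).
have tau01 : 0 < tau < 1.
  rewrite lt_min invr_gt0 ltr0n divr_gt0 //= gt_min invf_lt1 ?ltr1n //.
have taud : tau * 2 < d.
  have : tau <= d / 4 by rewrite /tau ge_min lexx orbT.
  move=> h; lra.
have [m1 h1] := cmean_homotopy r01 ar tau01 e3.
have fa0 : 0 < 1 + cabs (f a) by rewrite ltr_pwDl ?cabs_ge0.
have [m2 h2] := cmean_cauchy_kernel r0 ar (ltac:(by rewrite divr_gt0) : 0 < e / 3 / (1 + cabs (f a))).
exists (maxn m1 m2) => m; rewrite geq_max => /andP[/h1 {}h1 /h2 {}h2].
pose G u := f (a + tau%:C * (- a + r%:C * u)).
have h3 : cabs (cmean m (fun u => f a * cauchy_kernel r a u) -
    cmean m (fun u => G u * cauchy_kernel r a u)) <= e / 3.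
  rewrite -cmeanB; apply: cmean_le => u u1; rewrite -mulrBl cabsM.
  have hu : cabs (f a - G u) <= e / 3 * (1 - cabs a / r).
    rewrite cabsB; apply: hd; rewrite addrC addKr cabsM cabs_real gtr0_norm; last by case/andP: tau01.
    apply: le_lt_trans taud; rewrite ler_wpM2l ?(ltW (andP tau01).1) //.
    apply: le_trans (cabsD _ _) _; rewrite cabsN cabsM u1 mulr1 cabs_real gtr0_norm //.
    lra.
  apply: le_trans (ler_pM (cabs_ge0 _) (cabs_ge0 _) hu (cabs_cauchy_kernel r0 ar u1)) _.
  by rewrite mulfK // gt_eqF.
have h4 : cabs (f a - cmean m (fun u => f a * cauchy_kernel r a u)) <= e / 3.
  rewrite cmeanZ -{1}[f a]mulr1 -mulrBr cabsM.
  apply: le_trans (ler_wpM2l (cabs_ge0 _) h2) _.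
  by rewrite mulrCA ler_piMr ?(ltW e3) // ler_pdivrMr // mul1r lerDr.
apply: le_trans (cabs_trans (cmean m (fun u => f a * cauchy_kernel r a u)) _ _) _.
have -> : e = e / 3 + (e / 3 + e / 3) by field.
apply: lerD => //.
apply: le_trans (cabs_trans (cmean m (fun u => G u * cauchy_kernel r a u)) _ _) _.
by apply: lerD => //; rewrite cabsB.
Qed.

Lemma circle_bounded (r : R) : 0 < r < 1 ->
  exists B : R, forall y, 0 <= y <= 1 -> cabs (f (r%:C * uexp y)) <= B.
Proof.
move=> /andP[r0 r1].
have cont : {within `[0, 1], continuous (fun y : R => cabs (f (r%:C * uexp y)))}.
  apply: continuous_subspaceT => y; apply/cvgrPdist_le => e e0.
  have z1 : cabs (r%:C * uexp y) < 1 by rewrite cabsM cabs_uexp mulr1 cabs_real gtr0_norm.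
  have [d d0 hd] := cdiff_continuous (f_cdiff z1) e0.
  have [d1 d10 hd1] := rdiff_lip (rdiff_mulc r%:C (uexp_rdiff 0 y)).
  set C := (1 + _ + _) in hd1.
  have C0 : 0 < C by rewrite /C -addrA ltr_pwDl // addr_ge0 ?cabs_ge0.
  near=> y'.
  have ny : `|y' - y| < Num.min d1 (d / C).
    rewrite distrC; near: y'; apply: cvgr_dist_lt => //.
    by rewrite lt_min d10 divr_gt0.
  move: ny; rewrite lt_min => /andP[n1 n2].
  have := hd1 0 y'; rewrite subrr normr0 add0r => /(_ n1) h1.
  have h2 : cabs (r%:C * uexp y' - r%:C * uexp y) < d.
    by apply: le_lt_trans h1 _; rewrite mulrC -ltr_pdivlMr.
  apply: le_trans (hd _ h2); rewrite distrC ler_norml; apply/andP; split.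
    rewrite lerNl opprB lerBlDr -[X in cabs X <= _](subrK (f (r%:C * uexp y'))).
    by apply: le_trans (cabsD _ _) _; rewrite cabsB.
  rewrite lerBlDr -[X in cabs X <= _](subrK (f (r%:C * uexp y))).
  exact: cabsD.
have [c _ hc] := EVT_max ler01 cont.
by exists (cabs (f (r%:C * uexp c))) => y y01; apply: hc; rewrite in_itv.
Unshelve. all: by end_near.
Qed.

(** Expanding the Cauchy kernel gives, for each [m], a polynomial approximation whose
    coefficients are bounded by the maximum of [f] on the circle. *)
Lemma local_taylor (r : R) : 0 < r < 1 -> exists2 c : nat -> R[i],
    (exists B : R, forall n, cabs (c n) * r ^+ n <= B) &
    forall z, cabs z < r -> f z = psum c z.
Proof.
move=> r01; have /andP[r0 r1] := r01.
have cr : cabs r%:C = r by rewrite cabs_real gtr0_norm.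
have rn0 : r%:C != 0 by rewrite -cabs_gt0 cr.
have [B hB] := circle_bounded r01.
pose d m n := cmean m (fun u => f (r%:C * u) * (u ^+ n)^-1).
have dB m n : cabs (d m n) <= B.
  apply: cmean_le_circle => y y01; rewrite cabsM cabsV cabsX cabs_uexp expr1n invr1 mulr1.
  exact: hB.
have hF a : cabs a < 1 -> forall e : R, 0 < e -> exists M0, forall M L, (M0 <= M)%N ->
     cabs (f (r%:C * a) - \sum_(n < L) d M n * a ^+ n) <= e + B / (1 - cabs a) * cabs a ^+ L.
  move=> a1 e e0.
  have ra : cabs (r%:C * a) < r by rewrite cabsM cr -[ltRHS]mulr1 ltr_pM2l.
  have ra' : r%:C * a / r%:C = a by rewrite mulrAC divff // mul1r.
  have ca' : cabs (r%:C * a) / r = cabs a by rewrite cabsM cr mulrAC divff ?mul1r // gt_eqF.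
  have [m0 h0] := cauchy_formula r01 ra e0.
  exists m0 => M L /h0 {}h0.
  apply: le_trans (cabs_trans _ _ _) (lerD h0 _).
  have -> : \sum_(n < L) d M n * a ^+ n =
      cmean M (fun u => \sum_(n < L) a ^+ n * (f (r%:C * u) * (u ^+ n)^-1)).
    rewrite (cmean_sum M L (fun n u => a ^+ n * (f (r%:C * u) * (u ^+ n)^-1))).
    by apply: eq_bigr => n _; rewrite cmeanZ mulrC.
  rewrite -cmeanB; apply: cmean_le_circle => y y01.
  set u := uexp y; have u1 : cabs u = 1 by exact: cabs_uexp.
  have -> : f (r%:C * u) * cauchy_kernel r (r%:C * a) u -
     \sum_(n < L) a ^+ n * (f (r%:C * u) * (u ^+ n)^-1) =
     f (r%:C * u) * (a ^+ L * (u ^+ L)^-1 * cauchy_kernel r (r%:C * a) u).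
    rewrite {1}(cauchy_kernel_expand L r0 ra u1) ra' mulrDr mulr_sumr addrAC -sumrB big1 ?add0r //.
    by move=> n _; rewrite mulrCA subrr.
  rewrite !cabsM cabsV !cabsX u1 expr1n invr1 mulr1 mulrCA mulrC.
  have := cabs_cauchy_kernel r0 ra u1; rewrite ca' => hk.
  apply: ler_wpM2r; first by rewrite exprn_ge0 ?cabs_ge0.
  by apply: ler_pM => //; rewrite ?cabs_ge0 //; exact: hB.
have [c cB hc] := pointwise_limit_psum dB hF.
exists (fun n => c n * (r%:C^-1) ^+ n).
  exists B => n; rewrite cabsM cabsX cabsV cr -mulrA -exprMn mulVf ?gt_eqF // expr1n mulr1.
  exact: cB.
move=> z zr; rewrite psum_scale hc ?mulrA ?divff ?mul1r //.
by rewrite cabsM cabsV cr mulrC ltr_pdivrMr // mul1r.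
Qed.

(** The expansions on the disks of radius [r] have the same coefficients by
    uniqueness, so the one found for [r = 1 / 2] converges on the whole disk. *)
Theorem taylor : exists2 c, pcoef c & forall z, cabs z < 1 -> f z = psum c z.
Proof.
have h2 : 0 < (2^-1 : R) < 1 by rewrite invr_gt0 ltr0n invf_lt1 // ltr1n.
have [c [B hB] hc] := local_taylor h2.
pose s : R[i] := (2^-1)%:C.
have cs : cabs s = 2^-1 by rewrite cabs_real gtr0_norm // invr_gt0.
have ext (r : R) : 2^-1 <= r < 1 ->
    (exists B : R, forall n, cabs (c n) * r ^+ n <= B) /\ forall z, cabs z < r -> f z = psum c z.
  move=> /andP[r2 r1]; have r0 : 0 < r by apply: lt_le_trans r2; rewrite invr_gt0.
  have [|c' [B' hB'] hc'] := local_taylor (r := r); first by rewrite r0.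
  suff -> : c = c' by split => //; exists B'.
  (* [psum_inj] speaks of series on the whole disk, hence the rescaling by [1 / 2]. *)
  have p1 : pcoef (fun n => c n * s ^+ n).
    by apply: (pcoef_bounded (B := B)) => n; rewrite cabsM cabsX cs.
  have p2 : pcoef (fun n => c' n * s ^+ n).
    apply: (pcoef_bounded (B := B')) => n; rewrite cabsM cabsX cs; apply: le_trans (hB' n).
    by rewrite ler_wpM2l ?cabs_ge0 // lerXn2r // nnegrE ?invr_ge0 // ltW.
  have := psum_inj p1 p2 ltr01 _ => h.
  apply/funext => n; have {}h := h _ n.
  have sn : s ^+ n != 0 by rewrite expf_neq0 // -cabs_gt0 cs invr_gt0.
  apply: (mulIf sn); apply: h => z z1.
  have sz : cabs (s * z) < 2^-1 by rewrite cabsM cs -[ltRHS]mulr1 ltr_pM2l ?invr_gt0.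
  by rewrite !psum_scale -hc // -hc' // (lt_le_trans sz).
exists c.
  move=> rho /andP[rho0 rho1].
  have [|[B1 hB1] _] := ext (Num.max 2^-1 rho).
    by rewrite le_max lexx gt_max rho1 andbT; case/andP: h2.
  exists B1 => n; apply: le_trans (hB1 n); rewrite ler_wpM2l ?cabs_ge0 //.
  by rewrite lerXn2r ?nnegrE ?le_max ?(ltW rho0) ?lexx ?orbT.
move=> z z1; have [|_ ->] // := ext (Num.max 2^-1 ((1 + cabs z) / 2)).
  rewrite le_max lexx gt_max; apply/andP; split => //; apply/andP; split; first by case/andP: h2.
  by lra.
by rewrite lt_max; apply/orP; right; lra.
Qed.

End Taylor.

(** * Hadamard products of series with positive real part *)

Section Positivity.
Context {R : realType}.
Local Open Scope complex_scope.
Implicit Types (c T psi : nat -> R[i]) (u z : R[i]).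

Lemma pcoefM c1 c2 : pcoef c1 -> pcoef c2 -> pcoef (fun n => c1 n * c2 n : R[i]).
Proof.
move=> h1 h2 rho /andP[rho0 rho1].
have r01 : 0 < (1 + rho) / 2 < 1 by apply/andP; split; lra.
have [M1 hM1] := h1 _ r01; have [M2 hM2] := h2 _ r01; exists (M1 * M2) => n.
case/andP: r01 => r0 r1.
apply: (@le_trans _ _ ((cabs (c1 n) * ((1 + rho) / 2) ^+ n) * (cabs (c2 n) * ((1 + rho) / 2) ^+ n))).
  rewrite cabsM mulrACA; apply: ler_wpM2l; first by rewrite mulr_ge0 ?cabs_ge0.
  rewrite -exprMn; apply: lerXn2r; rewrite ?nnegrE ?(ltW rho0) ?(mulr_ge0 (ltW r0) (ltW r0)) //.
  by have := sqr_ge0 (1 - rho); rewrite expr2; lra.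
by apply: ler_pM; rewrite ?mulr_ge0 ?exprn_ge0 ?cabs_ge0 ?(ltW r0).
Qed.

Lemma cmean_laurent m k n : (k < 2 ^ m)%N -> (n < 2 ^ m)%N ->
  cmean m (fun u : R[i] => u ^+ k * (u ^+ n)^-1) = (k == n)%:R.
Proof.
move=> km nm; have u0 u : cabs u = 1 -> u != 0 :> R[i] by move=> u1; rewrite -cabs_gt0 u1.
have [kn|nk|->] := ltngtP k n.
- rewrite (eq_cmean m (G := fun u => (u ^+ (n - k))^-1)) ?cmean_exprV //.
    by rewrite subn_gt0 kn (leq_ltn_trans (leq_subr _ _)).
  move=> u /u0 {}u0; rewrite -{1}(subnK (ltnW kn)) exprD invfM mulrCA divff ?mulr1 //.
  by rewrite expf_neq0.
- rewrite (eq_cmean m (G := fun u => u ^+ (k - n))) ?cmean_expr //.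
    by rewrite subn_gt0 nk (leq_ltn_trans (leq_subr _ _)).
  by move=> u /u0 {}u0; rewrite -{1}(subnK (ltnW nk)) exprD mulfK // expf_neq0.
- rewrite (eq_cmean m (G := fun u => 1)) ?cmean_const //.
  by move=> u /u0 {}u0; rewrite divff // expf_neq0.
Qed.

Lemma conjc_unit u : cabs u = 1 -> conjc u = u^-1.
Proof.
move=> u1; have u0 : u != 0 by rewrite -cabs_gt0 u1.
apply: (mulfI u0); rewrite divff // -sqr_normc -cabsC u1 rmorph1 expr1n //.
Qed.

Lemma Re_conjc z : complex.Re (conjc z) = complex.Re z.
Proof. by case: z. Qed.

Lemma Re_cmean m (F : R[i] -> R[i]) :
  complex.Re (cmean m F) = (2 ^+ m)^-1 * \sum_(j < 2 ^ m) complex.Re (F (uexp (j%:R / 2 ^+ m))).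
Proof. by rewrite /cmean ReCM Re_sum. Qed.

Lemma cmean_poly_mul m M (a b : nat -> R[i]) : (M <= 2 ^ m)%N ->
  cmean m (fun u => (\sum_(k < M) a k * u ^+ k) * (\sum_(n < M) b n * (u ^+ n)^-1))
   = \sum_(k < M) a k * b k.
Proof.
move=> Mm.
have -> : (fun u => (\sum_(k < M) a k * u ^+ k) * (\sum_(n < M) b n * (u ^+ n)^-1)) =
   (fun u => \sum_(k < M) \sum_(n < M) a k * b n * (u ^+ k * (u ^+ n)^-1)).
  apply/funext => u; rewrite mulr_suml; apply: eq_bigr => k _; rewrite mulr_sumr.
  by apply: eq_bigr => n _; ring.
pose G (k : nat) u := \sum_(n < M) a k * b n * (u ^+ k * (u ^+ n)^-1).
rewrite (cmean_sum m M G); apply: eq_bigr => k _.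
rewrite (cmean_sum m M (fun n u => a k * b n * (u ^+ k * (u ^+ n)^-1))).
rewrite (bigD1 k) //= cmeanZ cmean_laurent ?eqxx ?mulr1 ?(leq_trans (ltn_ord _) Mm) //.
rewrite big1 ?addr0 // => n nk; rewrite cmeanZ cmean_laurent ?(leq_trans (ltn_ord _) Mm) //.
by rewrite eq_sym (inj_eq val_inj) (negbTE nk) mulr0.
Qed.

Lemma ord_neq0 M (M0 : (0 < M)%N) (k : 'I_M) : k != Ordinal M0 -> (k == 0 :> nat) = false.
Proof. by move=> k0; apply: negbTE; apply: contra k0 => /eqP h; apply/eqP/val_inj. Qed.

Lemma cmean_polyV_mul m M (a b : nat -> R[i]) : (0 < M)%N -> (M + M <= 2 ^ m)%N ->
  cmean m (fun u => (\sum_(k < M) a k * (u ^+ k)^-1) * (\sum_(n < M) b n * (u ^+ n)^-1))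
   = a 0%N * b 0%N.
Proof.
move=> M0 Mm.
have -> : (fun u => (\sum_(k < M) a k * (u ^+ k)^-1) * (\sum_(n < M) b n * (u ^+ n)^-1)) =
   (fun u => \sum_(k < M) \sum_(n < M) a k * b n * (u ^+ 0 * (u ^+ (k + n))^-1)).
  apply/funext => u; rewrite mulr_suml; apply: eq_bigr => k _; rewrite mulr_sumr.
  by apply: eq_bigr => n _; rewrite expr0 mul1r exprD invfM; ring.
pose G (k : nat) u := \sum_(n < M) a k * b n * (u ^+ 0 * (u ^+ (k + n))^-1).
rewrite (cmean_sum m M G).
have kn (k n : 'I_M) : (k + n < 2 ^ m)%N.
  by apply: leq_trans Mm; rewrite -addSn leq_add // ltnW.
have hG (k : 'I_M) : cmean m (G k) =
     \sum_(n < M) a k * b n * (k + n == 0)%N%:R.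
  rewrite (cmean_sum m M (fun n u => a k * b n * (u ^+ 0 * (u ^+ (k + n))^-1))).
  apply: eq_bigr => n _; rewrite cmeanZ cmean_laurent ?expn_gt0 //.
  by rewrite eq_sym.
under eq_bigr do rewrite hG.
rewrite (bigD1 (Ordinal M0)) //= [X in _ + X]big1 ?addr0; last first.
  move=> k k0; apply: big1 => n _; by rewrite addn_eq0 (ord_neq0 k0) mulr0.
rewrite (bigD1 (Ordinal M0)) //= mulr1 big1 ?addr0 // => n n0.
by rewrite add0n (ord_neq0 n0) mulr0.
Qed.

(** The mean over the circle of [Re T (rho u) * (Re psi (w / u) - kappa)], with
    [rho w = z], is nonnegative; by orthogonality its value is half the real part of
    [(psi * T) z + T 0], minus [kappa Re (T 0)]. The series are replaced by
    polynomials, for which the mean over roots of unity is exact. *)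
Theorem hadamard_Re_ge T psi (kappa : R) : pcoef T -> pcoef psi -> psi 0%N = 1 ->
  (forall z, cabs z < 1 -> 0 <= complex.Re (psum T z)) ->
  (forall z, cabs z < 1 -> kappa <= complex.Re (psum psi z)) ->
  forall z, cabs z < 1 ->
    (2 * kappa - 1) * complex.Re (T 0%N) <= complex.Re (psum (fun n => psi n * T n) z).
Proof.
move=> hT hpsi psi0 T_ge0 psi_ge z z1.
pose rho : R := (1 + cabs z) / 2.
have zr : cabs z < rho by rewrite /rho; lra.
have rho0 : 0 < rho by apply: le_lt_trans (cabs_ge0 z) zr.
have rho1 : rho < 1 by rewrite /rho; lra.
have crho : cabs rho%:C = rho by rewrite cabs_real gtr0_norm.
have rn0 : rho%:C != 0 by rewrite -cabs_gt0 crho.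
pose w := z / rho%:C.
have cw : cabs w = cabs z / rho by rewrite cabsM cabsV crho.
have w1 : cabs w < 1 by rewrite cw ltr_pdivrMr // mul1r.
have [|K1 [x1 [K10 x101 _ h1]]] := psum_unif hT (r := rho); first by rewrite ltW.
have [|K2 [x2 [K20 x201 _ h2]]] := psum_unif hpsi (r := cabs w); first by rewrite cabs_ge0.
have [|B1 hB1] := psum_le hT (r := rho); first by rewrite ltW.
have [|B2 hB2] := psum_le hpsi (r := cabs w); first by rewrite cabs_ge0.
have B10 : 0 <= B1 by apply: le_trans (hB1 0 _); rewrite ?cabs_ge0 // cabs0 ltW.
have B20 : 0 <= B2 by apply: le_trans (hB2 0 _); rewrite ?cabs_ge0 // cabs0 cabs_ge0.
apply/ler_addgt0Pr => e e0.
(* [eta] is the accuracy of the polynomial approximations, and [eta * C] bounds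
   the resulting error in the inequality. *)
pose C := 2 * (B1 + 1 + B2 + `|kappa|) + 1.
have C0 : 0 < C by rewrite ltr_wpDl // mulr_ge0 // !addr_ge0.
pose eta := Num.min 1 (e / C).
have eta0 : 0 < eta by rewrite lt_min ltr01 divr_gt0.
have eta1 : eta <= 1 by rewrite ge_min lexx.
have etaC : eta * C <= e by rewrite -ler_pdivlMr // ge_min lexx orbT.
have [N1 hN1] := geo_small K1 x101 eta0.
have [N2 hN2] := geo_small K2 x201 eta0.
have [N3 hN3] := psum_lim (pcoefM hpsi hT) z1 eta0.
pose m' := maxn N1 (maxn N2 N3); pose M := (2 ^ m')%N; pose m := m'.+1.
have M0 : (0 < M)%N by rewrite expn_gt0.
have MM : (M + M <= 2 ^ m)%N by rewrite addnn -mul2n -expnS.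
have mM : (m' <= M)%N by rewrite ltnW // ltn_expl.
pose TM u := \sum_(k < M) (T k * rho%:C ^+ k) * u ^+ k.
pose PM u := \sum_(n < M) (psi n * w ^+ n) * (u ^+ n)^-1.
have eT u : cabs u = 1 -> cabs (psum T (rho%:C * u) - TM u) <= eta.
  move=> u1; have ru : cabs (rho%:C * u) <= rho by rewrite cabsM crho u1 mulr1.
  apply: le_trans (hN1 M (leq_trans (leq_maxl _ _) mM)); apply: le_trans (h1 _ M ru).
  by rewrite /TM; under [in leRHS]eq_bigr do rewrite exprMn mulrA.
have eP u : cabs u = 1 -> cabs (psum psi (w / u) - PM u) <= eta.
  move=> u1; have ru : cabs (w / u) <= cabs w by rewrite cabsM cabsV u1 invr1 mulr1.
  apply: le_trans (hN2 M (leq_trans (leq_trans (leq_maxl _ _) (leq_maxr _ _)) mM)).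
  by apply: le_trans (h2 _ M ru); rewrite /PM; under [in leRHS]eq_bigr do rewrite expr_div_n mulrA.
pose Fex u := (complex.Re (psum T (rho%:C * u)) * (complex.Re (psum psi (w / u)) - kappa))%:C.
pose Fap u := (complex.Re (TM u) * (complex.Re (PM u) - kappa))%:C.
have ex_ge0 : 0 <= complex.Re (cmean m Fex).
  rewrite Re_cmean mulr_ge0 ?invr_ge0 ?exprn_ge0 // sumr_ge0 // => j _ /=.
  rewrite mulr_ge0 // ?subr_ge0; [apply: T_ge0|apply: psi_ge].
    by rewrite cabsM crho cabs_uexp mulr1.
  by rewrite cabsM cabsV cabs_uexp invr1 mulr1.
have diff : cabs (cmean m Fex - cmean m Fap) <= eta * (B2 + `|kappa| + (B1 + 1)).
  rewrite -cmeanB; apply: cmean_le => u u1.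
  have ru : cabs (rho%:C * u) <= rho by rewrite cabsM crho u1 mulr1.
  have rw : cabs (w / u) <= cabs w by rewrite cabsM cabsV u1 invr1 mulr1.
  have a1 : `|complex.Re (psum T (rho%:C * u)) - complex.Re (TM u)| <= eta.
    by rewrite -ReN -ReD; apply: le_trans (Re_le_cabs _) (eT _ u1).
  have a2 : `|complex.Re (psum psi (w / u)) - complex.Re (PM u)| <= eta.
    by rewrite -ReN -ReD; apply: le_trans (Re_le_cabs _) (eP _ u1).
  have a3 := le_trans (Re_le_cabs _) (hB1 _ ru).
  have a4 := le_trans (Re_le_cabs _) (hB2 _ rw).
  rewrite /Fex /Fap -rmorphB cabs_real.
  move: a1 a2 a3 a4; move: (complex.Re (psum T _)) (complex.Re (TM u)) (complex.Re (psum psi _)) (complex.Re (PM u)) => t t' p p'.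
  move=> a1 a2 a3 a4.
  have -> : t * (p - kappa) - t' * (p' - kappa) = (t - t') * (p - kappa) + (t - (t - t')) * (p - p').
    by ring.
  apply: le_trans (ler_normD _ _) _; rewrite !normrM mulrDr; apply: lerD.
    by apply: ler_pM => //; apply: le_trans (ler_normB _ _) _; rewrite lerD2r.
  rewrite mulrC; apply: ler_pM => //; apply: le_trans (ler_normB _ _) _.
  by apply: lerD => //; exact: le_trans a1 _.
have ap_val : complex.Re (cmean m Fap) =
   (complex.Re (\sum_(k < M) psi k * T k * z ^+ k) + complex.Re (T 0%N)) / 2 - kappa * complex.Re (T 0%N).
  pose G u := 2^-1 * (TM u * PM u + (\sum_(k < M) conjc (T k * rho%:C ^+ k) * (u ^+ k)^-1) * PM u)
     - kappa%:C * (TM u * (\sum_(n < M) (if n == 0 :> nat then 1 else 0) * (u ^+ n)^-1)).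
  have -> : complex.Re (cmean m Fap) = complex.Re (cmean m G).
    rewrite !Re_cmean; congr (_ * _); apply: eq_bigr => j _.
    have := cabs_uexp (j%:R / 2 ^+ m : R); move: (uexp _) => u u1.
    have one : \sum_(n < M) (if n == 0 :> nat then 1 else 0) * (u ^+ n)^-1 = 1.
      rewrite (bigD1 (Ordinal M0)) //= expr0 invr1 mulr1 big1 ?addr0 // => n n0.
      by rewrite (ord_neq0 n0) mul0r.
    have cj : \sum_(k < M) conjc (T k * rho%:C ^+ k) * (u ^+ k)^-1 = conjc (TM u).
      rewrite /TM rmorph_sum; apply: eq_bigr => k _.
      rewrite [in RHS]rmorphM; congr (_ * _).
      by rewrite -[RHS]/(conjc (u ^+ k)) conjc_unit // cabsX u1 expr1n.
    rewrite /G one cj /Fap mulr1 -mulrDl addcJ.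
    have -> : 2^-1 * (2%:R * (complex.Re (TM u))%:C * PM u) = (complex.Re (TM u))%:C * PM u.
      by rewrite !mulrA mulVf ?mul1r // pnatr_eq0.
    by rewrite ReD ReN !ReCM /=; ring.
  have split3 (F1 F2 F3 : R[i] -> R[i]) (a b : R[i]) :
      cmean m (fun u => a * (F1 u + F2 u) - b * F3 u) =
      a * (cmean m F1 + cmean m F2) - b * cmean m F3.
    rewrite (cmeanB m (fun u => a * (F1 u + F2 u)) (fun u => b * F3 u)).
    by rewrite (cmeanZ m a (fun u => F1 u + F2 u)) cmeanD (cmeanZ m b F3).
  rewrite /G (split3 (fun u => TM u * PM u)
    (fun u => (\sum_(k < M) conjc (T k * rho%:C ^+ k) * (u ^+ k)^-1) * PM u)
    (fun u => TM u * (\sum_(n < M) (if n == 0 :> nat then 1 else 0) * (u ^+ n)^-1))).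
  rewrite (cmean_poly_mul (fun k => T k * rho%:C ^+ k) (fun n => psi n * w ^+ n)); last first.
    exact: leq_trans (leq_addr _ _) MM.
  rewrite (cmean_polyV_mul (fun k => conjc (T k * rho%:C ^+ k)) (fun n => psi n * w ^+ n)) //.
  rewrite (cmean_poly_mul (fun k => T k * rho%:C ^+ k) (fun n => if n == 0%N then 1 else 0)); last first.
    exact: leq_trans (leq_addr _ _) MM.
  rewrite psi0 !expr0 !mulr1.
  have -> : \sum_(k < M) T k * rho%:C ^+ k * (if k == 0 :> nat then 1 else 0) = T 0%N.
    rewrite (bigD1 (Ordinal M0)) //= expr0 !mulr1 big1 ?addr0 // => n n0.
    by rewrite (ord_neq0 n0) mulr0.
  have -> : \sum_(k < M) T k * rho%:C ^+ k * (psi k * w ^+ k) = \sum_(k < M) psi k * T k * z ^+ k.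
    apply: eq_bigr => k _; rewrite mulrACA -exprMn.
    by rewrite (_ : rho%:C * w = z) 1?[T k * _]mulrC // /w mulrCA divff ?mulr1.
  have -> : (2^-1 : R[i]) = (2^-1)%:C by rewrite fmorphV rmorph_nat.
  by rewrite ReD ReN !ReCM ReD Re_conjc mulrC.
have h3 : complex.Re (\sum_(k < M) psi k * T k * z ^+ k) <=
    complex.Re (psum (fun n => psi n * T n) z) + eta.
  have := hN3 M (leq_trans (leq_trans (leq_maxr _ _) (leq_maxr _ _)) mM).
  move=> /(le_trans (Re_le_cabs _)); rewrite ReD ReN ler_norml => /andP[hh _].
  by move: hh; rewrite lerNl opprB lerBlDl.
have h4 : complex.Re (cmean m Fex) - complex.Re (cmean m Fap) <= eta * (B2 + `|kappa| + (B1 + 1)).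
  by apply: le_trans diff; rewrite -ReN -ReD; apply: le_trans (Re_le_cabs _); exact: ler_norm.
rewrite ap_val in h4.
move: ex_ge0 h4 h3 etaC; rewrite /C; move: (complex.Re _) (complex.Re _) (complex.Re _) (complex.Re _) => r1 r2 r3 r4.
have : 0 <= eta by exact: ltW.
have -> : eta * (2 * (B1 + 1 + B2 + `|kappa|) + 1) = 2 * (eta * (B2 + `|kappa| + (B1 + 1))) + eta by ring.
move: (eta * _) => y.
clear; lra.
Qed.

End Positivity.

(** * Integrals of Volterra type on the unit interval *)

Section ImproperFTC.
Context {R : realType}.
Notation leb := (@lebesgue_measure R).

Lemma bigcup_itv_right (x : R) : 0 < x ->
  `]0, x]%classic = \bigcup_n `[x / n.+2%:R, x]%classic.
Proof.
move=> x0; apply/seteqP; split => t /=; rewrite in_itv /=.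
  move=> /andP[t0 tx]; have [n hn] : exists n : nat, x / t < n.+2%:R.
    exists (Num.truncn (x / t)); apply: lt_trans (truncnS_gt (x / t)) _.
    by rewrite ltr_nat.
  exists n => //=; rewrite in_itv /= tx andbT ler_pdivrMr //.
  by move: hn; rewrite ltr_pdivrMr // mulrC => /ltW.
move=> [n _ /=]; rewrite in_itv /= => /andP[h ->]; rewrite andbT.
by apply: lt_le_trans h; rewrite divr_gt0.
Qed.

(** The integrand may be unbounded at [0]; monotone convergence along the intervals
    [[x / n, x]] reduces to the compact case. *)
Lemma improper_FTC (c x : R) (f F : R -> R) :
  (forall t, 0 < t < c -> is_derive t (1 : R) F (f t)) ->
  (forall t, 0 < t < c -> {for t, continuous f}) ->
  (forall t, 0 < t < c -> 0 <= f t) ->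
  F t @[t --> 0^'+] --> (0 : R) -> 0 < x < c ->
  (\int[leb]_(t in `]0%R, x]) (f t)%:E = (F x)%:E)%E.
Proof.
move=> dF cf f0 F0 /andP[x0 xc].
have itvP (a t : R) : 0 < a -> a <= t <= x -> 0 < t < c.
  by move=> a0 /andP[at_ tx]; rewrite (lt_le_trans a0 at_) (le_lt_trans tx xc).
have a0 n : 0 < x / n.+2%:R by rewrite divr_gt0.
have ax n : x / n.+2%:R < x by rewrite ltr_pdivrMr // ltr_pMr // ltr1n.
have hn n : (\int[leb]_(t in `[(x / n.+2%:R)%R, x]) (f t)%:E = (F x - F (x / n.+2%:R))%:E)%E.
  have dc t : 0 < t < c -> {for t, continuous F}.
    by move=> /dF[/derivable1_diffP /differentiable_continuous].
  rewrite (@continuous_FTC2 _ f F) //.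
  - apply/(continuous_within_itvP _ (ax n)); split.
    + by move=> t; rewrite in_itv /= => /andP[/ltW t1 /ltW t2]; apply: cf (itvP _ _ (a0 n) _); rewrite t1.
    + by apply: cvg_at_right_filter; apply: cf; rewrite a0 (lt_trans (ax n)).
    + by apply: cvg_at_left_filter; apply: cf; rewrite x0.
  - split.
    + move=> t; rewrite in_itv /= => /andP[/ltW t1 /ltW t2].
      by have [] := dF t (itvP _ _ (a0 n) (ltac:(by rewrite t1) : x / n.+2%:R <= t <= x)).
    + by apply: cvg_at_right_filter; apply: dc; rewrite a0 (lt_trans (ax n)).
    + by apply: cvg_at_left_filter; apply: dc; rewrite x0.
  - move=> t; rewrite in_itv /= => /andP[/ltW t1 /ltW t2].
    have [_ <-] := dF t (itvP _ _ (a0 n) (ltac:(by rewrite t1) : x / n.+2%:R <= t <= x)).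
    by rewrite derive1E.
have cvF : (F (x / n.+2%:R)) @[n --> \oo] --> (0 : R).
  apply: (cvg_comp _ _ _ F0) => A [e /= e0 he].
  have [N hN] : exists N : nat, x / e < N.+1%:R.
    by exists (Num.truncn (x / e)); exact: truncnS_gt.
  exists N => // n /= Nn; apply: (he (x / n.+2%:R) _ (a0 n)).
  rewrite /= sub0r normrN gtr0_norm // ltr_pdivrMr // mulrC -ltr_pdivrMr //.
  by apply: lt_le_trans hN _; rewrite ler_nat; lia.
rewrite bigcup_itv_right //.
have h1 : (\int[leb]_(t in `[(x / n.+2%:R)%R, x]) (f t)%:E @[n --> \oo] -->
     \int[leb]_(t in \bigcup_n `[(x / n.+2%:R)%R, x]%classic) (f t)%:E)%E.
  apply: ge0_nondecreasing_set_cvg_integral => //.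
  - move=> m n mn; apply/subsetPset => t /=; rewrite !in_itv /= => /andP[h ->].
    rewrite andbT; apply: le_trans h; rewrite ler_pM2l // lef_pV2 ?posrE //.
    by rewrite ler_nat; lia.
  - move=> n; apply/measurable_EFinP.
    have : measurable_fun `]0, c[%classic f.
      apply: open_continuous_measurable_fun; first exact: interval_open.
      by move=> t; rewrite inE /= in_itv /= => /cf.
    apply: measurable_funS => // t /=; rewrite !in_itv /=; exact: itvP.
  - by move=> n t /=; rewrite in_itv /= => /(itvP _ _ (a0 n))/f0; rewrite lee_fin.
have h2 : (\int[leb]_(t in `[(x / n.+2%:R)%R, x]) (f t)%:E @[n --> \oo] --> (F x)%:E)%E.
  under eq_fun do rewrite hn.
  apply/fine_cvgP; split; first by near=> n.
  have : F x - F (x / n.+2%:R) @[n --> \oo] --> F x - 0 by apply: cvgB => //; exact: cvg_cst.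
  by rewrite subr0.
exact: cvg_unique h1 h2.
Unshelve. all: by end_near.
Qed.

End ImproperFTC.

Section Triangle.
Context {R : realType}.
Notation leb := (@lebesgue_measure R).
Notation I := (`]0%R, 1%R[%classic : set R).

Lemma measurable_I : measurable I. Proof. exact: measurable_itv. Qed.

Variables p k : R -> R.
Hypotheses (mp : measurable_fun I p) (mk : measurable_fun I k).
Hypotheses (p0 : forall t : R, 0 < t < 1 -> 0 <= p t) (k0 : forall t : R, 0 < t < 1 -> 0 <= k t).

Let F (z : R * R) : \bar R := ((p \_ I) z.1 * (k \_ I) z.2 * (if z.1 <= z.2 then 1 else 0))%:E.

Let F_ge0 z : (0 <= F z)%E.
Proof.
rewrite lee_fin !mulr_ge0 //; last by case: ifP.
  rewrite patchE; case: ifPn => //; rewrite inE /= in_itv /=; exact: p0.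
by rewrite patchE; case: ifPn => //; rewrite inE /= in_itv /=; exact: k0.
Qed.

Let mF : measurable_fun setT F.
Proof.
apply/measurable_EFinP; apply: measurable_funM; first apply: measurable_funM.
- by apply: (measurableT_comp (f := p \_ I)) => //; exact/(measurable_restrictT p measurable_I).
- by apply: (measurableT_comp (f := k \_ I)) => //; exact/(measurable_restrictT k measurable_I).
- by apply: measurable_fun_ifT => //; apply: measurable_fun_ler.
Qed.

Let intF_x (t : R) : 0 < t < 1 ->
  (\int[leb]_x F (t, x) = (p t)%:E * \int[leb]_(x in `[t, 1%R[) (k x)%:E)%E.
Proof.
move=> t01; have /andP[t0 t1] := t01.
rewrite -ge0_integralZl_EFin //; first last.
- exact: p0.
- apply/measurable_EFinP; apply: measurable_funS mk => //.
  move=> x /=; rewrite !in_itv /= => /andP[h ->]; rewrite andbT; exact: lt_le_trans h.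
- move=> x /=; rewrite in_itv /= => /andP[h1 h2]; rewrite lee_fin k0 // h2 andbT.
  exact: lt_le_trans h1.
rewrite [RHS]integral_mkcond; apply: eq_integral => x _.
rewrite /F /= !patchE mem_set /= ?in_itv //=.
have [xI|xI] := boolP (x \in `[t, 1[%classic).
  move: xI; rewrite inE /= in_itv /= => /andP[tx x1].
  by rewrite mem_set /= ?in_itv /= ?x1 ?(lt_le_trans t0) // tx mulr1.
move: xI; rewrite notin_setE /= in_itv /= => /negP; rewrite negb_and -ltNge -leNgt.
move=> /orP[xt|x1].
  by rewrite leNgt xt /= mulr0.
by rewrite memNset /= ?mulr0 ?mul0r // in_itv /= => /andP[_]; rewrite ltNge x1.
Qed.

Let intF_t (x : R) : 0 < x < 1 ->
  (\int[leb]_t F (t, x) = (k x)%:E * \int[leb]_(t in `]0%R, x]) (p t)%:E)%E.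
Proof.
move=> x01; have /andP[x0 x1] := x01.
rewrite -ge0_integralZl_EFin //; first last.
- exact: k0.
- apply/measurable_EFinP; apply: measurable_funS mp => //.
  move=> t /=; rewrite !in_itv /= => /andP[-> h]; exact: le_lt_trans h _.
- move=> t /=; rewrite in_itv /= => /andP[h1 h2]; rewrite lee_fin p0 // h1.
  exact: le_lt_trans h2 _.
rewrite [RHS]integral_mkcond; apply: eq_integral => t _.
rewrite /F /= !patchE [x \in I]mem_set /= ?in_itv //=.
have [tI|tI] := boolP (t \in `]0%R, x]%classic).
  move: tI; rewrite inE /= in_itv /= => /andP[t0 tx].
  by rewrite mem_set /= ?in_itv /= ?t0 ?(le_lt_trans tx) // tx mulr1 mulrC.
move: tI; rewrite notin_setE /= in_itv /= => /negP; rewrite negb_and -leNgt -ltNge.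
move=> /orP[t0|xt].
  by rewrite memNset /= ?mul0r // in_itv /= => /andP[]; rewrite ltNge t0.
by rewrite leNgt xt /= mulr0.
Qed.

(** Tonelli's theorem on the triangle [0 < t <= x < 1]. *)
Lemma triangle_tonelli :
  (\int[leb]_(t in I) ((p t)%:E * \int[leb]_(x in `[t, 1%R[) (k x)%:E) =
   \int[leb]_(x in I) ((k x)%:E * \int[leb]_(t in `]0%R, x]) (p t)%:E))%E.
Proof.
have h : (\int[leb]_t \int[leb]_x F (t, x) = \int[leb]_x \int[leb]_t F (t, x))%E.
  apply (@fubini_tonelli _ _ _ _ R leb leb F mF F_ge0).
transitivity (\int[leb]_t \int[leb]_x F (t, x))%E.
  rewrite integral_mkcond; apply: eq_integral => t _; rewrite patchE.
  case: ifPn; first by rewrite inE /= in_itv /= => /intF_x ->.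
  move=> tI; rewrite integral0_eq // => x _.
  by rewrite /F /= patchE (negbTE tI) mul0r mul0r.
rewrite h [RHS]integral_mkcond; apply: eq_integral => x _; rewrite patchE.
case: ifPn; first by rewrite inE /= in_itv /= => /intF_t ->.
move=> xI; rewrite integral0_eq // => t _.
by rewrite /F /= [X in _ * X * _]patchE (negbTE xI) mulr0 mul0r.
Qed.

Lemma triangle_measurable :
  measurable_fun I (fun t => (p t)%:E * \int[leb]_(x in `[t, 1%R[) (k x)%:E)%E.
Proof.
have := @measurable_fun_fubini_tonelli_F _ _ _ _ R leb F mF F_ge0.
move=> /(measurable_funS measurableT (@subsetT _ I)).
apply: eq_measurable_fun => t; rewrite inE /= in_itv /= => /intF_x <-.
by [].
Qed.

End Triangle.

Section Volterra.
Context {R : realType}.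
Notation leb := (@lebesgue_measure R).
Notation I := (`]0%R, 1%R[%classic : set R).

Lemma continuous_measurable_oo (f : R -> R) (b c : R) :
  (forall t, b < t < c -> {for t, continuous f}) -> measurable_fun `]b, c[ f.
Proof.
move=> h; apply: open_continuous_measurable_fun; first exact: interval_open.
by move=> t; rewrite inE /= in_itv /= => /h.
Qed.

Lemma integrable_mul_bounded (D : set R) (f h : R -> R) (B : R) : measurable D ->
  leb.-integrable D (EFin \o f) -> measurable_fun D h -> (forall x, D x -> `|h x| <= B) ->
  leb.-integrable D (EFin \o (fun x => f x * h x)).
Proof.
move=> mD fi mh hB; have mf : measurable_fun D f.
  by apply/measurable_EFinP; case/integrableP: fi.
apply (@le_integrable _ _ R leb D mD _ (fun x => (B%:E * (EFin \o f) x)%E)).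
- by apply/measurable_EFinP; exact: measurable_funM.
- move=> x Dx; rewrite /= lee_fin !normrM mulrC.
  by rewrite ler_wpM2r // (le_trans (hB x Dx)) // ler_norm.
- exact: integrableZl.
Qed.

Lemma continuous_measurable_I (f : R -> R) :
  (forall t, 0 < t < 1 -> {for t, continuous f}) -> measurable_fun I f.
Proof. exact: continuous_measurable_oo. Qed.

Lemma powR_continuous (a t : R) : 0 < t -> {for t, continuous (fun x => x `^ a)}.
Proof.
move=> t0; have [/derivable1_diffP] := is_derive1_powR a t0.
by move=> /differentiable_continuous.
Qed.

Section Kernel.
Variables (a : R) (kap : R -> R).
Hypothesis a0 : 0 < a.
Hypotheses (mkap : measurable_fun I kap) (kap0 : forall t, 0 < t < 1 -> 0 <= kap t).
Hypothesis ikap : leb.-integrable I (EFin \o kap).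

Definition volterra (t : R) : R := \int[leb]_(x in `[t, 1]) (kap x / x `^ a).

Let k (x : R) := kap x / x `^ a.

Let mk : measurable_fun I k.
Proof.
apply: measurable_funM => //; apply: continuous_measurable_I => t /andP[t0 _].
by apply: cvgV; [rewrite gt_eqF // powR_gt0|exact: powR_continuous].
Qed.

Let k0 (t : R) : 0 < t < 1 -> 0 <= k t.
Proof. by move=> t01; rewrite divr_ge0 ?kap0 ?powR_ge0. Qed.

Lemma volterraE (t : R) : 0 < t < 1 ->
  ((volterra t)%:E = \int[leb]_(x in `[t, 1%R[) (k x)%:E)%E.
Proof.
move=> /andP[t0 t1].
have sub : `]t, 1[%classic `<=` I.
  by move=> x /=; rewrite !in_itv /= => /andP[h ->]; rewrite (lt_trans t0 h).
have mk' : measurable_fun `]t, 1[ (EFin \o k).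
  by apply/measurable_EFinP; apply: measurable_funS mk.
rewrite /volterra /Rintegral !(integral_itv_bndoo _ _ mk') fineK //.
apply: integrable_fin_num => //.
have -> : EFin \o k = EFin \o (fun x => kap x * (x `^ a)^-1) by [].
have ta0 : 0 < t `^ a by rewrite powR_gt0.
apply: (integrable_mul_bounded (B := (t `^ a)^-1)) => //.
- exact: integrableS ikap.
- apply: continuous_measurable_oo => x /andP[tx _]; have x0 := lt_trans t0 tx.
  by apply: cvgV; [rewrite gt_eqF // powR_gt0|exact: powR_continuous].
- move=> x /=; rewrite in_itv /= => /andP[tx _].
  have x0 := lt_trans t0 tx.
  rewrite ger0_norm ?invr_ge0 ?powR_ge0 // lef_pV2 ?posrE ?powR_gt0 //.
  by rewrite ge0_ler_powR ?nnegrE ?(ltW a0) ?(ltW t0) ?(ltW x0) ?(ltW tx).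
Qed.

Lemma volterra_ge0 (t : R) : 0 < t < 1 -> 0 <= volterra t.
Proof.
move=> t01; rewrite -lee_fin volterraE // integral_ge0 // => x /=.
rewrite in_itv /= => /andP[tx x1]; rewrite lee_fin k0 // x1 andbT.
by apply: lt_le_trans tx; case/andP: t01.
Qed.

Lemma volterra_measurable : measurable_fun I volterra.
Proof.
have := triangle_measurable (measurable_cst (1 : R)) mk (fun _ _ => ler01) k0.
move=> h; apply/measurable_EFinP; apply: eq_measurable_fun h => t.
by rewrite inE /= in_itv /= => t01; rewrite mul1e volterraE.
Qed.

(** Interchanging the integrations over the triangle [t <= x] trades the kernel for a
    primitive of [t ^ (a - 1) phi t]. *)
Lemma volterra_integral (phi J : R -> R) : measurable_fun I phi ->
  (forall t, 0 < t < 1 -> 0 <= phi t) ->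
  (forall x, 0 < x < 1 ->
     (\int[leb]_(t in `]0%R, x]) (t `^ (a - 1) * phi t)%:E = (x `^ a * J x)%:E)%E) ->
  (\int[leb]_(t in I) (t `^ (a - 1) * volterra t * phi t)%:E =
   \int[leb]_(x in I) (kap x * J x)%:E)%E.
Proof.
move=> mphi phi0 hJ.
have mp : measurable_fun I (fun t => t `^ (a - 1) * phi t).
  apply: measurable_funM => //; apply: continuous_measurable_I => t /andP[t0 _].
  exact: powR_continuous.
have p0 (t : R) : 0 < t < 1 -> 0 <= t `^ (a - 1) * phi t.
  by move=> t01; rewrite mulr_ge0 ?powR_ge0 ?phi0.
have := triangle_tonelli mp mk p0 k0.
under eq_integral => t.
  rewrite inE /= in_itv /= => t01; rewrite -volterraE // -EFinM mulrAC; over.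
move=> ->; apply: eq_integral => x; rewrite inE /= in_itv /= => x01.
rewrite hJ // -EFinM /k mulrA divfK // gt_eqF // powR_gt0 //; by case/andP: x01.
Qed.

End Kernel.

Lemma powR_primitive (a x : R) n : 0 < a -> 0 < x ->
  (\int[leb]_(t in `]0%R, x]) (t `^ (a - 1) * t ^+ n)%:E = (x `^ a * (x ^+ n / (a + n%:R)))%:E)%E.
Proof.
move=> a0 x0; have an0 : 0 < a + n%:R by rewrite ltr_wpDr.
transitivity (((a + n%:R)^-1 * x `^ (a + n%:R))%:E); last first.
  congr EFin; rewrite powRD; last by apply/implyP => _; rewrite gt_eqF.
  by rewrite powR_mulrn ?ltW // mulrC mulrA.
apply: (@improper_FTC _ (x + 1) x (fun t => t `^ (a - 1) * t ^+ n)
   (fun t => (a + n%:R)^-1 * t `^ (a + n%:R))).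
- move=> t /andP[t0 _].
  have h := is_deriveZ (a + n%:R)^-1 (is_derive1_powR (a + n%:R) t0).
  apply: is_derive_eq h _.
  rewrite /GRing.scale /= mulrA mulVf ?gt_eqF // mul1r addrAC [LHS]powRD.
    by rewrite powR_mulrn // ltW.
  by apply/implyP => _; rewrite gt_eqF.
- move=> t /andP[t0 _]; apply: cvgM; first exact: powR_continuous.
  exact: exprn_continuous.
- by move=> t /andP[t0 _]; rewrite mulr_ge0 ?powR_ge0 ?exprn_ge0 // ltW.
- by rewrite -[X in _ --> X](mulr0 (a + n%:R)^-1); apply: cvgMr; exact: powR_cvg0.
- by rewrite x0 ltrDl ltr01.
Qed.

Lemma powR_primitive0 (a x : R) : 0 < a -> 0 < x ->
  (\int[leb]_(t in `]0%R, x]) (t `^ (a - 1))%:E = (x `^ a / a)%:E)%E.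
Proof.
move=> a0 x0; have := powR_primitive 0 a0 x0; rewrite expr0 addr0 div1r => <-.
by apply: eq_integral => t _; rewrite expr0 mulr1.
Qed.

End Volterra.

Section IteratedVolterra.
Context {R : realType}.
Notation leb := (@lebesgue_measure R).
Notation I := (`]0%R, 1%R[%classic : set R).

Lemma Rintegral_I (f : R -> R) : measurable_fun I f ->
  \int[leb]_(x in `[0, 1]) f x = \int[leb]_(x in I) f x.
Proof. by move=> mf; rewrite /Rintegral integral_itv_bndoo //; apply/measurable_EFinP. Qed.

Lemma ge0_integrable_I (f : R -> R) (r : R) : measurable_fun I f ->
  (forall t, 0 < t < 1 -> 0 <= f t) -> (\int[leb]_(x in I) (f x)%:E = r%:E)%E ->
  leb.-integrable I (EFin \o f).
Proof.
move=> mf f0 fr; apply/integrableP; split; first exact/measurable_EFinP.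
rewrite (_ : \int[leb]_(x in I) _ = \int[leb]_(x in I) (f x)%:E)%E; last first.
  by apply: eq_integral => x; rewrite inE /= in_itv /= => /f0 fx; rewrite ger0_norm.
by rewrite fr ltry.
Qed.

Section TwoKernels.
Variables (mu nu : R) (lam : R -> R).
Hypotheses (mu0 : 0 < mu) (nu0 : 0 < nu).
Hypotheses (ilam : leb.-integrable I (EFin \o lam)) (lam0 : forall t, 0 < t < 1 -> 0 <= lam t).

Let mlam : measurable_fun I lam.
Proof. by apply/measurable_EFinP; case/integrableP: ilam. Qed.

Let nui : 0 < nu^-1. Proof. by rewrite invr_gt0. Qed.
Let mui : 0 < mu^-1. Proof. by rewrite invr_gt0. Qed.

Let LambdaE : Lambda_ nu lam = volterra nu^-1 lam. Proof. by []. Qed.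

Let kap t := Lambda_ nu lam t * t `^ (nu^-1 - 1).

Let mkap : measurable_fun I kap.
Proof.
apply: measurable_funM; first exact: volterra_measurable.
by apply: continuous_measurable_I => t /andP[t0 _]; exact: powR_continuous.
Qed.

Let kap0 t : 0 < t < 1 -> 0 <= kap t.
Proof. by move=> t01; rewrite mulr_ge0 ?powR_ge0 // LambdaE volterra_ge0. Qed.

Let ikap : leb.-integrable I (EFin \o kap).
Proof.
have h := @volterra_integral R nu^-1 lam nui mlam lam0 ilam (fun=> 1) (fun=> nu)
  (measurable_cst _) (fun _ _ => ler01).
apply: (@ge0_integrable_I _ (\int[leb]_(x in I) (lam x * nu))) => //.
have -> : (\int[leb]_(x in I) (kap x)%:E =
     \int[leb]_(t in I) (t `^ (nu^-1 - 1) * volterra nu^-1 lam t * 1)%:E)%E.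
  by apply: eq_integral => t _; rewrite mulr1 mulrC.
rewrite h.
  rewrite /Rintegral fineK //; apply: integrable_fin_num => //.
  by apply: (integrable_mul_bounded (B := `|nu|)) => //; exact: measurable_cst.
move=> x /andP[x0 _]; have := powR_primitive 0 nui x0.
by under eq_integral do rewrite expr0; rewrite addr0 expr0 div1r invrK.
Qed.

Lemma Pi_volterra t : 0 < t < 1 -> Pi_ mu nu lam t = volterra mu^-1 kap t.
Proof.
move=> /andP[t0 t1]; apply: eq_Rintegral => x; rewrite inE /= in_itv /= => /andP[tx _].
rewrite /kap -mulrA powRB //; apply/implyP => _; by rewrite gt_eqF // (lt_le_trans t0).
Qed.

Definition Pi_kernel t := t `^ (mu^-1 - 1) * Pi_ mu nu lam t.

Lemma Pi_kernel_measurable : measurable_fun I Pi_kernel.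
Proof.
apply: (@eq_measurable_fun _ _ _ _ _ (fun t => t `^ (mu^-1 - 1) * volterra mu^-1 kap t)).
  by move=> t; rewrite inE /= in_itv /= => t01; rewrite /Pi_kernel Pi_volterra.
apply: measurable_funM; last exact: volterra_measurable.
by apply: continuous_measurable_I => t /andP[t0 _]; exact: powR_continuous.
Qed.

Lemma Pi_kernel_ge0 t : 0 < t < 1 -> 0 <= Pi_kernel t.
Proof.
by move=> t01; rewrite mulr_ge0 ?powR_ge0 // Pi_volterra // volterra_ge0.
Qed.

(** The kernel is dual to two successive averages with weights [s ^ (1/mu - 1)]
    and [s ^ (1/nu - 1)]. *)
Lemma Pi_kernel_integral (phi J1 J2 : R -> R) :
  measurable_fun I phi -> (forall t, 0 < t < 1 -> 0 <= phi t) ->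
  measurable_fun I J1 -> (forall t, 0 < t < 1 -> 0 <= J1 t) ->
  (forall x, 0 < x < 1 ->
   (\int[leb]_(t in `]0%R, x]) (t `^ (mu^-1 - 1) * phi t)%:E = (x `^ mu^-1 * J1 x)%:E)%E) ->
  (forall x, 0 < x < 1 ->
   (\int[leb]_(t in `]0%R, x]) (t `^ (nu^-1 - 1) * J1 t)%:E = (x `^ nu^-1 * J2 x)%:E)%E) ->
  (\int[leb]_(t in I) (Pi_kernel t * phi t)%:E = \int[leb]_(x in I) (lam x * J2 x)%:E)%E.
Proof.
move=> mphi phi0 mJ1 J10 h1 h2.
have e1 := volterra_integral mui mkap kap0 ikap mphi phi0 h1.
have e2 := volterra_integral nui mlam lam0 ilam mJ1 J10 h2.
transitivity (\int[leb]_(t in I) (t `^ (mu^-1 - 1) * volterra mu^-1 kap t * phi t)%:E)%E.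
  apply: eq_integral => t; rewrite inE /= in_itv /= => t01.
  by rewrite /Pi_kernel Pi_volterra.
rewrite e1 -e2; apply: eq_integral => t _.
by rewrite /kap LambdaE [volterra _ _ _ * _]mulrC.
Qed.

(** Hence the moments of the kernel are those of [lam] divided by
    [(1 / mu + n) (1 / nu + n)]. *)
Lemma Pi_kernel_monomial n :
  (\int[leb]_(t in I) (Pi_kernel t * t ^+ n)%:E =
   \int[leb]_(x in I) (lam x * (x ^+ n / ((mu^-1 + n%:R) * (nu^-1 + n%:R))))%:E)%E.
Proof.
have mX : measurable_fun I (fun t : R => t ^+ n).
  by apply: continuous_measurable_I => t _; exact: exprn_continuous.
have X0 (t : R) : 0 < t < 1 -> 0 <= t ^+ n by move=> /andP[/ltW t0 _]; rewrite exprn_ge0.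
have mn0 : 0 < mu^-1 + n%:R by rewrite ltr_wpDr.
have h1 (x : R) (x01 : 0 < x < 1) := powR_primitive n mui (andP x01).1.
have h2 (x : R) : 0 < x < 1 ->
   (\int[leb]_(t in `]0%R, x]) (t `^ (nu^-1 - 1) * (t ^+ n / (mu^-1 + n%:R)))%:E =
    (x `^ nu^-1 * (x ^+ n / ((mu^-1 + n%:R) * (nu^-1 + n%:R))))%:E)%E.
  move=> /andP[x0 x1].
  under eq_integral do rewrite mulrA mulrC EFinM.
  rewrite ge0_integralZl_EFin //.
  - by rewrite powR_primitive // -EFinM invfM; congr EFin; ring.
  - by move=> t /=; rewrite in_itv /= => /andP[/ltW t0 _]; rewrite lee_fin mulr_ge0 ?powR_ge0 ?exprn_ge0.
  - apply/measurable_EFinP; apply: (measurable_funS measurable_I) => [t /=|].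
      by rewrite !in_itv /= => /andP[-> h]; exact: le_lt_trans h _.
    apply: measurable_funM => //; apply: continuous_measurable_I => t /andP[t0 _].
    exact: powR_continuous.
  - by rewrite invr_ge0 ltW.
apply: (Pi_kernel_integral (J1 := fun t => t ^+ n / (mu^-1 + n%:R))) => //.
- by apply: measurable_funM => //; exact: measurable_cst.
- by move=> t /X0 t0; rewrite divr_ge0 // ltW.
Qed.

Lemma Pi_kernel_integrable : leb.-integrable I (EFin \o Pi_kernel).
Proof.
have h := Pi_kernel_monomial 0.
apply: (@ge0_integrable_I _ (\int[leb]_(x in I) (lam x * (mu * nu)))).
- exact: Pi_kernel_measurable.
- exact: Pi_kernel_ge0.
- transitivity (\int[leb]_(t in I) (Pi_kernel t * t ^+ 0)%:E)%E.
    by apply: eq_integral => t _; rewrite expr0 mulr1.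
  rewrite h.
  under eq_integral do rewrite !addr0 expr0 div1r invfM !invrK.
  rewrite /Rintegral fineK //; apply: integrable_fin_num => //.
  by apply: (integrable_mul_bounded (B := `|mu * nu|)) => //; exact: measurable_cst.
Qed.

End TwoKernels.

End IteratedVolterra.

Section Averages.
Context {R : realType}.
Notation leb := (@lebesgue_measure R).
Notation I := (`]0%R, 1%R[%classic : set R).

Section Rescale.
Variables (b B : R) (phi : R -> R).
Hypotheses (b0 : 0 < b) (cphi : forall t : R, 0 < t < 1 -> {for t, continuous phi}).
Hypotheses (phi0 : forall t : R, 0 < t < 1 -> 0 <= phi t)
  (phiB : forall t : R, 0 < t < 1 -> phi t <= B).

(** The average of [phi] over [[0, x]] with weight [t ^ (b - 1)], after rescaling
    to the unit interval. *)
Definition average (x : R) : R := \int[leb]_(s in `[0, 1]) (s `^ (b - 1) * phi (s * x)).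

Let f t := t `^ (b - 1) * phi t.

Let cf t : 0 < t < 1 -> {for t, continuous f}.
Proof.
by move=> t01; apply: cvgM; [apply: powR_continuous; case/andP: t01|exact: cphi].
Qed.

Let f0 t : 0 < t < 1 -> 0 <= f t.
Proof. by move=> t01; rewrite mulr_ge0 ?powR_ge0 ?phi0. Qed.

Let intf_le (x : R) : 0 < x < 1 ->
  (\int[leb]_(t in `]0%R, x]) (f t)%:E <= (B * (x `^ b / b))%:E)%E.
Proof.
move=> /andP[x0 x1].
have B0 : 0 <= B by apply: le_trans (phiB (t := x) _); rewrite ?phi0 ?x0.
have sub : `]0, x]%classic `<=` I.
  by move=> t /=; rewrite !in_itv /= => /andP[-> h]; exact: le_lt_trans h _.
have mpow : measurable_fun `]0, x] (fun t : R => t `^ (b - 1)).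
  apply: (measurable_funS measurable_I sub); apply: continuous_measurable_I => t /andP[t0 _].
  exact: powR_continuous.
apply: (@le_trans _ _ (\int[leb]_(t in `]0%R, x]) (B%:E * (t `^ (b - 1))%:E))%E).
  apply: ge0_le_integral => //.
  - by move=> t /sub; rewrite /= in_itv /= => t01; rewrite lee_fin f0.
  - apply/measurable_EFinP; apply: (measurable_funS measurable_I sub).
    exact: continuous_measurable_I.
  - by apply/measurable_EFinP; apply: measurable_funM => //; exact: measurable_cst.
  - move=> t /sub; rewrite /= in_itv /= => t01.
    by rewrite -EFinM lee_fin /f mulrC ler_wpM2r ?powR_ge0 // phiB.
rewrite ge0_integralZl_EFin //; last 2 first.
- by move=> t _; rewrite lee_fin powR_ge0.
- exact/measurable_EFinP.
by rewrite powR_primitive0.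
Qed.

Let F y := \int[leb]_(t in `]0, y]) f t.

Let intfE (x : R) : 0 < x < 1 -> (\int[leb]_(t in `]0%R, x]) (f t)%:E = (F x)%:E)%E.
Proof.
move=> x01; rewrite /F /Rintegral fineK // ge0_fin_numE.
  by apply: le_lt_trans (intf_le x01) _; rewrite ltry.
apply: integral_ge0 => t /=; rewrite in_itv /= => /andP[t0 tx].
by rewrite lee_fin f0 // t0; case/andP: x01 => _; exact: le_lt_trans.
Qed.

Let F_le (x : R) : 0 < x < 1 -> 0 <= F x <= B * (x `^ b / b).
Proof.
move=> x01; rewrite -!lee_fin -intfE // intf_le // andbT; apply: integral_ge0 => t /=.
rewrite in_itv /= => /andP[t0 tx].
by rewrite lee_fin f0 // t0; case/andP: x01 => _; exact: le_lt_trans.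
Qed.

Let dF (x : R) : 0 < x < 1 -> is_derive x (1 : R) F (f x).
Proof.
move=> x01; have /andP[x0 x1] := x01.
have u01 : 0 < (1 + x) / 2 < 1 by apply/andP; split; lra.
have xu : x < (1 + x) / 2 by lra.
have fi : leb.-integrable `]0, ((1 + x) / 2)] (EFin \o f).
  apply/integrableP; split.
    apply/measurable_EFinP; apply: (measurable_funS measurable_I); last exact: continuous_measurable_I.
    by move=> t /=; rewrite !in_itv /= => /andP[-> h]; apply: le_lt_trans h _; case/andP: u01.
  rewrite (_ : \int[leb]_(x in _) _ = \int[leb]_(t in `]0%R, ((1 + x) / 2)%R]) (f t)%:E)%E.
    by rewrite intfE // ltry.
  apply: eq_integral => t; rewrite inE /= in_itv /= => /andP[t0 tu].
  rewrite ger0_norm // f0 // t0; case/andP: u01 => _; exact: le_lt_trans.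
have [d1 d2] := continuous_FTC1 xu fi (ltac:(by rewrite bnd_simp) : (BRight 0 < BRight x)%O) (cf x01).
by split; [exact: d1|rewrite -derive1E; exact: d2].
Qed.

Let F_at0 : F t @[t --> 0^'+] --> (0 : R).
Proof.
apply: (@squeeze_cvgr _ _ _ _ (fun=> 0) (fun t => B * (t `^ b / b))).
- near=> t; apply: F_le; apply/andP; split; first by near: t; exact: nbhs_right_gt.
  by near: t; apply: nbhs_right_lt.
- exact: cvg_cst.
- rewrite -[X in _ --> X](mulr0 B); apply: cvgMr.
  by rewrite -[X in _ --> X](mul0r b^-1); apply: cvgMl; exact: powR_cvg0.
Unshelve. all: by end_near.
Qed.

Lemma averageE (x : R) : 0 < x < 1 ->
  (\int[leb]_(t in `]0%R, x]) (t `^ (b - 1) * phi t)%:E = (x `^ b * average x)%:E)%E.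
Proof.
move=> x01; rewrite intfE //; have /andP[x0 x1] := x01.
have dG (s : R) : 0 < s < x^-1 -> is_derive s (1 : R) (fun s => F (s * x)) (x `^ b * (s `^ (b - 1) * phi (s * x))).
  move=> /andP[s0 sx]; have sx01 : 0 < s * x < 1 by rewrite mulr_gt0 //= -ltr_pdivlMr // div1r.
  have dl : is_derive s (1 : R) (fun s => s * x) x.
    have h := is_deriveZ x (is_derive_id s (1 : R)).
    rewrite (_ : (fun s => s * x) = x \*: id); last by apply/funext => u /=; rewrite mulrC.
    by apply: is_derive_eq h _; rewrite /GRing.scale /= mulr1.
  have h := @is_derive1_comp R F (fun s => s * x) s _ _ (dF sx01) dl.
  apply: is_derive_eq h _.
  rewrite /f powRM ?(ltW s0) ?(ltW x0) //.
  have -> : x `^ b = x * x `^ (b - 1) by rewrite mulr_powRB1 // ltW.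
  by rewrite /GRing.scale /=; ring.
have cG (s : R) : 0 < s < x^-1 -> {for s, continuous (fun s => x `^ b * (s `^ (b - 1) * phi (s * x)))}.
  move=> /andP[s0 sx]; have sx01 : 0 < s * x < 1 by rewrite mulr_gt0 //= -ltr_pdivlMr // div1r.
  apply: cvgMr; apply: cvgM; first exact: powR_continuous.
  apply: continuous_comp; last exact: cphi.
  by apply: cvgMl; exact: cvg_id.
have G0 (s : R) : 0 < s < x^-1 -> 0 <= x `^ b * (s `^ (b - 1) * phi (s * x)).
  move=> /andP[s0 sx]; rewrite !mulr_ge0 ?powR_ge0 // phi0 // mulr_gt0 //=.
  by rewrite -ltr_pdivlMr // div1r.
have Gat0 : F (s * x) @[s --> 0^'+] --> (0 : R).
  apply: (@cvg_comp _ _ _ (fun s => s * x) F _ (0^'+)); last exact: F_at0.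
  move=> A [e /= e0 he]; exists e => // s /=; rewrite sub0r normrN => se s0.
  apply: he; rewrite /= ?mulr_gt0 // sub0r normrN gtr0_norm ?mulr_gt0 //.
  move: se; rewrite gtr0_norm // => se; apply: le_lt_trans se.
  by rewrite ler_piMr // ltW.
have := improper_FTC dG cG G0 Gat0 (x := 1).
rewrite ltr01 invf_gt1 //= => /(_ x1); rewrite mul1r => Fx; rewrite -Fx; move: Fx.
have m01 : measurable_fun I (fun s : R => s `^ (b - 1) * phi (s * x)).
  apply: continuous_measurable_I => s /andP[s0 s1].
  have sx01 : 0 < s * x < 1.
    by rewrite mulr_gt0 //= (lt_trans _ x1) // -[ltRHS]mul1r ltr_pM2r.
  apply: cvgM; first exact: powR_continuous.
  apply: continuous_comp; last exact: cphi.
  by apply: cvgMl; exact: cvg_id.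
have m01' : measurable_fun I (fun s : R => (s `^ (b - 1) * phi (s * x))%:E).
  exact/measurable_EFinP.
have m01x : measurable_fun I (fun s : R => (x `^ b * (s `^ (b - 1) * phi (s * x)))%:E).
  by apply/measurable_EFinP; apply: measurable_funM => //; exact: measurable_cst.
have p01 (s : R) : I s -> 0 <= s `^ (b - 1) * phi (s * x).
  rewrite /= in_itv /= => /andP[s0 s1]; rewrite mulr_ge0 ?powR_ge0 // phi0 // mulr_gt0 //=.
  by rewrite (lt_trans _ x1) // -[ltRHS]mul1r ltr_pM2r.
have xb0 : 0 < x `^ b by rewrite powR_gt0.
rewrite /average /Rintegral (integral_itv_bndoo _ _ m01x) (integral_itv_bndoo _ _ m01').
under [LHS]eq_integral do rewrite EFinM.
rewrite ge0_integralZl_EFin ?(ltW xb0) //.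
move=> h; rewrite EFinM fineK // ge0_fin_numE; last first.
  by apply: integral_ge0 => s /p01; rewrite lee_fin.
rewrite ltNge leye_eq; apply/negP => /eqP e; move: h; rewrite e.
by rewrite gt0_muley // lte_fin.
Qed.

Lemma average_ge0 (x : R) : 0 < x < 1 -> 0 <= average x.
Proof.
move=> x01; have /andP[x0 x1] := x01.
have : 0 <= x `^ b * average x.
  by rewrite -lee_fin -averageE // intfE // lee_fin; case/andP: (F_le x01).
by rewrite pmulr_rge0 // powR_gt0.
Qed.

Lemma average_continuous (x : R) : 0 < x < 1 -> {for x, continuous average}.
Proof.
move=> x01; have /andP[x0 x1] := x01.
have avE (y : R) : 0 < y < 1 -> F y / y `^ b = average y.
  move=> y01; have : F y = y `^ b * average y by apply: EFin_inj; rewrite -intfE // averageE.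
  by move=> ->; rewrite mulrAC divff ?mul1r // gt_eqF // powR_gt0 //; case/andP: y01.
have near01 : \forall y \near x, 0 < y < 1.
  have : nbhs x `]0, 1[%classic.
    by apply: open_nbhs_nbhs; split; [exact: interval_open|rewrite /= in_itv /= x0].
  by apply: filterS => y /=; rewrite in_itv.
rewrite /prop_for /continuous_at -avE //.
apply: cvg_trans; last first.
  apply: (@cvgM _ _ (nbhs x) _ F (fun y => (y `^ b)^-1)).
    have [/derivable1_diffP dFx _] := dF x01; exact: differentiable_continuous dFx.
  by apply: cvgV; [rewrite gt_eqF // powR_gt0|exact: powR_continuous].
apply: near_eq_cvg; near=> y; apply: avE; near: y; exact: near01.
Unshelve. all: by end_near.
Qed.

End Rescale.

(** Continuity of [y] at [0] makes [u ^ a y] vanish there, which fixes the constant of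
    integration in the singular equation [(u ^ a y)' = c u ^ (a - 1) J]. *)
Lemma singular_ode (a c y0 : R) (J y : R -> R) : 0 < a -> 0 < c ->
  (forall t : R, 0 < t < 1 -> {for t, continuous J}) -> (forall t : R, 0 < t < 1 -> 0 <= J t) ->
  y t @[t --> 0^'+] --> y0 ->
  (forall t : R, 0 < t < 1 -> is_derive t (1 : R) (fun u => u `^ a * y u) (c * t `^ (a - 1) * J t)) ->
  forall x : R, 0 < x < 1 ->
   (\int[leb]_(t in `]0%R, x]) (t `^ (a - 1) * J t)%:E = (x `^ a * (y x / c))%:E)%E.
Proof.
move=> a0 c0 cJ J0 y_at0 dy x x01.
transitivity ((c^-1 * (x `^ a * y x))%:E); last by congr EFin; ring.
apply: (@improper_FTC _ 1 x _ (fun u => c^-1 * (u `^ a * y u))) => //.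
- move=> t t01; have h := is_deriveZ c^-1 (dy t t01).
  apply: is_derive_eq h _; rewrite /GRing.scale /= !mulrA mulVf ?mul1r //.
  by rewrite gt_eqF.
- move=> t t01; apply: cvgM; last exact: cJ.
  by apply: powR_continuous; case/andP: t01.
- by move=> t t01; rewrite mulr_ge0 ?powR_ge0 ?J0.
- rewrite -[X in _ --> X](mulr0 c^-1); apply: cvgMr.
  by rewrite -[X in _ --> X](mul0r y0); apply: cvgM => //; exact: powR_cvg0.
Qed.

Lemma singular_ode_continuous (a : R) (y dy : R -> R) :
  (forall t : R, 0 < t < 1 -> is_derive t (1 : R) (fun u => u `^ a * y u) (dy t)) ->
  forall t : R, 0 < t < 1 -> {for t, continuous y}.
Proof.
move=> h t t01; have /andP[t0 t1] := t01.
have yE (u : R) : 0 < u -> (u `^ a * y u) / u `^ a = y u.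
  by move=> u0; rewrite mulrAC divff ?mul1r // gt_eqF // powR_gt0.
rewrite /prop_for /continuous_at -[X in _ --> X]yE //.
apply: cvg_trans; last first.
  apply: (@cvgM _ _ (nbhs t) _ (fun u => u `^ a * y u) (fun u => (u `^ a)^-1)).
    by have [/derivable1_diffP dht _] := h t t01; exact: differentiable_continuous dht.
  by apply: cvgV; [rewrite gt_eqF // powR_gt0|exact: powR_continuous].
by apply: near_eq_cvg; near=> u; apply: yE; near: u; exact: lt_nbhsr.
Unshelve. all: by end_near.
Qed.

End Averages.

(** * Moments of a kernel and dilated power series *)

Section MomentSeries.
Context {R : realType}.
Notation leb := (@lebesgue_measure R).
Notation I := (`]0%R, 1%R[%classic : set R).
Local Open Scope complex_scope.
Variables (kern : R -> R).
Hypotheses (ikern : leb.-integrable I (EFin \o kern)) (kern0 : forall t : R, 0 < t < 1 -> 0 <= kern t).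

Definition moment n : R := \int[leb]_(t in I) (kern t * t ^+ n).

Let expr01 (t : R) n : I t -> `|t ^+ n| <= 1.
Proof.
rewrite /= in_itv /= => /andP[/ltW t0 /ltW t1].
by rewrite ger0_norm ?exprn_ge0 // exprn_ile1.
Qed.

Let mexpr n : measurable_fun I (fun t : R => t ^+ n).
Proof. by apply: continuous_measurable_I => t _; exact: exprn_continuous. Qed.

Lemma moment_integrable n : leb.-integrable I (EFin \o (fun t => kern t * t ^+ n)).
Proof. by apply: (integrable_mul_bounded (B := 1)) => // t /expr01. Qed.

Lemma moment_ge0 n : 0 <= moment n.
Proof.
apply: Rintegral_ge0 => t /=; rewrite in_itv /= => /andP[t0 t1].
by rewrite mulr_ge0 ?kern0 ?t0 // exprn_ge0 // ltW.
Qed.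

Lemma moment_le n : moment n <= moment 0.
Proof.
apply: le_Rintegral => //; try exact: moment_integrable.
move=> t /=; rewrite in_itv /= => /andP[t0 t1].
rewrite ler_wpM2l ?kern0 ?t0 //  expr0 exprn_ile1 // ltW //.
Qed.

Lemma pcoef_moment (c : nat -> R[i]) : pcoef c -> pcoef (fun n => (moment n)%:C * c n).
Proof.
apply: (pcoef_le (B := moment 0)); first exact: moment_ge0.
move=> n; rewrite cabsM cabs_real ger0_norm ?moment_ge0 //.
by rewrite ler_wpM2r ?cabs_ge0 // moment_le.
Qed.

Section Series.
Variables (c : nat -> R[i]) (z : R[i]).
Hypotheses (hc : pcoef c) (z1 : cabs z < 1).

Let part N t : R := \sum_(k < N) t ^+ k * complex.Re (c k * z ^+ k).

Let partE N t : part N t = complex.Re (\sum_(k < N) c k * (t%:C * z) ^+ k).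
Proof.
rewrite Re_sum; apply: eq_bigr => k _.
by rewrite exprMn mulrCA -rmorphXn ReCM.
Qed.

Let part_measurable N : measurable_fun I (part N).
Proof.
apply: continuous_measurable_I => t _.
have -> : part N = \sum_(k < N) (fun t => t ^+ k * complex.Re (c k * z ^+ k)).
  by apply/funext => s; rewrite fct_sumE.
apply: (big_ind (fun f : R -> R => {for t, continuous f})).
- exact: cst_continuous.
- by move=> f g cf cg; exact: cvgD.
- by move=> k _; apply: cvgMl; exact: exprn_continuous.
Qed.

Let tz (t : R) : I t -> cabs (t%:C * z) <= cabs z.
Proof.
rewrite /= in_itv /= => /andP[t0 t1].
by rewrite cabsM cabs_real gtr0_norm // ler_piMl ?cabs_ge0 // ltW.
Qed.

Let value t := complex.Re (psum c (t%:C * z)).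

Let value_measurable : measurable_fun I value.
Proof.
apply: (@measurable_fun_cvg _ _ _ _ part) => [N|t It]; first exact: part_measurable.
apply/cvgrPdist_le => e e0.
have [N hN] := psum_lim hc (le_lt_trans (tz It) z1) e0.
exists N => // n /hN; apply: le_trans.
by rewrite partE /value -ReN -ReD; exact: Re_le_cabs.
Qed.

Let value_integrable : leb.-integrable I (EFin \o (fun t => kern t * value t)).
Proof.
have [K hK] := psum_le hc (ltac:(by rewrite cabs_ge0 z1) : 0 <= cabs z < 1).
apply: (integrable_mul_bounded (B := K)) => // t It.
exact: le_trans (Re_le_cabs _) (hK _ (tz It)).
Qed.

Lemma psum_dilate_integrable :
  leb.-integrable I (EFin \o (fun t => kern t * complex.Re (psum c (t%:C * z)))).
Proof. exact: value_integrable. Qed.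

(** Termwise integration, by uniform convergence of the partial sums on the segment
    from [0] to [z]. *)
Lemma integral_psum_dilate :
  \int[leb]_(t in I) (kern t * complex.Re (psum c (t%:C * z))) =
  complex.Re (psum (fun n => (moment n)%:C * c n) z).
Proof.
have [|K [x [K0 x01 _ hK]]] := psum_unif hc (r := cabs z); first by rewrite cabs_ge0.
have ipart N : leb.-integrable I (EFin \o (fun t => kern t * part N t)).
  have [B hB] : exists B, forall t, I t -> `|part N t| <= B.
    exists (\sum_(k < N) `|complex.Re (c k * z ^+ k)|) => t It.
    apply: le_trans (ler_norm_sum _ _ _) _; apply: ler_sum => k _.
    by rewrite normrM ler_piMl // expr01.
  exact: (integrable_mul_bounded (B := B)).
have ipartE N : \int[leb]_(t in I) (kern t * part N t) =
    complex.Re (\sum_(k < N) (moment k)%:C * c k * z ^+ k).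
  elim: N => [|N IH].
    rewrite big_ord0 /= /Rintegral integral0_eq // => t _.
    by rewrite /part big_ord0 mulr0.
  rewrite big_ord_recr /= ReD -IH -mulrA ReCM /moment -RintegralZr //; last exact: moment_integrable.
  rewrite -RintegralD //.
    by apply: eq_Rintegral => t _; rewrite /part big_ord_recr /= mulrDr mulrA.
  by apply: (integrable_mul_bounded (B := `|complex.Re (c N * z ^+ N)|)) => //;
    exact: moment_integrable.
have main N : `|\int[leb]_(t in I) (kern t * value t) -
    complex.Re (\sum_(k < N) (moment k)%:C * c k * z ^+ k)| <= moment 0 * K * x ^+ N.
  rewrite -ipartE -RintegralB //.
  have idiff : leb.-integrable I (EFin \o (fun t => kern t * value t - kern t * part N t)).
    apply (@integrableB _ _ R leb I measurable_I _ _ value_integrable (ipart N)).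
  apply: le_trans (le_normr_Rintegral _ idiff) _ => //.
  rewrite -mulrA /moment -RintegralZr //; last exact: moment_integrable.
  apply: le_Rintegral => //.
  - exact: integrable_norm idiff.
  - apply: (integrable_mul_bounded (B := `|K * x ^+ N|)) => //; exact: moment_integrable.
  - move=> t It; have kt : 0 <= kern t by move: It; rewrite /= in_itv /=; exact: kern0.
    rewrite expr0 mulr1 -mulrBr normrM ger0_norm // ler_wpM2l // partE /value -ReN -ReD.
    by apply: le_trans (Re_le_cabs _) _; apply: hK; exact: tz.
apply/eqP; rewrite -subr_eq0 -normr_le0; apply/ler_addgt0Pr => e e0; rewrite add0r.
have e2 : 0 < e / 2 by rewrite divr_gt0.
have [N1 h1] := geo_small (moment 0 * K) x01 e2.
have [N2 h2] := psum_lim (pcoef_moment hc) z1 e2.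
have {}h1 := le_trans (main (maxn N1 N2)) (h1 _ (leq_maxl _ _)).
have {}h2 := h2 _ (leq_maxr N1 N2).
have {}h2 := le_trans (Re_le_cabs _) h2; rewrite ReD ReN distrC in h2.
rewrite [leRHS]splitr; apply: le_trans (lerD h1 h2).
by apply: le_trans (ler_normD _ _); rewrite addrA subrK.
Qed.

End Series.
End MomentSeries.

(** * Power series tools for the classes of functions *)

Section SeriesTools.
Context {R : realType}.
Local Open Scope complex_scope.
Implicit Types (c : nat -> R[i]) (z w : R[i]) (f : R[i] -> R[i]).

Lemma pcoef1 : pcoef (fun=> 1 : R[i]).
Proof. by apply: (pcoef_bounded (B := 1)) => n; rewrite cabs1. Qed.

Lemma cabs_lt1_neq z : cabs z < 1 -> 1 - z != 0.
Proof.
move=> z1; apply/negP => /eqP /subr0_eq h.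
by move: z1; rewrite -h cabs1 ltxx.
Qed.

Lemma psum_geo z : cabs z < 1 -> psum (fun=> 1) z = (1 - z)^-1.
Proof.
move=> z1; have := psumS pcoef1 z1; set S := psum _ _ => h.
have e : (1 - z) * S = 1 by rewrite mulrBl mul1r {1}h addrK.
by apply: (mulfI (cabs_lt1_neq z1)); rewrite e divff // cabs_lt1_neq.
Qed.

Lemma psum_scalar c (a : R[i]) z : pcoef c -> cabs z < 1 ->
  psum (fun n => if n == 0%N then c 0%N else a * c n) z = c 0%N + a * (psum c z - c 0%N).
Proof.
move=> hc z1; have hs := pcoefS hc.
transitivity (psum (fun n => if n is m.+1 then a * c m.+1 else c 0%N) z).
  by apply: eq_psum => -[].
rewrite (psum_cons (c := fun m => a * c m.+1)) //; last exact: (pcoefZ a hs).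
by rewrite (psumZ a hs) // [psum c z]psumS //; ring.
Qed.

Lemma psum_mul_1B c z : pcoef c -> cabs z < 1 ->
  (1 - z) * psum c z = psum (fun n => c n - (if n is m.+1 then c m else 0)) z.
Proof.
move=> hc z1; have hs : pcoef (fun n => if n is m.+1 then c m else 0 : R[i]) by exact: pcoef_cons.
transitivity (psum (fun n => c n + -1 * (if n is m.+1 then c m else 0)) z); last first.
  by apply: eq_psum => n; rewrite mulN1r.
rewrite psumD ?(psumZ (-1) hs) ?psum_cons //; last exact: (pcoefZ (-1) hs).
ring.
Qed.

Lemma pcoef_succ : pcoef (fun n => n.+1%:R : R[i]).
Proof.
have := pcoefS (pcoefMn pcoef1); apply: (pcoef_le (B := 1)) => // n.
by rewrite mulr1 mul1r.
Qed.

Lemma pcoef_nat : pcoef (fun n => n%:R : R[i]).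
Proof.
have := pcoefMn pcoef1; apply: (pcoef_le (B := 1)) => // n.
by rewrite mulr1 mul1r.
Qed.

Lemma psum_nat z : cabs z < 1 -> psum (fun n => n%:R) z = z * psum (fun n => n.+1%:R) z.
Proof.
move=> z1; rewrite -[RHS]add0r -psum_cons //; last exact: pcoef_succ.
by apply: eq_psum => -[].
Qed.

Lemma psum_succ z : cabs z < 1 -> psum (fun n => n.+1%:R) z = (1 - z)^-1 ^+ 2.
Proof.
move=> z1; have z0 := cabs_lt1_neq z1; apply: (mulfI z0).
rewrite psum_mul_1B //; last exact: pcoef_succ.
transitivity (psum (fun=> 1) z); last by rewrite psum_geo //; field.
apply: eq_psum => -[|n]; rewrite ?subr0 //.
by rewrite -[n.+2%:R]natr1 addrAC subrr add0r.
Qed.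

Lemma psum_sqr_succ z : cabs z < 1 ->
  psum (fun n => n.+1%:R * n.+1%:R) z = (1 + z) / (1 - z) ^+ 3.
Proof.
move=> z1; have z0 := cabs_lt1_neq z1; apply: (mulfI z0).
have h2 : pcoef (fun n => n.+1%:R * n.+1%:R : R[i]) by apply: pcoefM; exact: pcoef_succ.
rewrite psum_mul_1B //.
transitivity (psum (fun n => 2 * n.+1%:R + -1 * 1) z).
  apply: eq_psum => -[|n]; first by rewrite subr0; ring.
  by rewrite -[n.+2%:R]natr1; ring.
have p1 := pcoefZ 2 pcoef_succ; have p2 := pcoefZ (-1) pcoef1.
rewrite psumD // (psumZ 2 pcoef_succ) // (psumZ (-1) pcoef1) // psum_geo // psum_succ //.
by field.
Qed.

Lemma psum_zderiv c z : pcoef c -> cabs z < 1 ->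
  z * psum (dcoef c) z = psum (fun n => n%:R * c n) z.
Proof.
move=> hc z1; rewrite [RHS]psumS ?mul0r ?add0r //; exact: pcoefMn.
Qed.

(** The image of the disk of radius [s] under [1 / (1 - z)] is a disk whose leftmost
    point is [1 / (1 + s)]. *)
Lemma Re_inv1B_ge z (s : R) : cabs z <= s -> s < 1 -> (1 + s)^-1 <= complex.Re (1 - z)^-1.
Proof.
move=> zs s1; have z1 : cabs z < 1 by apply: le_lt_trans s1.
have a0 := cabs_ge0 z.
apply: (@le_trans _ _ (1 + cabs z)^-1).
  by rewrite lef_pV2 ?posrE ?lerD2l ?ltr_wpDr // (le_trans a0).
have d0 : 0 < cabs (1 - z) ^+ 2 by rewrite exprn_gt0 // cabs_gt0 cabs_lt1_neq.
have -> : complex.Re (1 - z)^-1 = complex.Re (1 - z) / cabs (1 - z) ^+ 2.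
  by rewrite cabs_sqr; case: (1 - z).
rewrite ler_pdivlMr // mulrC ler_pdivrMr ?ltr_wpDr // cabs_sqr.
have := Re_le_cabs z; rewrite ler_norml => /andP[h _].
have := cabs_sqr z; rewrite !ReD !ImD !ReN !ImN /= => e.
move: (cabs z) a0 z1 h e => a a0 z1 h e.
rewrite sub0r sqrrN sqrrB expr1n mul1r -addrA -e.
move: (complex.Re z) h => x h.
have h1 : 0 <= a + x by lra.
have h2 : 0 <= 1 - a by lra.
have := mulr_ge0 h1 h2.
rewrite expr2; lra.
Qed.

(** A series with nonnegative real part on the disk and positive real part at the
    origin has positive real part: Harnack's inequality, obtained from the Hadamard
    product with [1 / (1 - s z)]. *)
Lemma psum_Re_gt0 c : pcoef c -> (forall z, cabs z < 1 -> 0 <= complex.Re (psum c z)) ->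
  0 < complex.Re (c 0%N) -> forall z, cabs z < 1 -> 0 < complex.Re (psum c z).
Proof.
move=> hc c_ge0 c00 z z1.
pose s : R := (1 + cabs z) / 2.
have zs : cabs z < s by rewrite /s; lra.
have s1 : s < 1 by rewrite /s; lra.
have s0 : 0 < s by apply: le_lt_trans zs; exact: cabs_ge0.
have cs : cabs s%:C = s by rewrite cabs_real gtr0_norm.
have sn0 : s%:C != 0 by rewrite -cabs_gt0 cs.
have hpsi : pcoef (fun n => s%:C ^+ n).
  by apply: (pcoef_bounded (B := 1)) => n; rewrite cabsX cs exprn_ile1 // ltW.
have hge w : cabs w < 1 -> (1 + s)^-1 <= complex.Re (psum (fun n => s%:C ^+ n) w).
  move=> w1; have sw : cabs (s%:C * w) <= s by rewrite cabsM cs ler_piMr // ltW.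
  have -> : psum (fun n => s%:C ^+ n) w = psum (fun n => 1 * s%:C ^+ n) w.
    by apply: eq_psum => n; rewrite mul1r.
  by rewrite (psum_scale (fun=> 1)) psum_geo ?(le_lt_trans sw) // Re_inv1B_ge.
have w1 : cabs (z / s%:C) < 1 by rewrite cabsM cabsV cs ltr_pdivrMr // mul1r.
have := hadamard_Re_ge hc hpsi (expr0 _) c_ge0 hge w1.
have -> : psum (fun n => s%:C ^+ n * c n) (z / s%:C) = psum (fun n => c n * s%:C ^+ n) (z / s%:C).
  by apply: eq_psum => n; rewrite mulrC.
rewrite psum_scale (_ : s%:C * (z / s%:C) = z); last by rewrite mulrCA divff // mulr1.
apply: lt_le_trans.
rewrite mulr_gt0 // subr_gt0 ltr_pdivlMr ?mul1r ?addr_gt0 //; lra.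
Qed.

(** The intermediate value theorem on a radius; [t > 0] because the value at the
    origin is larger than [v]. *)
Lemma psum_segment c z (v : R) : pcoef c -> cabs z < 1 ->
  v < complex.Re (c 0%N) -> complex.Re (psum c z) <= v ->
  exists2 t : R, 0 < t <= 1 & complex.Re (psum c (t%:C * z)) = v.
Proof.
move=> hc z1 v0 v1.
have tz (t : R) : 0 <= t <= 1 -> cabs (t%:C * z) < 1.
  move=> /andP[t0 t1]; apply: le_lt_trans z1.
  by rewrite cabsM cabs_real ger0_norm // ler_piMl ?cabs_ge0.
have [F FE cont] : exists2 F : R -> R, (forall t, F t = complex.Re (psum c (t%:C * z))) &
    {within `[0, 1], continuous F}.
  exists (fun t : R => complex.Re (psum c (t%:C * z))) => //.
  apply: continuous_in_subspaceT => t; rewrite inE /= in_itv /= => /tz tz1.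
  apply/cvgrPdist_le => e e0.
  have [d d0 hd] := cdiff_continuous (psum_cdiff hc tz1) e0.
  near=> u.
  rewrite -[leLHS]/(`|complex.Re (psum c (t%:C * z)) - complex.Re (psum c (u%:C * z))|).
  rewrite -ReN -ReD; apply: le_trans (Re_le_cabs _) _; rewrite cabsB; apply: hd.
  rewrite -mulrBl -rmorphB cabsM cabs_real distrC.
  apply: (@le_lt_trans _ _ `|t - u|); first by rewrite ler_piMr // ltW.
  by near: u; exact: cvgr_dist_lt.
have e0 : F 0 = complex.Re (c 0%N) by rewrite FE -[0%:C]/(0 : R[i]) mul0r psum0.
have e1 : F 1 = complex.Re (psum c z) by rewrite FE -[1%:C]/(1 : R[i]) mul1r.
have hv : Num.min (F 0) (F 1) <= v <= Num.max (F 0) (F 1).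
  by rewrite ge_min le_max e0 e1 v1 (ltW v0) orbT.
have [t] := IVT ler01 cont hv; rewrite in_itv /= => /andP[t0 t1] ht.
exists t; last exact: etrans (esym (FE t)) ht.
rewrite lt_neqAle t0 t1 !andbT.
by apply/negP => /eqP t00; move: v0; rewrite -ht -t00 e0 ltxx.
Unshelve. all: by end_near.
Qed.

Lemma psum_real c (z : R[i]) : pcoef c -> cabs z < 1 -> (forall n, complex.Im (c n) = 0) ->
  complex.Im z = 0 -> complex.Im (psum c z) = 0.
Proof.
move=> hc z1 cr zr.
have zX k : complex.Im (z ^+ k) = 0.
  elim: k => [|j IH]; first by rewrite expr0.
  by rewrite exprS ImM zr IH mulr0 mul0r addr0.
apply/eqP; rewrite -normr_le0; apply/ler_addgt0Pr => e e0; rewrite add0r.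
have [N hN] := psum_lim hc z1 e0; have := hN N (leqnn _).
move=> /(le_trans (Im_le_cabs _)); rewrite ImD ImN Im_sum big1 ?subr0 // => k _.
by rewrite ImM cr zX mulr0 mul0r addr0.
Qed.

Section DiskFunction.
Variables (f : R[i] -> R[i]) (c : nat -> R[i]).
Hypotheses (hc : pcoef c) (fE : forall z, cabs z < 1 -> f z = psum c z).

(** Only the values on the disk are given, but derivatives are local. *)
Lemma disk_cderive z : cabs z < 1 -> cderivable f z /\ cderive f z = psum (dcoef c) z.
Proof.
move=> z1; apply: cdiff_is_derive.
apply: (@cdiff_local _ (psum c) f z _ (1 - cabs z)); first by rewrite subr_gt0.
  move=> w wz; rewrite fE //; rewrite -[w](subrK z); apply: le_lt_trans (cabsD _ _) _.
  by rewrite -ltrBrDr.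
exact: psum_cdiff.
Qed.

Lemma disk_cderive0 : cderive f 0 = c 1%N.
Proof.
have c0 : cabs (0 : R[i]) < 1 by rewrite cabs0.
have [_ ->] := disk_cderive c0.
by rewrite psum0 /dcoef ?mul1r //; exact: pcoef_dcoef.
Qed.

Lemma disk_quotz z : c 0%N = 0 -> cabs z < 1 -> quotz f z = psum (fun n => c n.+1) z.
Proof.
move=> c0 z1; rewrite /quotz; case: eqVneq => [->|z0].
  by rewrite disk_cderive0 psum0 //; exact: pcoefS.
by rewrite fE // psumS // c0 add0r mulrC mulKf.
Qed.

Lemma disk_class_A : c 0%N = 0 -> c 1%N = 1 -> class_A f.
Proof.
move=> c0 c1; split.
- by move=> z; rewrite unit_diskE => /disk_cderive[].
- by rewrite fE ?cabs0 // psum0.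
- by rewrite disk_cderive0.
Qed.

End DiskFunction.

Lemma class_A_psum f : class_A f ->
  exists c, [/\ pcoef c, (forall z, cabs z < 1 -> f z = psum c z), c 0%N = 0 & c 1%N = 1].
Proof.
move=> [fa f0 f1]; have [c hc fE] := taylor fa; exists c; split => //.
- by rewrite -(psum0 hc) -fE ?cabs0.
- by rewrite -(disk_cderive0 hc fE).
Qed.

End SeriesTools.

(** * The integral [N] as the real part of a power series *)

Section KernelODE.
Context {R : realType}.
Notation leb := (@lebesgue_measure R).
Notation I := (`]0%R, 1%R[%classic : set R).
Variables (mu nu : R) (lam : R -> R).
Hypotheses (mu0 : 0 < mu) (nu0 : 0 < nu).
Hypotheses (ilam : leb.-integrable I (EFin \o lam)) (lam0 : forall t : R, 0 < t < 1 -> 0 <= lam t).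

Let mlam : measurable_fun I lam.
Proof. by apply/measurable_EFinP; case/integrableP: ilam. Qed.

(** Common form of the equations for [1 + g] and [q], for which [phi] is respectively
    [1 / (1 + t) ^ 2] and [(1 - t) / (1 + t) ^ 3]: the solution is the double average of
    [phi], to which the kernel is dual. *)
Lemma kernel_ode (phi y : R -> R) (c y0 : R) :
  (forall t : R, 0 < t < 1 -> {for t, continuous phi}) ->
  (forall t : R, 0 < t < 1 -> 0 <= phi t <= 1) -> 0 < c ->
  y t @[t --> 0^'+] --> y0 ->
  (forall t : R, 0 < t < 1 -> is_derive t (1 : R) (fun u => u `^ nu^-1 * y u)
     (c * t `^ (nu^-1 - 1) * average mu^-1 phi t)) ->
  [/\ leb.-integrable I (EFin \o (fun x => lam x * y x)),
      leb.-integrable I (EFin \o (fun t => Pi_kernel mu nu lam t * phi t)) &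
      \int[leb]_(t in I) (Pi_kernel mu nu lam t * phi t) =
      (\int[leb]_(x in I) (lam x * y x)) / c].
Proof.
move=> cphi phi01 c0 y_at0 dy.
have nui : 0 < nu^-1 by rewrite invr_gt0.
have mui : 0 < mu^-1 by rewrite invr_gt0.
have phi0 (t : R) : 0 < t < 1 -> 0 <= phi t by move=> /phi01/andP[].
have phi1 (t : R) : 0 < t < 1 -> phi t <= 1 by move=> /phi01/andP[].
have cJ := average_continuous mui cphi phi0 phi1.
have J0 := average_ge0 mui cphi phi0 phi1.
have hJ := averageE mui cphi phi0 phi1.
have hy := singular_ode nui c0 cJ J0 y_at0 dy.
have cy := singular_ode_continuous dy.
have y_ge0 (x : R) : 0 < x < 1 -> 0 <= y x.
  move=> x01; have /andP[x0 x1] := x01.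
  have : 0 <= x `^ nu^-1 * (y x / c).
    rewrite -lee_fin -hy // integral_ge0 // => t /=; rewrite in_itv /= => /andP[t0 tx].
    by rewrite lee_fin mulr_ge0 ?powR_ge0 // J0 // t0 (le_lt_trans tx).
  by rewrite pmulr_rge0 ?powR_gt0 // pmulr_lge0 // invr_gt0.
have mphi := continuous_measurable_I cphi.
have iphi : leb.-integrable I (EFin \o (fun t => Pi_kernel mu nu lam t * phi t)).
  apply: (integrable_mul_bounded (B := 1)) => //.
    exact: Pi_kernel_integrable.
  move=> t; rewrite /= in_itv /= => t01.
  by rewrite ger0_norm ?phi0 ?phi1.
have e := Pi_kernel_integral mu0 nu0 ilam lam0 mphi phi0 (continuous_measurable_I cJ) J0 hJ hy.
have my : measurable_fun I (fun x => lam x * y x).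
  by apply: measurable_funM => //; exact: continuous_measurable_I.
have iyc : leb.-integrable I (EFin \o (fun x => lam x * (y x / c))).
  apply: (@ge0_integrable_I _ _ (\int[leb]_(t in I) (Pi_kernel mu nu lam t * phi t))).
  - by apply: measurable_funM => //; apply: measurable_funM => //; exact: continuous_measurable_I.
  - by move=> t t01; rewrite mulr_ge0 ?lam0 // divr_ge0 ?y_ge0 // ltW.
  - by rewrite -e /Rintegral fineK //; exact: integrable_fin_num.
have iy : leb.-integrable I (EFin \o (fun x => lam x * y x)).
  have := integrable_mul_bounded (B := `|c|) measurable_I iyc (measurable_cst c) (fun _ _ => lexx _).
  congr (leb.-integrable _ _); apply/funext => x /=; congr EFin.
  by rewrite -!mulrA mulVf ?mulr1 // gt_eqF.
split => //.
rewrite -RintegralZr //; rewrite /Rintegral e; congr fine.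
by apply: eq_integral => x _; rewrite mulrA.
Qed.

End KernelODE.

Section RealPartIdentity.
Context {R : realType}.
Notation leb := (@lebesgue_measure R).
Notation I := (`]0%R, 1%R[%classic : set R).
Local Open Scope complex_scope.

(** These are the coefficients of [h_ eps z / z], written so that multiplying by them
    is [2^-1 * (X + Y + eps * (X - Y))] with [X] the image under [n.+1] and [Y] under [1]. *)
Definition hcoef (eps : R[i]) n : R[i] := n.+1%:R + (eps - 1) / 2 * n%:R.

Lemma pcoef_hcoef eps : pcoef (hcoef eps).
Proof.
apply: pcoefD; first exact: pcoef_succ.
exact: (pcoefZ _ pcoef_nat).
Qed.

Lemma h_psum eps (z : R[i]) : cabs z < 1 ->
  h_ eps z = psum (fun n => if n is m.+1 then hcoef eps m else 0) z.
Proof.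
move=> z1; have z0 := cabs_lt1_neq z1.
rewrite psum_cons //; last exact: pcoef_hcoef.
have hz := pcoefZ ((eps - 1) / 2) pcoef_nat.
rewrite (psumD pcoef_succ hz) // (psumZ _ pcoef_nat) // psum_nat // psum_succ //.
rewrite /h_ add0r exprVn; move: (1 - z) z0 => d d0; field.
by rewrite d0.
Qed.

Lemma pcoef_h eps : pcoef (fun n => if n is m.+1 then hcoef eps m else 0).
Proof. exact/pcoef_cons/pcoef_hcoef. Qed.

Lemma h_quotz eps (z : R[i]) : cabs z < 1 -> quotz (h_ eps) z = psum (hcoef eps) z.
Proof. by move=> z1; rewrite (disk_quotz (pcoef_h eps) (@h_psum eps)). Qed.

Lemma h_cderive eps (z : R[i]) : cabs z < 1 ->
  cderive (h_ eps) z = psum (fun n => n.+1%:R * hcoef eps n) z.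
Proof. by move=> z1; have [_ ->] := disk_cderive (pcoef_h eps) (@h_psum eps) z1. Qed.

(** The values at [z = - t] of [h_ 1 z / z] and of the derivative of [h_ 1]; they are the
    terms subtracted in [N_]. *)
Definition phi_g (t : R) : R := 1 / (1 + t) ^+ 2.
Definition phi_q (t : R) : R := (1 - t) / (1 + t) ^+ 3.

Let t1 (t : R) : 0 < t < 1 -> 1 + t != 0.
Proof. by move=> /andP[t0 _]; rewrite gt_eqF // addr_gt0. Qed.

Lemma phi_g_continuous (t : R) : 0 < t < 1 -> {for t, continuous phi_g}.
Proof.
move=> t01; apply: cvgM; first exact: cvg_cst.
apply: cvgV; first by rewrite expf_neq0 // t1.
apply: (@continuous_comp _ _ _ (fun u : R => 1 + u) (fun v => v ^+ 2)); last exact: exprn_continuous.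
by apply: cvgD; [exact: cvg_cst|exact: cvg_id].
Qed.

Lemma phi_q_continuous (t : R) : 0 < t < 1 -> {for t, continuous phi_q}.
Proof.
move=> t01; apply: cvgM; first by apply: cvgB; [exact: cvg_cst|exact: cvg_id].
apply: cvgV; first by rewrite expf_neq0 // t1.
apply: (@continuous_comp _ _ _ (fun u : R => 1 + u) (fun v => v ^+ 3)); last exact: exprn_continuous.
by apply: cvgD; [exact: cvg_cst|exact: cvg_id].
Qed.

Lemma phi_g_01 (t : R) : 0 < t < 1 -> 0 <= phi_g t <= 1.
Proof.
move=> /andP[t0 _]; have h : 1 <= (1 + t) ^+ 2 by rewrite exprn_ege1 // lerDl ltW.
rewrite /phi_g div1r invr_ge0 (le_trans _ h) //= invf_le1 //; exact: lt_le_trans h.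
Qed.

Lemma phi_q_01 (t : R) : 0 < t < 1 -> 0 <= phi_q t <= 1.
Proof.
move=> /andP[t0 tlt]; have h : 1 <= (1 + t) ^+ 3 by rewrite exprn_ege1 // lerDl ltW.
have h0 : 0 < (1 + t) ^+ 3 by exact: lt_le_trans h.
rewrite /phi_q divr_ge0 ?subr_ge0 ?(ltW tlt) ?(ltW h0) //= ler_pdivrMr // mul1r.
by apply: le_trans h; rewrite lerBlDr lerDl ltW.
Qed.

Variables (mu nu xi b : R) (lam g q : R -> R).
Hypotheses (mu0 : 0 < mu) (nu0 : 0 < nu).
Hypotheses (ilam : leb.-integrable I (EFin \o lam)) (lam0 : forall t : R, 0 < t < 1 -> 0 <= lam t).
Hypothesis lam1 : \int[leb]_(t in I) lam t = 1.
Hypotheses (g_sol : solves_g mu nu g) (q_sol : solves_q mu nu q).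
Hypothesis b_eq : b = - \int[leb]_(t in `[0, 1]) (lam t * ((1 - xi) * g t + xi * (2 * q t - 1))).
Hypothesis xi01 : 0 <= xi <= 1.

Let kern := Pi_kernel mu nu lam.

Let g_facts : [/\ leb.-integrable I (EFin \o (fun x => lam x * (1 + g x))),
      leb.-integrable I (EFin \o (fun t => kern t * phi_g t)) &
      \int[leb]_(t in I) (kern t * phi_g t) =
      (\int[leb]_(x in I) (lam x * (1 + g x))) / (2 / (mu * nu))].
Proof.
have [g0 g_at0 dg] := g_sol.
apply: (@kernel_ode _ mu nu lam mu0 nu0 ilam lam0 phi_g (fun u => 1 + g u) (2 / (mu * nu)) (1 + g 0)).
- exact: phi_g_continuous.
- exact: phi_g_01.
- by rewrite divr_gt0 // mulr_gt0.
- by apply: cvgD => //; exact: cvg_cst.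
- move=> t t01; have -> : average mu^-1 phi_g t =
      \int[leb]_(s in `[0, 1]) (s `^ (mu^-1 - 1) / (1 + s * t) ^+ 2).
    by apply: eq_Rintegral => s _; rewrite /phi_g div1r.
  exact: dg.
Qed.

Let q_facts : [/\ leb.-integrable I (EFin \o (fun x => lam x * q x)),
      leb.-integrable I (EFin \o (fun t => kern t * phi_q t)) &
      \int[leb]_(t in I) (kern t * phi_q t) =
      (\int[leb]_(x in I) (lam x * q x)) / (1 / (mu * nu))].
Proof.
have [q0 q_at0 dq] := q_sol.
apply: (@kernel_ode _ mu nu lam mu0 nu0 ilam lam0 phi_q q (1 / (mu * nu)) (q 0)) => //.
- exact: phi_q_continuous.
- exact: phi_q_01.
- by rewrite divr_gt0 // mulr_gt0.
Qed.

Let munu0 : mu * nu != 0. Proof. by rewrite mulf_neq0 ?gt_eqF. Qed.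

Let integrableZ (f : R -> R) (r : R) : leb.-integrable I (EFin \o f) ->
  leb.-integrable I (EFin \o (fun t => r * f t)).
Proof. by move=> fi; apply (@integrableZl _ _ R leb I measurable_I r _ fi). Qed.

Let integrable_add (f h : R -> R) : leb.-integrable I (EFin \o f) -> leb.-integrable I (EFin \o h) ->
  leb.-integrable I (EFin \o (fun t => f t + h t)).
Proof. by move=> fi hi; apply (@integrableD _ _ R leb I measurable_I _ _ fi hi). Qed.

Let integrable_meas (f : R -> R) : leb.-integrable I (EFin \o f) -> measurable_fun I f.
Proof. by case/integrableP => /measurable_EFinP. Qed.

(** Here the equation for [beta] enters, with [b = beta / (1 - beta)]. *)
Lemma kernel_beta : \int[leb]_(t in I) (kern t * ((1 - xi) * phi_g t + xi * phi_q t)) =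
   mu * nu * ((1 - b) / 2).
Proof.
have [i1 i2 eg] := g_facts; have [i3 i4 eq_] := q_facts.
set A1 := \int[leb]_(x in I) (lam x * (1 + g x)) in eg.
set A2 := \int[leb]_(x in I) (lam x * q x) in eq_.
have hb : 1 - b = (1 - xi) * A1 + 2 * xi * A2.
  have E : \int[leb]_(t in `[0, 1]) (lam t * ((1 - xi) * g t + xi * (2 * q t - 1))) =
      \int[leb]_(t in I) ((1 - xi) * (lam t * (1 + g t)) + (2 * xi) * (lam t * q t) + (-1) * lam t).
    have ie : leb.-integrable I (EFin \o (fun t => (1 - xi) * (lam t * (1 + g t)) +
        (2 * xi) * (lam t * q t) + (-1) * lam t)).
      by do 2 (apply: integrable_add; last exact: integrableZ); exact: integrableZ.
    have ef : (fun t => lam t * ((1 - xi) * g t + xi * (2 * q t - 1))) =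
      (fun t => (1 - xi) * (lam t * (1 + g t)) + (2 * xi) * (lam t * q t) + (-1) * lam t).
      by apply/funext => t; ring.
    by rewrite ef Rintegral_I //; exact: integrable_meas ie.
  rewrite b_eq E.
  rewrite !RintegralD ?RintegralZl ?lam1 -/A1 -/A2 //; try exact: integrableZ.
    ring.
  by apply: integrable_add; exact: integrableZ.
transitivity (\int[leb]_(t in I) ((1 - xi) * (kern t * phi_g t) + xi * (kern t * phi_q t))).
  by apply: eq_Rintegral => t _; ring.
rewrite RintegralD ?RintegralZl ?eg ?eq_ ?hb //; try exact: integrableZ.
by field; rewrite !gt_eqF.
Qed.

Let xi_w n : R := (1 + xi * n%:R).

(** With this weight, [N_] is the infimum of [mu * nu * (Re psi - (1 - b) / 2)] where [psi]
    is the series with coefficients [psi_coef]; the denominator comes from the moments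
    of the kernel and [xi_w] from the combination of [h z / z] and [h' z]. *)
Definition psi_weight n : R := xi_w n * ((1 + mu * n%:R) * (1 + nu * n%:R))^-1 * moment lam n.

Definition psi_coef (eps : R[i]) n : R[i] := (psi_weight n)%:C * hcoef eps n.

Lemma moment_kernel n : moment kern n = mu * nu * (((1 + mu * n%:R) * (1 + nu * n%:R))^-1 * moment lam n).
Proof.
rewrite /moment /Rintegral /kern Pi_kernel_monomial //.
have pn : 0 < 1 + mu * n%:R by rewrite ltr_pwDl // mulr_ge0 // ltW.
have pn' : 0 < 1 + nu * n%:R by rewrite ltr_pwDl // mulr_ge0 // ltW.
rewrite -/(Rintegral leb I (fun x => lam x * (x ^+ n / ((mu^-1 + n%:R) * (nu^-1 + n%:R))))).
rewrite -/(Rintegral leb I (fun x => lam x * x ^+ n)) mulrA -RintegralZl //; last exact: moment_integrable.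
apply: eq_Rintegral => x _.
rewrite (_ : mu^-1 + n%:R = (1 + mu * n%:R) / mu); last by field; rewrite gt_eqF.
rewrite (_ : nu^-1 + n%:R = (1 + nu * n%:R) / nu); last by field; rewrite gt_eqF.
by field; rewrite !gt_eqF.
Qed.

Lemma pcoef_affine (c : nat -> R[i]) : pcoef c -> pcoef (fun n => (1 + xi * n%:R)%:C * c n).
Proof.
move=> hc; have := pcoefD hc (pcoefZ xi%:C (pcoefMn hc)).
congr pcoef; apply/funext => n.
by rewrite rmorphD rmorphM rmorph1 rmorph_nat mulrDl mul1r mulrA.
Qed.

Let ikern := Pi_kernel_integrable mu0 nu0 ilam lam0.
Let kern0 := Pi_kernel_ge0 mu0 nu0 ilam lam0.

Lemma psi_coefE eps n : psi_coef eps n =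
  ((mu * nu)^-1)%:C * ((moment kern n)%:C * ((xi_w n)%:C * hcoef eps n)).
Proof.
rewrite /psi_coef !mulrA -!rmorphM; congr (_%:C * _).
by rewrite moment_kernel mulKf // /psi_weight /xi_w; ring.
Qed.

Lemma pcoef_psi eps : pcoef (psi_coef eps).
Proof.
rewrite (funext (psi_coefE eps)); apply: pcoefZ; apply: pcoef_moment => //.
exact/pcoef_affine/pcoef_hcoef.
Qed.

Lemma psi_coef0 eps : psi_coef eps 0%N = 1.
Proof.
rewrite /psi_coef /psi_weight /xi_w /hcoef !mulr0 !addr0 !mul1r invr1 mul1r mulr1.
have -> : moment lam 0 = 1 by rewrite -lam1; apply: eq_Rintegral => t _; rewrite expr0 mulr1.
by rewrite rmorph1.
Qed.

Lemma N_integrandE (eps z : R[i]) : cabs z < 1 ->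
  \int[leb]_(t in `[0, 1])
      (t `^ (mu^-1 - 1) * Pi_ mu nu lam t *
       ((1 - xi) * (complex.Re (quotz (h_ eps) (t%:C * z)) - 1 / (1 + t) ^+ 2)
        + xi * (complex.Re (cderive (h_ eps) (t%:C * z)) - (1 - t) / (1 + t) ^+ 3))) =
  mu * nu * (complex.Re (psum (psi_coef eps) z) - (1 - b) / 2).
Proof.
move=> z1.
pose d n : R[i] := (xi_w n)%:C * hcoef eps n.
have hd1 : pcoef (fun n => (1 - xi)%:C * hcoef eps n) by exact/pcoefZ/pcoef_hcoef.
have hd2 : pcoef (fun n => n.+1%:R * hcoef eps n).
  by apply: pcoefM; [exact: pcoef_succ|exact: pcoef_hcoef].
have hd2' := pcoefZ xi%:C hd2.
have dE n : d n = (1 - xi)%:C * hcoef eps n + xi%:C * (n.+1%:R * hcoef eps n).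
  rewrite /d /xi_w mulrA -mulrDl; congr (_ * _).
  by rewrite -(rmorph_nat (real_complex R)) -rmorphM -rmorphD -natr1; congr (_%:C); ring.
have hd : pcoef d by exact/pcoef_affine/pcoef_hcoef.
have tz (t : R) : 0 < t < 1 -> cabs (t%:C * z) < 1.
  move=> /andP[t0 tl]; apply: le_lt_trans z1; rewrite cabsM cabs_real gtr0_norm //.
  by rewrite ler_piMl ?cabs_ge0 // ltW.
pose F t := kern t * complex.Re (psum d (t%:C * z)) -
   kern t * ((1 - xi) * phi_g t + xi * phi_q t).
have FE (t : R) : 0 < t < 1 -> t `^ (mu^-1 - 1) * Pi_ mu nu lam t *
       ((1 - xi) * (complex.Re (quotz (h_ eps) (t%:C * z)) - 1 / (1 + t) ^+ 2)
        + xi * (complex.Re (cderive (h_ eps) (t%:C * z)) - (1 - t) / (1 + t) ^+ 3)) = F t.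
  move=> t01; have tz1 := tz _ t01.
  rewrite /F -mulrBr -/(Pi_kernel mu nu lam t) -/(phi_g t) -/(phi_q t); congr (_ * _).
  rewrite h_quotz // h_cderive // (funext dE) (psumD hd1 hd2') // (psumZ _ (pcoef_hcoef eps)) // (psumZ _ hd2) //.
  by rewrite ReD !ReCM; ring.
have i1 := psum_dilate_integrable ikern hd z1.
have [_ i2 _] := g_facts; have [_ i3 _] := q_facts.
have i4 : leb.-integrable I (EFin \o (fun t => kern t * ((1 - xi) * phi_g t + xi * phi_q t))).
  have -> : (fun t => kern t * ((1 - xi) * phi_g t + xi * phi_q t)) =
     (fun t => (1 - xi) * (kern t * phi_g t) + xi * (kern t * phi_q t)).
    by apply/funext => t; ring.
  by apply: integrable_add; exact: integrableZ.
have mF : measurable_fun I F.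
  by apply: measurable_funB; [exact: integrable_meas i1|exact: integrable_meas i4].
rewrite Rintegral_I; last first.
  by apply: eq_measurable_fun mF => t; rewrite inE /= in_itv /= => /FE ->.
transitivity (\int[leb]_(t in I) F t).
  by apply: eq_Rintegral => t; rewrite inE /= in_itv /= => /FE.
rewrite RintegralB // kernel_beta integral_psum_dilate // mulrBr; congr (_ - _).
rewrite -ReCM -(psumZ _ (pcoef_psi eps)) //; congr (complex.Re _); apply: eq_psum => n.
by rewrite psi_coefE mulrA -rmorphM mulfV // rmorph1 mul1r.
Qed.

Lemma kernel_mass : \int[leb]_(t in I) kern t = mu * nu.
Proof.
have := moment_kernel 0; rewrite /moment.
under eq_Rintegral do rewrite expr0 mulr1.
move=> ->; under eq_Rintegral do rewrite expr0 mulr1.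
by rewrite lam1 !mulr0 !addr0 mulr1 invr1 !mulr1.
Qed.

Lemma phi_gE (t : R) : phi_g t = (1 + t)^-1 ^+ 2.
Proof. by rewrite /phi_g div1r exprVn. Qed.

Lemma phi_qE (t : R) : 1 + t != 0 -> phi_q t = 2 * (1 + t)^-1 ^+ 3 - (1 + t)^-1 ^+ 2.
Proof.
move=> t0; rewrite /phi_q (_ : 1 - t = 2 - (1 + t)); last by ring.
by move: (1 + t) t0 => v v0; field.
Qed.

Lemma phi_lip (r t : R) : 0 < r < 1 -> 0 < t < 1 ->
  phi_g (r * t) - phi_g t <= 8 * (1 - r) /\ phi_q (r * t) - phi_q t <= 8 * (1 - r).
Proof.
move=> /andP[r0 r1] /andP[t0 tl].
have u0 : 0 < 1 + r * t by rewrite addr_gt0 // mulr_gt0.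
have v0 : 0 < 1 + t by rewrite addr_gt0.
pose u := (1 + r * t)^-1; pose v := (1 + t)^-1.
have u1 : 0 <= u <= 1.
  by rewrite invr_ge0 ltW //= invf_le1 // lerDl mulr_ge0 // ltW.
have v1 : 0 <= v <= 1 by rewrite invr_ge0 ltW //= invf_le1 // lerDl ltW.
have le1 (x y : R) : 0 <= x -> x <= 1 -> 0 <= y -> y <= 1 -> x * y <= 1.
  by move=> x0 x1 y0 y1; rewrite -[leRHS]mulr1; exact: ler_pM.
have uv : 0 <= u - v <= 1 - r.
  have -> : u - v = (1 - r) * (t * (u * v)) by rewrite /u /v; field; rewrite !gt_eqF.
  have r1' : 0 <= 1 - r by rewrite subr_ge0 ltW.
  case/andP: u1 => u1 u2; case/andP: v1 => v1 v2.
  have uv0 : 0 <= u * v by rewrite mulr_ge0.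
  rewrite mulr_ge0 ?mulr_ge0 ?(ltW t0) //= ler_piMr //.
  exact: (le1 t (u * v) (ltW t0) (ltW tl) uv0 (le1 u v u1 u2 v1 v2)).
have -> : phi_g (r * t) - phi_g t = (u - v) * (u + v).
  by rewrite !phi_gE -/u -/v; ring.
have -> : phi_q (r * t) - phi_q t = (u - v) * (2 * (u ^+ 2 + u * v + v ^+ 2) - (u + v)).
  by rewrite !phi_qE ?gt_eqF // -/u -/v; ring.
case/andP: u1 => u1 u2; case/andP: v1 => v1 v2; case/andP: uv => d1 d2.
have huv := le1 _ _ u1 u2 v1 v2; have huu := le1 _ _ u1 u2 u1 u2; have hvv := le1 _ _ v1 v2 v1 v2.
have bnd (m : R) : m <= 8 -> (u - v) * m <= 8 * (1 - r).
  move=> m8; apply: (@le_trans _ _ ((u - v) * 8)); first by rewrite ler_wpM2l.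
  by rewrite mulrC ler_wpM2l.
split; apply: bnd; first by apply: le_trans (lerD u2 v2) _; lra.
rewrite !expr2; lra.
Qed.

(** At the boundary point [z = -1] and for [eps = 1] the integrand of [N_] vanishes
    identically; near that point it is small by [phi_lip]. *)
Lemma psi_near_minus1 (r : R) : 0 < r < 1 ->
  complex.Re (psum (psi_coef 1) (- r%:C)) <= (1 - b) / 2 + 8 * (1 - r).
Proof.
move=> r01; have /andP[r0 r1] := r01.
have z1 : cabs (- r%:C) < 1 by rewrite cabsN cabs_real gtr0_norm.
pose d n : R[i] := (xi_w n)%:C * hcoef 1 n.
have hd : pcoef d by exact/pcoef_affine/pcoef_hcoef.
have dval (t : R) : 0 < t < 1 -> complex.Re (psum d (t%:C * - r%:C)) =
    (1 - xi) * phi_g (r * t) + xi * phi_q (r * t).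
  move=> /andP[t0 tl].
  have rt : 0 < r * t by rewrite mulr_gt0.
  have w1 : cabs (t%:C * - r%:C) < 1.
    apply: le_lt_trans z1; rewrite cabsM cabs_real gtr0_norm //.
    by rewrite ler_piMl ?cabs_ge0 // ltW.
  have p2 : pcoef (fun n => n.+1%:R * n.+1%:R : R[i]) by apply: pcoefM; exact: pcoef_succ.
  have h1 := pcoefZ (1 - xi)%:C (pcoef_succ (R := R)); have h2 := pcoefZ xi%:C p2.
  have -> : psum d (t%:C * - r%:C) =
      psum (fun n => (1 - xi)%:C * n.+1%:R + xi%:C * (n.+1%:R * n.+1%:R)) (t%:C * - r%:C).
    apply: eq_psum => n; rewrite /d /hcoef subrr !mul0r addr0 mulrA -mulrDl; congr (_ * _).
    by rewrite -(rmorph_nat (real_complex R)) -rmorphM -rmorphD /xi_w -natr1; congr (_%:C); ring.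
  rewrite (psumD h1 h2) // (psumZ _ pcoef_succ) // (psumZ _ p2) // psum_succ // psum_sqr_succ //.
  have -> : t%:C * - r%:C = (- (r * t))%:C by rewrite rmorphN rmorphM; ring.
  have -> : 1 - (- (r * t))%:C = (1 + r * t)%:C by rewrite rmorphN opprK rmorphD rmorph1.
  have -> : 1 + (- (r * t))%:C = (1 - r * t)%:C by rewrite rmorphN rmorphB rmorph1.
  rewrite -fmorphV -!rmorphXn -fmorphV -!rmorphM -rmorphD /= /phi_g /phi_q exprVn.
  by rewrite div1r.
have i1 := psum_dilate_integrable ikern hd z1.
have [_ i2 _] := g_facts; have [_ i3 _] := q_facts.
have i4 : leb.-integrable I (EFin \o (fun t => kern t * ((1 - xi) * phi_g t + xi * phi_q t))).
  have -> : (fun t => kern t * ((1 - xi) * phi_g t + xi * phi_q t)) =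
     (fun t => (1 - xi) * (kern t * phi_g t) + xi * (kern t * phi_q t)).
    by apply/funext => t; ring.
  by apply: integrable_add; exact: integrableZ.
have h1 : \int[leb]_(t in I) (kern t * complex.Re (psum d (t%:C * - r%:C))) =
    mu * nu * complex.Re (psum (psi_coef 1) (- r%:C)).
  rewrite integral_psum_dilate // -ReCM -(psumZ _ (pcoef_psi 1)) //; congr (complex.Re _).
  by apply: eq_psum => n; rewrite psi_coefE mulrA -rmorphM mulfV // rmorph1 mul1r.
have h2 : \int[leb]_(t in I) (kern t * complex.Re (psum d (t%:C * - r%:C))) <=
    \int[leb]_(t in I) (kern t * ((1 - xi) * phi_g t + xi * phi_q t) + (8 * (1 - r)) * kern t).
  apply: le_Rintegral => //; first by apply: integrable_add => //; exact: integrableZ ikern.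
  move=> t It; have t01 : 0 < t < 1 by move: It; rewrite /= in_itv.
  rewrite dval // [_ * kern t]mulrC -mulrDr.
  rewrite ler_wpM2l ?kern0 //; have [l1 l2] := phi_lip r01 t01.
  case/andP: xi01 => x0 x1; have x1' : 0 <= 1 - xi by rewrite subr_ge0.
  rewrite -lerBlDl; apply: (@le_trans _ _ ((1 - xi) * (8 * (1 - r)) + xi * (8 * (1 - r)))).
    rewrite [leLHS](_ : _ = (1 - xi) * (phi_g (r * t) - phi_g t) + xi * (phi_q (r * t) - phi_q t)); last by ring.
    by rewrite lerD // ler_wpM2l.
  by rewrite -mulrDl subrK mul1r.
have mn0 : 0 < mu * nu by rewrite mulr_gt0.
move: h2; rewrite h1 RintegralD ?kernel_beta //; last exact: integrableZ ikern.
rewrite RintegralZl // kernel_mass [_ * (mu * nu)]mulrC -mulrDr.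
by rewrite ler_pM2l.
Qed.

End RealPartIdentity.

(** * The classes and the transform in terms of coefficients *)

Section Coefficients.
Context {R : realType}.
Notation leb := (@lebesgue_measure R).
Notation I := (`]0%R, 1%R[%classic : set R).
Local Open Scope complex_scope.
Implicit Types (f F : R[i] -> R[i]) (a A B : nat -> R[i]) (z : R[i]).

Section Transform.
Variable lam : R -> R.
Hypotheses (ilam : leb.-integrable I (EFin \o lam)) (lam0 : forall t : R, 0 < t < 1 -> 0 <= lam t).

Let integral_dilate (G : R -> R) (c : nat -> R[i]) z : pcoef c -> cabs z < 1 ->
  (forall t : R, 0 < t < 1 -> G t = lam t * complex.Re (psum c (t%:C * z))) ->
  \int[leb]_(t in `[0, 1]) G t = complex.Re (psum (fun n => (moment lam n)%:C * c n) z).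
Proof.
move=> hc z1 hG.
have i1 := psum_dilate_integrable ilam hc z1.
have m1 : measurable_fun I (fun t => lam t * complex.Re (psum c (t%:C * z))).
  by case/integrableP: i1 => /measurable_EFinP.
rewrite Rintegral_I; last first.
  by apply: eq_measurable_fun m1 => t; rewrite inE /= in_itv /= => /hG ->.
rewrite -integral_psum_dilate //.
by apply: eq_Rintegral => t; rewrite inE /= in_itv /= => /hG.
Qed.

(** The complex integral is computed from [integral_psum_dilate], applied to the series
    for the real part and to its product with [- i] for the imaginary part. *)
Lemma V_op_psum f a : pcoef a -> a 0%N = 0 -> (forall z, cabs z < 1 -> f z = psum a z) ->
  forall z, cabs z < 1 ->
  V_op lam f z = psum (fun n => if n is m.+1 then (moment lam m)%:C * a m.+1 else 0) z.
Proof.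
move=> ha a0 fE z z1.
have haS := pcoefS ha.
have hm : pcoef (fun n => (moment lam n)%:C * a n.+1) by exact: pcoef_moment.
rewrite psum_cons // add0r.
have hc := pcoefZ z haS.
have quot (t : R) : 0 < t < 1 -> f (t%:C * z) / t%:C = psum (fun n => z * a n.+1) (t%:C * z).
  move=> /andP[t0 t1]; have tz : cabs (t%:C * z) < 1.
    by apply: le_lt_trans z1; rewrite cabsM cabs_real gtr0_norm // ler_piMl ?cabs_ge0 // ltW.
  rewrite fE // psumS // a0 add0r (psumZ z haS) // mulrAC; congr (_ * _).
  by rewrite mulrAC divff ?mul1r // -cabs_gt0 cabs_real normr_gt0 gt_eqF.
have tz (t : R) : 0 < t < 1 -> cabs (t%:C * z) < 1.
  move=> /andP[t0 t1]; apply: le_lt_trans z1.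
  by rewrite cabsM cabs_real gtr0_norm // ler_piMl ?cabs_ge0 // ltW.
have val c0 : psum (fun n => (moment lam n)%:C * (c0 * (z * a n.+1))) z =
    c0 * (z * psum (fun n => (moment lam n)%:C * a n.+1) z).
  rewrite mulrA -psumZ //; apply: eq_psum => n; ring.
apply: complex_ReIm.
  rewrite /V_op /cintegral01 [LHS]/= (integral_dilate hc z1).
    rewrite -[z * psum _ _]mul1r -val; congr (complex.Re _); apply: eq_psum => n.
    by rewrite mul1r.
  by move=> t t01; rewrite ReCM quot.
have hic := pcoefZ (- 'i%C) hc.
rewrite /V_op /cintegral01 [LHS]/= (integral_dilate hic z1).
  by rewrite val ReM /=; ring.
move=> t t01; rewrite ImCM quot // (psumZ _ hc) ?tz //.
by congr (_ * _); rewrite ReM /=; ring.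
Qed.

End Transform.

(** The relations between [mu, nu] and [alpha, gamma] are made for the factorisation
    [1 + (alpha - gamma) n + gamma n ^ 2 = (1 + mu n) (1 + nu n)]. *)
Lemma class_W_psum (alpha gamma mu nu : R) f a :
  mu + nu = alpha - gamma -> mu * nu = gamma ->
  pcoef a -> a 0%N = 0 -> (forall z, cabs z < 1 -> f z = psum a z) ->
  forall z, cabs z < 1 ->
  (1 - alpha + 2 * gamma)%:C * quotz f z + (alpha - 2 * gamma)%:C * cderive f z
     + gamma%:C * z * cderive (cderive f) z =
  psum (fun n => ((1 + mu * n%:R) * (1 + nu * n%:R))%:C * a n.+1) z.
Proof.
move=> hD hM ha a0 fE z z1.
have hda := pcoef_dcoef ha.
have fdE w : cabs w < 1 -> cderive f w = psum (dcoef a) w.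
  by move=> w1; have [_ ->] := disk_cderive ha fE w1.
have [_ fddE] := disk_cderive hda fdE z1.
have haS := pcoefS ha.
rewrite (disk_quotz ha fE a0 z1) fdE // fddE -mulrA psum_zderiv //.
have h1 := pcoefZ (1 - alpha + 2 * gamma)%:C haS.
have h2 := pcoefZ (alpha - 2 * gamma)%:C hda.
have h3 := pcoefZ gamma%:C (pcoefMn hda).
rewrite -(psumZ _ haS) // -(psumZ _ hda) // -(psumZ _ (pcoefMn hda)) //.
rewrite -(psumD h1 h2) // -(psumD (pcoefD h1 h2) h3) //; apply: eq_psum => n.
rewrite /dcoef -!(rmorph_nat (real_complex R)) !mulrA -!rmorphM -!mulrDl -!rmorphD.
congr (_%:C * _); have -> : alpha = mu + nu + gamma by rewrite hD subrK.
by rewrite -hM -natr1; ring.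
Qed.

Section Pascu.
Variables (xi : R) (F : R[i] -> R[i]) (A : nat -> R[i]).
Hypotheses (hA : pcoef A) (A0 : A 0%N = 0) (FE : forall z, cabs z < 1 -> F z = psum A z).

Let zdF w : cabs w < 1 -> w * cderive F w = psum (fun n => n%:R * A n) w.
Proof. by move=> w1; have [_ ->] := disk_cderive hA FE w1; rewrite psum_zderiv. Qed.

Let hA1 := pcoefMn hA.
Let hA2 := pcoefMn hA1.

Lemma pascu_numerator z : cabs z < 1 ->
  xi%:C * z * cderive (fun w => w * cderive F w) z + (1 - xi)%:C * (z * cderive F z) =
  z * psum (fun n => n.+1%:R * ((1 + xi * n%:R)%:C * A n.+1)) z.
Proof.
move=> z1; rewrite zdF //.
have [_ ->] := disk_cderive hA1 zdF z1.
rewrite -mulrA psum_zderiv // -(psumZ _ hA2) // -(psumZ _ hA1) //.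
have h1 := pcoefZ xi%:C hA2; have h2 := pcoefZ (1 - xi)%:C hA1.
rewrite -(psumD h1 h2) // psumS //; last exact: pcoefD.
rewrite !mul0r !mulr0 addr0 add0r; congr (_ * _); apply: eq_psum => n.
rewrite -!(rmorph_nat (real_complex R)) !mulrA -!rmorphM -!mulrDl -!rmorphD.
by congr (_%:C * _); rewrite -natr1; ring.
Qed.

Lemma pascu_denominator z : cabs z < 1 ->
  xi%:C * (z * cderive F z) + (1 - xi)%:C * F z =
  z * psum (fun n => (1 + xi * n%:R)%:C * A n.+1) z.
Proof.
move=> z1; rewrite zdF // FE // -(psumZ _ hA1) // -(psumZ _ hA) //.
have h1 := pcoefZ xi%:C hA1; have h2 := pcoefZ (1 - xi)%:C hA.
rewrite -(psumD h1 h2) // psumS //; last exact: pcoefD.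
rewrite A0 !mulr0 addr0 add0r; congr (_ * _); apply: eq_psum => n.
rewrite -!(rmorph_nat (real_complex R)) !mulrA -!rmorphM -!mulrDl -!rmorphD.
by congr (_%:C * _); rewrite -natr1; ring.
Qed.

End Pascu.

Lemma pcoef_succM B : pcoef B -> pcoef (fun n => n.+1%:R * B n).
Proof. by move=> hB; apply: pcoefM => //; exact: pcoef_succ. Qed.

(** The Hadamard product with [h_ eps z / z] is a rotation-dependent combination of the
    numerator and denominator of the Pascu quotient. *)
Lemma psum_hcoef B (eps z : R[i]) : pcoef B -> cabs z < 1 ->
  2 * psum (fun n => hcoef eps n * B n) z =
  psum (fun n => n.+1%:R * B n) z + psum B z +
  eps * (psum (fun n => n.+1%:R * B n) z - psum B z).
Proof.
move=> hB z1; have h1 := pcoef_succM hB; have h0 := pcoefM (pcoef_hcoef eps) hB.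
have h2 := pcoefZ (-1) hB; have h3 := pcoefD h1 h2; have h4 := pcoefZ eps h3.
have -> : psum (fun n => n.+1%:R * B n) z - psum B z =
   psum (fun n => n.+1%:R * B n + -1 * B n) z.
  by rewrite (psumD h1 h2) // (psumZ _ hB) // mulN1r.
rewrite -(psumZ _ h3) // -(psumD h1 hB) // -(psumD (pcoefD h1 hB) h4) // -(psumZ _ h0) //.
by apply: eq_psum => n; rewrite /hcoef -natr1; field.
Qed.

(** [x / y] lies in the right half-plane iff [x] is nearer to [y] than to [- y]; this is
    also correct for [y = 0], with the convention [x / 0 = 0]. *)
Lemma cabs_lt_Re (x y : R[i]) : (cabs (x - y) < cabs (x + y)) = (0 < complex.Re (x / y)).
Proof.
have -> : (cabs (x - y) < cabs (x + y)) = (cabs (x - y) ^+ 2 < cabs (x + y) ^+ 2).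
  by rewrite ltr_pXn2r // nnegrE cabs_ge0.
have [->|y0] := eqVneq y 0; first by rewrite subr0 addr0 invr0 mulr0 !ltxx.
have y2 : 0 < cabs y ^+ 2 by rewrite exprn_gt0 // cabs_gt0.
have e : complex.Re (x / y) * cabs y ^+ 2 * 4 = cabs (x + y) ^+ 2 - cabs (x - y) ^+ 2.
  move: y2; rewrite !cabs_sqr ReM !ReD !ImD !ReN !ImN; case: x y {y0} => x1 x2 [y1 y2] /= h.
  by field; rewrite gt_eqF.
by rewrite -subr_gt0 -e pmulr_lgt0 // pmulr_lgt0.
Qed.

(** Choose [eps] so that [e * eps * v] is the negative number [- cabs v]. *)
Lemma cabs_lt_of_rotations (e u v : R[i]) : cabs e = 1 ->
  (forall eps, cabs eps = 1 -> 0 < complex.Re (e * (u + eps * v))) -> cabs v < cabs u.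
Proof.
move=> e1 h.
have e0 : e != 0 by rewrite -cabs_gt0 e1.
have key eps : cabs eps = 1 -> - complex.Re (e * (eps * v)) < cabs u.
  move=> /h; rewrite mulrDr ReD => h1; rewrite ltrNl -subr_gt0 opprK.
  apply: lt_le_trans h1 _; rewrite addrC lerD2l.
  have := Re_le_cabs (e * u); rewrite cabsM e1 mul1r; apply: le_trans; exact: ler_norm.
have [v0|v0] := eqVneq v 0.
  have := h 1 (cabs1 (R := R)); rewrite v0 mulr0 addr0 cabs0 => h1; apply: lt_le_trans h1 _.
  by have := Re_le_cabs (e * u); rewrite cabsM e1 mul1r; apply: le_trans; exact: ler_norm.
pose eps := - (cabs v)%:C / (e * v).
have ev0 : e * v != 0 by rewrite mulf_neq0.
have eps1 : cabs eps = 1.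
  rewrite cabsM cabsN cabs_real ger0_norm ?cabs_ge0 // cabsV cabsM e1 mul1r divff //.
  by rewrite gt_eqF // cabs_gt0.
have := key _ eps1; rewrite mulrCA /eps divfK //.
by rewrite ReN opprK.
Qed.

End Coefficients.

(** * Duality, extremal functions and sharpness *)

Section Duality.
Context {R : realType}.
Notation leb := (@lebesgue_measure R).
Notation I := (`]0%R, 1%R[%classic : set R).
Local Open Scope complex_scope.
Variables (alpha gamma xi mu nu : R) (lam : R -> R).
Hypotheses (mu0 : 0 < mu) (nu0 : 0 < nu).
Hypotheses (munuD : mu + nu = alpha - gamma) (munuM : mu * nu = gamma).
Hypotheses (ilam : leb.-integrable I (EFin \o lam)) (lam0 : forall t : R, 0 < t < 1 -> 0 <= lam t).
Hypothesis lam1 : \int[leb]_(t in I) lam t = 1.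

Let psi := psi_coef mu nu xi lam.
Let pcoef_psi' eps : pcoef (psi eps) := pcoef_psi xi mu0 nu0 ilam lam0 eps.

Let W n : R := (1 + mu * n%:R) * (1 + nu * n%:R).

Let W_gt0 n : 0 < W n.
Proof. by rewrite mulr_gt0 // ltr_pwDl // mulr_ge0 // ltW. Qed.

(** [P a] gives the expression in the definition of [class_W] before [beta] is
    subtracted; [B a] gives the denominator of the Pascu quotient of the transform, up
    to a factor [z]. *)
Let P (a : nat -> R[i]) n : R[i] := (W n)%:C * a n.+1.
Let B (a : nat -> R[i]) n : R[i] := (1 + xi * n%:R)%:C * ((moment lam n)%:C * a n.+1).

(** The factorisation on which the duality rests: all conditions on the transform are
    conditions on Hadamard products of [P a] with fixed series. *)
Let psi_P eps a n : psi eps n * P a n = hcoef eps n * B a n.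
Proof.
rewrite /psi /psi_coef /psi_weight /P /B -/(W n).
rewrite [_%:C * hcoef _ _]mulrC -!mulrA; congr (_ * _); rewrite !mulrA -!rmorphM; congr (_%:C * _).
by have := W_gt0 n; move: (W n) => w w0; field; rewrite gt_eqF.
Qed.

Let pcoef_B a : pcoef a -> pcoef (B a).
Proof. by move=> ha; apply: pcoef_affine; apply: pcoef_moment => //; exact: pcoefS. Qed.

Let pcoef_P a : pcoef a -> pcoef (P a).
Proof. by move=> ha; have := pcoef_affine mu (pcoef_affine nu (pcoefS ha)); congr pcoef;
  apply/funext => n; rewrite /P /W rmorphM mulrA. Qed.

Lemma moment0 : moment lam 0 = 1.
Proof. by rewrite -lam1; apply: eq_Rintegral => t _; rewrite expr0 mulr1. Qed.

Lemma pascu_V_op f a : pcoef a -> (forall z, cabs z < 1 -> f z = psum a z) ->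
  a 0%N = 0 -> a 1%N = 1 ->
  pascu xi (V_op lam f) <-> forall z, cabs z < 1 -> z != 0 ->
    0 < complex.Re (psum (fun n => n.+1%:R * B a n) z / psum (B a) z).
Proof.
move=> ha fE a0 a1.
have hm : pcoef (fun n => (moment lam n)%:C * a n.+1) by apply: pcoef_moment => //; exact: pcoefS.
have hA := pcoef_cons 0 hm; have FE := V_op_psum ilam lam0 ha a0 fE.
have val z : cabs z < 1 -> z != 0 ->
   (xi%:C * z * cderive (fun w => w * cderive (V_op lam f) w) z
             + (1 - xi)%:C * (z * cderive (V_op lam f) z))
            / (xi%:C * (z * cderive (V_op lam f) z) + (1 - xi)%:C * V_op lam f z) =
   psum (fun n => n.+1%:R * B a n) z / psum (B a) z.
  move=> z1 z0; rewrite (pascu_numerator xi hA FE z1) (pascu_denominator xi hA erefl FE z1).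
  by rewrite invfM mulrACA divff // mul1r.
split.
  by move=> [_ h] z z1 z0; rewrite -val // h // unit_diskE.
move=> h; split; first by apply: (disk_class_A hA FE) => //=; rewrite moment0 a1 mulr1.
by move=> z; rewrite unit_diskE => z1 z0; rewrite val // h.
Qed.

Lemma real_scale (r : R) (z : R[i]) : cabs z < 1 -> 0 < r <= 1 -> cabs (r%:C * z) < 1.
Proof.
move=> z1 /andP[r0 r1]; apply: le_lt_trans z1.
by rewrite cabsM cabs_real gtr0_norm // ler_piMl ?cabs_ge0.
Qed.

Section Beta.
Variable beta : R.
Hypothesis beta1 : beta < 1.
Let b := beta / (1 - beta).

Let beta0 : 0 < 1 - beta. Proof. by rewrite subr_gt0. Qed.

Let bE : b * (1 - beta) = beta. Proof. by rewrite divfK // gt_eqF. Qed.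

Let b1 : (1 + b) * (1 - beta) = 1. Proof. by rewrite mulrDl bE mul1r subrK. Qed.

(** Membership in the class says that [e * (P a - beta)] has positive real part, so
    [hadamard_Re_ge] applies to it: the bound [(1 - b) / 2] is exactly the one for which
    [e * (psi * P a)] has nonnegative real part. The product then never vanishes, in
    the quantitative form needed for [cabs_lt_of_rotations]. *)
Theorem pascu_of_psi_bound :
  (forall eps : R[i], cabs eps = 1 -> forall z, cabs z < 1 ->
     (1 - b) / 2 <= complex.Re (psum (psi eps) z)) ->
  forall f, class_W beta alpha gamma f -> pascu xi (V_op lam f).
Proof.
move=> hpsi f [fA [phi fW]].
have [a [ha fE a0 a1]] := class_A_psum fA.
apply/(pascu_V_op ha fE a0 a1) => z z1 z0.
pose e : R[i] := cos phi +i* sin phi.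
have e1 : cabs e = 1 by rewrite cabsE /= cos2Dsin2 sqrtr1.
have hP := pcoef_P ha; have hB := pcoef_B ha.
have P0 : P a 0%N = 1 by rewrite /P /W !mulr0 !addr0 mulr1 rmorph1 mul1r.
pose dl n : R[i] := if n is m.+1 then 0 else 1.
have hz : pcoef (fun=> 0 : R[i]) by apply: (pcoef_bounded (B := 0)) => n; rewrite cabs0.
have hdl : pcoef dl by exact: (pcoef_cons 1 hz).
have dlE w : cabs w < 1 -> psum dl w = 1.
  move=> w1; rewrite (psum_cons 1 hz) //.
  have -> : psum (fun=> 0) w = 0 * psum (fun=> 0) w.
    by rewrite -(psumZ 0 hz) //; apply: eq_psum => n; rewrite mul0r.
  by rewrite mul0r mulr0 addr0.
pose T n := e * (P a n + (- beta%:C) * dl n).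
have hT : pcoef T by apply: pcoefZ; apply: pcoefD => //; exact: pcoefZ.
have TE w : cabs w < 1 -> psum T w = e * (psum (P a) w - beta%:C).
  move=> w1; have h2 := pcoefZ (- beta%:C) hdl.
  by rewrite (psumZ _ (pcoefD hP h2)) // (psumD hP h2) // (psumZ _ hdl) // dlE // mulr1.
have T_gt0 w : cabs w < 1 -> 0 < complex.Re (psum T w).
  move=> w1; rewrite TE //.
  have := fW w; rewrite unit_diskE => /(_ w1).
  have lE := class_W_psum munuD munuM ha a0 fE w1.
  have -> : psum (P a) w = psum (fun n => (W n)%:C * a n.+1) w by [].
  by rewrite -lE.
have T0 : T 0%N = e * (1 - beta)%:C by rewrite /T P0 /dl mulr1 rmorphB rmorph1.
have ReT0 : complex.Re (T 0%N) = cos phi * (1 - beta).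
  by rewrite T0 mulrC ReCM mulrC.
have cos0 : 0 < cos phi.
  have c0 : cabs (0 : R[i]) < 1 by rewrite cabs0.
  by have := T_gt0 _ c0; rewrite psum0 // ReT0 pmulr_lgt0.
rewrite -cabs_lt_Re.
apply: (cabs_lt_of_rotations e1) => eps eps1.
have hpsiP := pcoefM (pcoef_psi' eps) hP.
pose H n := e * (psi eps n * P a n).
have hH : pcoef H by exact: pcoefZ.
have psi0 : psi eps 0%N = 1 by exact: psi_coef0.
have HE w : cabs w < 1 -> psum (fun n => psi eps n * T n) w = psum H w - e * beta%:C.
  move=> w1; have h2 := pcoefZ (- (e * beta%:C)) hdl.
  rewrite -[- (e * beta%:C)]mulr1 -(dlE w w1) -(psumZ _ hdl) // -(psumD hH h2) //.
  apply: eq_psum => -[|n]; rewrite /T /H /dl ?psi0; ring.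
have H_ge0 w : cabs w < 1 -> 0 <= complex.Re (psum H w).
  move=> w1.
  have := hadamard_Re_ge hT (pcoef_psi' eps) psi0 (fun z hz => ltW (T_gt0 z hz)) (hpsi eps eps1) w1.
  rewrite HE // ReD ReN ReT0 [e * beta%:C]mulrC ReCM -/b => h.
  have e2 : (2 * ((1 - b) / 2) - 1) * (cos phi * (1 - beta)) = - (beta * cos phi).
    by rewrite -[in RHS]bE; field.
  by move: h; rewrite e2 -[X in X <= _]add0r lerD2r.
have H0 : 0 < complex.Re (H 0%N) by rewrite /H psi0 P0 !mulr1.
have := psum_Re_gt0 hH H_ge0 H0 z1.
have -> : psum H z = e * psum (fun n => hcoef eps n * B a n) z.
  by rewrite (psumZ _ hpsiP) //; congr (_ * _); apply: eq_psum => n; exact: psi_P.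
have -> : psum (fun n => hcoef eps n * B a n) z = 2^-1 * (2 * psum (fun n => hcoef eps n * B a n) z).
  by rewrite mulrA mulVf ?mul1r // pnatr_eq0.
rewrite psum_hcoef //.
have -> : (2^-1 : R[i]) = (2^-1)%:C by rewrite fmorphV rmorph_nat.
by rewrite mulrCA ReCM pmulr_rgt0 // invr_gt0.
Qed.

(** Chosen so that the series [P] of this function is [1 + s * (z + z ^ 2 + ...)], a
    Moebius map which for suitable [s] takes the disk onto the half-plane allowed by
    [class_W]. *)
Definition extremal_coef (s : R[i]) n : R[i] :=
  if n is m.+1 then ((W m)^-1)%:C * (if m == 0%N then 1 else s) else 0.

Definition extremal (s : R[i]) : R[i] -> R[i] := psum (extremal_coef s).

Lemma pcoef_extremal s : pcoef (extremal_coef s).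
Proof.
apply: (pcoef_bounded (B := 1 + cabs s)) => -[|m] /=.
  by rewrite cabs0 addr_ge0 ?cabs_ge0.
have W1 : 1 <= W m.
  have h1 : 1 <= 1 + mu * m%:R by rewrite lerDl mulr_ge0 // ltW.
  have h2 : 1 <= 1 + nu * m%:R by rewrite lerDl mulr_ge0 // ltW.
  by apply: (le_trans h1); rewrite /W ler_peMr // (le_trans ler01 h1).
rewrite cabsM cabs_real ger0_norm ?invr_ge0 ?(ltW (W_gt0 m)) //.
apply: (@le_trans _ _ (cabs (if m == 0%N then 1 else s))).
  by rewrite ler_piMl ?cabs_ge0 // invf_le1.
by case: ifP => _; rewrite ?cabs1 ?lerDl ?lerDr ?cabs_ge0.
Qed.

Lemma extremal1 s : extremal_coef s 1%N = 1.
Proof.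
have W0 : W 0 = 1 by rewrite /W !mulr0 !addr0 mulr1.
by rewrite /extremal_coef W0 invr1 mulr1.
Qed.

Lemma P_extremal s n : P (extremal_coef s) n = if n == 0%N then 1 else s.
Proof.
have e : (W n)%:C * ((W n)^-1)%:C = 1 by rewrite -rmorphM mulfV // gt_eqF.
by rewrite /P /extremal_coef mulrA e mul1r.
Qed.

Lemma psum_psi_extremal eps s z : cabs z < 1 ->
  psum (fun n => psi eps n * P (extremal_coef s) n) z = 1 + s * (psum (psi eps) z - 1).
Proof.
move=> z1; have psi0 : psi eps 0%N = 1 by exact: psi_coef0.
have := psum_scalar s (pcoef_psi' eps) z1; rewrite psi0 => <-.
by apply: eq_psum => -[|n]; rewrite P_extremal /= ?psi0 ?mulr1 // mulrC.
Qed.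

Lemma extremal_class_W s (phi : R) :
  0 < cos phi -> (cos phi +i* sin phi) * s = (2 * (1 - beta) * cos phi)%:C ->
  class_W beta alpha gamma (extremal s).
Proof.
move=> cos0 hs; have ha := pcoef_extremal s.
split; first by apply: (disk_class_A ha) => //; exact: extremal1.
exists phi => z; rewrite unit_diskE => z1.
have a0 : extremal_coef s 0 = 0 by [].
have fE w : cabs w < 1 -> extremal s w = psum (extremal_coef s) w by [].
have lE := class_W_psum munuD munuM ha a0 fE z1.
set e : R[i] := _ +i* _ in hs *.
rewrite (congr1 (fun x => complex.Re (e * (x - beta%:C))) lE).
have -> : psum (fun n => ((1 + mu * n%:R) * (1 + nu * n%:R))%:C * extremal_coef s n.+1) z =
   1 + s * ((1 - z)^-1 - 1).
  rewrite -psum_geo // -[X in X + _]/((fun=> 1 : R[i]) 0%N) -[X in _ - X]/((fun=> 1 : R[i]) 0%N).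
  rewrite -(psum_scalar s (pcoef1 (R := R))) //.
  by apply: eq_psum => n; rewrite -/(P _ n) P_extremal mulr1.
have -> : e * (1 + s * ((1 - z)^-1 - 1) - beta%:C) =
   e * (1 - beta)%:C + (e * s) * ((1 - z)^-1 - 1) by rewrite rmorphB rmorph1; ring.
rewrite hs ReD ReCM ReD ReN [complex.Re 1]/= [e * _]mulrC ReCM /=.
have := Re_inv1B_ge (lexx (cabs z)) z1.
have h : 2^-1 < (1 + cabs z)^-1.
  have c0 : 0 < 1 + cabs z by rewrite ltr_wpDr ?cabs_ge0.
  by rewrite ltf_pV2 ?posrE // -[ltRHS]/(1 + 1) ltrD2l.
move=> /(lt_le_trans h); move: (complex.Re _) => x hx.
have -> : (1 - beta) * cos phi + 2 * (1 - beta) * cos phi * (x - 1) =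
   (1 - beta) * cos phi * (2 * (x - 2^-1)) by field.
by rewrite mulr_gt0 ?mulr_gt0 // subr_gt0.
Qed.

(** If the bound on [psi] failed, its real part would equal [(1 - b) / 2] somewhere on
    a radius. At such a point [e * (1 + s * (psi - 1))] has real part [0] whatever the
    rotation [e], and the angle is chosen to make the imaginary part vanish too. *)
Theorem psi_bound_of_pascu :
  (forall f, class_W beta alpha gamma f -> pascu xi (V_op lam f)) ->
  forall eps : R[i], cabs eps = 1 -> forall z, cabs z < 1 ->
     (1 - b) / 2 <= complex.Re (psum (psi eps) z).
Proof.
move=> hpascu eps eps1 z0 z01; rewrite leNgt; apply/negP => hlt.
have b10 : 0 < 1 + b by rewrite -(pmulr_lgt0 _ beta0) b1.
have psi0 : psi eps 0%N = 1 by exact: psi_coef0.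
have v1 : (1 - b) / 2 < complex.Re (psi eps 0%N) by rewrite psi0 /=; lra.
have [t t01 ht] := psum_segment (pcoef_psi' eps) z01 v1 (ltW hlt).
have zn0 : z0 != 0.
  by apply/negP => /eqP e; move: hlt; rewrite e psum0 // ltNge (ltW v1).
set z := t%:C * z0 in ht.
have z1 : cabs z < 1 by exact: real_scale.
have zz0 : z != 0.
  by rewrite mulf_neq0 // -cabs_gt0 cabs_real normr_gt0 gt_eqF //; case/andP: t01.
pose eta := complex.Im (psum (psi eps) z).
(* The equation [2 * (1 - beta) * eta * cos phi + sin phi = 0] for the imaginary part. *)
pose phi := atan (- (2 * eta * (1 - beta))).
have cos0 : 0 < cos phi by rewrite cos_gt0_pihalf // atan_gtNpi2 atan_ltpi2.
pose e : R[i] := cos phi +i* sin phi.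
have sinE : sin phi = - (2 * eta * (1 - beta)) * cos phi.
  have : tan phi = - (2 * eta * (1 - beta)) by rewrite atanK.
  by rewrite /tan => <-; rewrite divfK // gt_eqF.
pose s : R[i] := (2 * (1 - beta) * cos phi)%:C * (cos phi -i* sin phi).
have es : e * s = (2 * (1 - beta) * cos phi)%:C.
  rewrite /s mulrCA (_ : e * _ = 1) ?mulr1 //.
  apply: complex_ReIm; rewrite /= ?mulrN ?opprK; last by ring.
  by rewrite -!expr2 cos2Dsin2.
have hW := extremal_class_W cos0 es.
have ha := pcoef_extremal s; have hB := pcoef_B ha.
have /(pascu_V_op ha (fun _ _ => erefl) erefl (extremal1 s)) hgt := hpascu _ hW.
have := hgt z z1 zz0; rewrite -cabs_lt_Re.
set x := psum _ z; set y := psum _ z.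
have zero : x + y + eps * (x - y) = 0.
  rewrite -psum_hcoef //.
  have -> : psum (fun n => hcoef eps n * B (extremal_coef s) n) z =
     psum (fun n => psi eps n * P (extremal_coef s) n) z.
    by apply: eq_psum => n; rewrite psi_P.
  rewrite psum_psi_extremal //.
  have en0 : e != 0 by rewrite -cabs_gt0 cabsE /= cos2Dsin2 sqrtr1.
  apply/eqP; rewrite mulf_eq0 pnatr_eq0 /=; apply/eqP; apply: (mulfI en0).
  rewrite mulr0 mulrDr mulr1 mulrA es.
  apply: complex_ReIm.
    rewrite ReD ReCM ReD ReN ht -[complex.Re e]/(cos phi) -[complex.Re 1]/(1 : R).
    have -> : 2 * (1 - beta) * cos phi * ((1 - b) / 2 - 1) =
      - ((1 + b) * (1 - beta)) * cos phi by field.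
    by rewrite b1 mulN1r subrr.
  rewrite ImD ImCM ImD ImN -/eta -[complex.Im e]/(sin phi) sinE.
  by rewrite -[complex.Im 1]/(0 : R) -[RHS]/(0 : R); ring.
have -> : x + y = - (eps * (x - y)) by apply/eqP; rewrite -addr_eq0 zero.
by rewrite cabsN cabsM eps1 mul1r ltxx.
Qed.

End Beta.

Lemma psum_P_extremal_Im eps s z : (forall n, complex.Im (psi eps n) = 0) ->
  complex.Im s = 0 -> cabs z < 1 -> complex.Im z = 0 ->
  complex.Im (psum (fun n => psi eps n * P (extremal_coef s) n) z) = 0.
Proof.
move=> hpsi s0 z1 z0.
apply: psum_real => //; first exact: pcoefM (pcoef_psi' eps) (pcoef_P (pcoef_extremal s)).
by move=> n; rewrite P_extremal ImM hpsi mul0r addr0; case: ifP => _; rewrite ?s0 mulr0.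
Qed.

(** For [beta' < beta] the extremal function makes the real Hadamard product
    change sign on the segment from [0] to [-1]; at the zero, which for [eps = 1]
    is a zero of the numerator in the Pascu quotient, the quotient vanishes. *)
Theorem pascu_sharp beta beta' : beta < 1 -> beta' < beta ->
  (forall n, complex.Im (psi 1 n) = 0) ->
  (forall r : R, 0 < r < 1 -> complex.Re (psum (psi 1) (- r%:C)) <=
     (1 - beta / (1 - beta)) / 2 + 8 * (1 - r)) ->
  exists f, class_W beta' alpha gamma f /\ ~ pascu xi (V_op lam f).
Proof.
move=> beta1 lt_beta psi_real near1.
have beta0 : 0 < 1 - beta by rewrite subr_gt0.
have beta'1 : beta' < 1 by exact: lt_trans beta1.
have beta'0 : 0 < 1 - beta' by rewrite subr_gt0.
pose s : R[i] := (2 * (1 - beta'))%:C.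
exists (extremal s); split.
  apply: (@extremal_class_W _ beta'1 _ 0); rewrite cos0 ?ltr01 // sin0 mulr1.
  by rewrite -[_ +i* _]/(1 : R[i]) mul1r.
have ha := pcoef_extremal s; have hB := pcoef_B ha.
have fE w : cabs w < 1 -> extremal s w = psum (extremal_coef s) w by [].
have a0 : extremal_coef s 0 = 0 by [].
move=> /(pascu_V_op ha fE a0 (extremal1 s)) hgt.
pose c n := psi 1 n * P (extremal_coef s) n.
have hc : pcoef c by exact: pcoefM (pcoef_psi' 1) (pcoef_P ha).
(* The value of the product at [-1] is at most [1 - (1 - beta') / (1 - beta)], which is
   negative, and moving to [- r] costs at most [16 * (1 - beta') * (1 - r)]. *)
pose d0 := (beta - beta') / (16 * (1 - beta) * (1 - beta')).
have d00 : 0 < d0 by rewrite divr_gt0 ?mulr_gt0 ?subr_gt0.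
pose r := 1 - Num.min d0 2^-1.
have m0 : 0 < Num.min d0 2^-1 by rewrite lt_min d00 invr_gt0 ltr0n.
have r01 : 0 < r < 1.
  have half1 : (2^-1 : R) < 1 by rewrite invf_lt1 ?ltr1n.
  by rewrite /r subr_gt0 gt_min half1 orbT ltrBlDr ltrDl m0.
have z1 : cabs (- r%:C) < 1 by case/andP: r01 => r0 r1; rewrite cabsN cabs_real gtr0_norm.
have c0 : complex.Re (c 0%N) = 1.
  have psi0 : psi 1 0%N = 1 by exact: psi_coef0.
  by rewrite /c P_extremal mulr1 psi0.
have c_le0 : complex.Re (psum c (- r%:C)) <= 0.
  rewrite psum_psi_extremal // ReD ReCM ReD ReN [complex.Re 1]/=.
  have h := near1 r r01.
  have h' : complex.Re (psum (psi 1) (- r%:C)) - 1 <= - (2 * (1 - beta))^-1 + 8 * d0.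
    apply: (@le_trans _ _ ((1 - beta / (1 - beta)) / 2 + 8 * (1 - r) - 1)); first by rewrite lerB.
    have -> : (1 - beta / (1 - beta)) / 2 = 1 - (2 * (1 - beta))^-1.
      by field; rewrite gt_eqF.
    have : 1 - r <= d0 by rewrite /r opprB addrC subrK ge_min lexx.
    by move: (_^-1) => x; lra.
  apply: (@le_trans _ _ (1 + 2 * (1 - beta') * (- (2 * (1 - beta))^-1 + 8 * d0))).
    by rewrite lerD2l ler_wpM2l // mulr_ge0 // ltW.
  rewrite le_eqVlt; apply/orP; left; apply/eqP; rewrite /d0; field.
  by rewrite !gt_eqF.
have c01 : 0 < complex.Re (c 0%N) by rewrite c0.
have [t t01 ht] := psum_segment hc z1 c01 c_le0.
set z := t%:C * _ in ht.
have z'1 : cabs z < 1 by exact: real_scale.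
have zz0 : z != 0.
  rewrite -cabs_gt0 cabsM cabsN !cabs_real mulr_gt0 // normr_gt0 gt_eqF //.
    by case/andP: t01.
  by case/andP: r01.
have zI : complex.Im z = 0 by rewrite ImCM ImN /= oppr0 mulr0.
have cz : psum c z = 0.
  apply: complex_ReIm; rewrite ?ht //.
  by rewrite (psum_P_extremal_Im psi_real).
have := hgt z z'1 zz0.
have -> : psum (fun n => n.+1%:R * B (extremal_coef s) n) z = psum c z.
  by apply: eq_psum => n; rewrite /c psi_P /hcoef subrr !mul0r addr0.
by rewrite cz mul0r ltxx.
Qed.

End Duality.

Theorem theorem2p1 (R : realType) (alpha gamma xi mu nu beta : R)
    (lam g q : R -> R)
    (alpha_ge0 : 0 <= alpha) (gamma_gt0 : 0 < gamma) (xi01 : 0 <= xi <= 1)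
    (mu_gt0 : 0 < mu) (nu_gt0 : 0 < nu)
    (munuD : mu + nu = alpha - gamma) (munuM : mu * nu = gamma)
    (lam_ge0 : forall t : R, 0 <= t <= 1 -> 0 <= lam t)
    (lam_int : (@lebesgue_measure R).-integrable `[0, 1] (EFin \o lam))
    (lam_mass : \int[@lebesgue_measure R]_(t in `[0, 1]) lam t = 1)
    (g_sol : solves_g mu nu g) (q_sol : solves_q mu nu q)
    (beta_lt1 : beta < 1)
    (beta_eq : beta / (1 - beta) =
       - \int[@lebesgue_measure R]_(t in `[0, 1])
           (lam t * ((1 - xi) * g t + xi * (2 * q t - 1))))
    (Lambda_lim : t `^ nu^-1 * Lambda_ nu lam t @[t --> 0^'+] --> (0 : R))
    (Pi_lim : t `^ mu^-1 * Pi_ mu nu lam t @[t --> 0^'+] --> (0 : R)) :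
  ((forall eps : R[i], `|eps| = 1 -> (0 <= N_ mu nu lam xi (h_ eps))%E)
   <-> (forall f : R[i] -> R[i],
          class_W beta alpha gamma f -> pascu xi (V_op lam f)))
  /\ (forall beta' : R, beta' < beta ->
        exists f : R[i] -> R[i],
          class_W beta' alpha gamma f /\ ~ pascu xi (V_op lam f)).
Proof.
pose b := beta / (1 - beta).
have lam0 (t : R) : 0 < t < 1 -> 0 <= lam t.
  by move=> /andP[t0 t1]; rewrite lam_ge0 // !ltW.
have I01 : (`]0%R, 1%R[%classic : set R) `<=` `[0%R, 1%R]%classic.
  exact: subset_itv_oo_cc.
have ilam : (@lebesgue_measure R).-integrable `]0%R, 1%R[ (EFin \o lam).
  by move: lam_int; apply: (@integrableS _ _ R lebesgue_measure `[0, 1]%classic) => //; exact: measurable_itv.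
have lam1 : \int[@lebesgue_measure R]_(t in `]0%R, 1%R[) lam t = 1.
  rewrite -[RHS]lam_mass Rintegral_I //.
  by apply/measurable_EFinP; case/integrableP: ilam.
have mn0 : 0 < mu * nu by rewrite mulr_gt0.
have NE eps z (z1 : cabs z < 1) :=
  N_integrandE mu_gt0 nu_gt0 ilam lam0 lam1 g_sol q_sol beta_eq eps z1.
have NP eps : (0 <= N_ mu nu lam xi (h_ eps))%E <->
    forall z : R[i], cabs z < 1 ->
      (1 - b) / 2 <= complex.Re (psum (psi_coef mu nu xi lam eps) z).
  split => [N0 z z1|h].
    have : (0 <= (mu * nu * (complex.Re (psum (psi_coef mu nu xi lam eps) z)
                    - (1 - b) / 2))%:E)%E.
      rewrite -NE //; apply: (le_trans N0); apply: ereal_inf_lbound.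
      by exists z => //; rewrite unit_diskE.
    by rewrite lee_fin pmulr_rge0 // subr_ge0.
  apply: le_ereal_inf_tmp => _ [z + <-]; rewrite unit_diskE => z1.
  by rewrite NE // lee_fin pmulr_rge0 // subr_ge0 h.
have normE (eps : R[i]) : (`|eps| = 1) <-> (cabs eps = 1).
  rewrite -cabsC; split => [|->] //.
  by case.
split; first split.
- move=> N0; apply: (pascu_of_psi_bound mu_gt0 nu_gt0 munuD munuM ilam lam0 lam1 beta_lt1).
  by move=> eps /normE /N0 /NP.
- move=> hW eps /normE eps1; apply/NP.
  exact: (psi_bound_of_pascu mu_gt0 nu_gt0 munuD munuM ilam lam0 lam1 beta_lt1 hW).
move=> beta' lt_beta.
apply: (pascu_sharp mu_gt0 nu_gt0 munuD munuM ilam lam0 lam1 beta_lt1 lt_beta).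
  by move=> n; rewrite ImCM /hcoef subrr !mul0r addr0 -(rmorph_nat (real_complex R)) mulr0.
exact: (psi_near_minus1 mu_gt0 nu_gt0 ilam lam0 lam1 g_sol q_sol beta_eq xi01).
Qed.
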